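(* Let $\Lambda=(\lambda_n)_{n\ge 1}$ be a sequence of distinct points of $\mathbb{C}_{-1/2}$ satisfying $$\sum_{n}\frac{\frac12+\Re(\lambda_n)}{1+\left|\lambda_n+\frac12\right|^2}<+\infty .$$ Let $B_\Lambda$ be the Blaschke product on $\mathbb{C}_0$ whose zeros are the points $\overline{\lambda_n}+\frac12$, $n\ge1$. Then $\mathcal{D}$ realizes (by restriction) an isometric isomorphism between $M_\Lambda^2$ and the model space $K_{B_\Lambda}$.
   Context: For $a\in\mathbb{R}$, $\mathbb{C}_a=\{z\in\mathbb{C}:\Re(z)>a\}$. For $\lambda\in\mathbb{C}_{-1/2}$, $e_\lambda(t)=t^\lambda=\exp(\lambda\ln t)$ for $t\in(0,1]$; this belongs to $L^2([0,1],dx)$ (complex-valued functions). $M_\Lambda^2$ denotes the closed linear span of $\{e_{\lambda_n}: n\ge1\}$ in $L^2([0,1],dx)$. $\mathcal{H}^2(\mathbb{C}_0)$ is the Hardy space of functions $f$ analytic on $\mathbb{C}_0$ with $\|f\|_2=\sup_{x>0}\left(\int_{\mathbb{R}}|f(x+iy)|^2\frac{dy}{2\pi}\right)^{1/2}<\infty$. It is a reproducing kernel Hilbert space with kernel $k_\lambda(z)=\frac{1}{z+\overline\lambda}$, $\lambda,z\in\mathbb{C}_0$. The map $\mathcal{D}:L^2([0,1],ds)\to\mathcal{H}^2(\mathbb{C}_0)$ is defined by $\mathcal{D}(f)(z)=\int_0^1 f(s)s^{z-\frac12}\,ds$, $z\in\mathbb{C}_0$. The Blaschke product with zeros $(\nu_n)$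 in $\mathbb{C}_0$ is $\prod_n \alpha_n\frac{z-\nu_n}{z+\overline{\nu_n}}$ with suitable unimodular constants $\alpha_n$ making the product converge. For an inner function $\Theta$ on $\mathbb{C}_0$, the model space is $K_\Theta=(\Theta\mathcal{H}^2(\mathbb{C}_0))^\perp$, the orthogonal complement in $\mathcal{H}^2(\mathbb{C}_0)$. *)

(* Defs.v *)
From HB Require Import structures.
From mathcomp Require Import all_boot all_order all_algebra.
From mathcomp Require Import complex.
From mathcomp Require Import all_classical all_reals all_analysis.

Set Implicit Arguments.
Unset Strict Implicit.
Unset Printing Implicit Defensive.

Import Order.TTheory GRing.Theory Num.Theory.
Import numFieldNormedType.Exports.

Local Open Scope classical_set_scope.
Local Open Scope ring_scope.
Local Open Scope complex_scope.

(* [R[i]] is the field of complex numbers over [R]; [normc z : R] is the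
   modulus of [z] ([`|z|] is the same number seen in [R[i]]).  Spaces of
   functions are sets of representatives: elements of L^2([0,1]) are functions
   [R -> R[i]] considered up to a.e. equality on [0,1], and functions on a half
   plane are functions [R[i] -> R[i]] considered up to equality there. *)
Notation normc := ComplexField.Normc.normc.

Definition half_plane (R : realType) (a : R) : set R[i] :=
  [set z | a < complex.Re z].

Definition cexp (R : realType) (z : R[i]) : R[i] :=
  (expR (complex.Re z))%:C * (cos (complex.Im z) +i* sin (complex.Im z)).

(* Only meaningful for [0 < t]; as [ln 0 = 0], the value at [t = 0] is [1],
   which is irrelevant for integration over [0,1]. *)
Definition cpow (R : realType) (t : R) (l : R[i]) : R[i] :=
  cexp (l * (ln t)%:C).

Definition cintegral (R : realType) (D : set R) (f : R -> R[i]) : R[i] :=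
  (\int[lebesgue_measure]_(t in D) complex.Re (f t)) +i*
  (\int[lebesgue_measure]_(t in D) complex.Im (f t)).

Definition I01 (R : realType) : set R := `[0, 1]%classic.

Definition l2norm (R : realType) (f : R -> R[i]) : \bar R :=
  ((\int[lebesgue_measure]_(t in @I01 R) ((normc (f t)) ^+ 2)%:E) `^ 2^-1)%E.

Definition L2 (R : realType) : set (R -> R[i]) :=
  [set f | [/\ measurable_fun (@I01 R) (fun t => complex.Re (f t)),
               measurable_fun (@I01 R) (fun t => complex.Im (f t)) &
               (l2norm f < +oo)%E]].

Definition l2eq (R : realType) (f g : R -> R[i]) : Prop :=
  {ae lebesgue_measure, forall t, @I01 R t -> f t = g t}.

(* The closure in L^2([0,1]) of the linear span of the [t ^ lam n]. *)
Definition muntz_space (R : realType) (lam : nat -> R[i]) :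
    set (R -> R[i]) :=
  [set f | L2 f /\
    forall eps : R, 0 < eps -> exists (N : nat) (c : nat -> R[i]),
      (l2norm (fun t => (f t - \sum_(n < N) c n * cpow t (lam n))%R) < eps%:E)%E].

Definition hardy_norm (R : realType) (f : R[i] -> R[i]) : \bar R :=
  ereal_sup [set
    (((2 * pi)^-1%:E *
      \int[lebesgue_measure]_(y in [set: R]) ((normc (f (x +i* y))) ^+ 2)%:E)
     `^ 2^-1)%E | x in [set x : R | 0 < x]].

(* [derivable] is taken over the base field [R[i]]: complex
   differentiability. *)
Definition analytic_on (R : realType) (D : set R[i]) (f : R[i] -> R[i]) : Prop :=
  forall z, D z -> derivable (f : R[i]^o -> R[i]^o) z 1.

Definition H2 (R : realType) : set (R[i] -> R[i]) :=
  [set f | analytic_on (half_plane 0) f /\ (hardy_norm f < +oo)%E].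

Definition h2eq (R : realType) (f g : R[i] -> R[i]) : Prop :=
  {in half_plane (0 : R), f =1 g}.

(* The inner product of H^2, recovered from its norm by polarization; it is
   linear in the first argument. *)
Definition hardy_inner (R : realType) (f g : R[i] -> R[i]) : R[i] :=
  4^-1 * \sum_(k < 4) 'i ^+ k *
    (fine (hardy_norm (fun z => f z + 'i ^+ k * g z)) ^+ 2)%:C.

Definition model_space (R : realType) (Theta : R[i] -> R[i]) :
    set (R[i] -> R[i]) :=
  [set f | H2 f /\
    forall g, H2 g -> hardy_inner f (fun z => Theta z * g z) = 0].

(* [B] is a Blaschke product with zeros [nu n]; it is determined up to a
   unimodular constant factor. *)
Definition blaschke_product (R : realType) (nu : nat -> R[i])
    (B : R[i] -> R[i]) : Prop :=
  exists alpha : nat -> R[i], (forall n, normc (alpha n) = 1) /\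
    forall z, half_plane 0 z ->
      (fun N => \prod_(n < N) (alpha n * ((z - nu n) / (z + (nu n)^*)))
         : R[i]^o) @ \oo --> (B z : R[i]^o).

Definition mellin (R : realType) (f : R -> R[i]) : R[i] -> R[i] :=
  fun z => cintegral (@I01 R) (fun s => f s * cpow s (z - 2^-1)).

(* [U] induces a linear isometric bijection between the quotients of [M] by
   [eqM] and of [K] by [eqK]. *)
Definition isometric_isomorphism (R : realType) (S T : Type)
    (M : set (S -> R[i])) (eqM : (S -> R[i]) -> (S -> R[i]) -> Prop)
    (normM : (S -> R[i]) -> \bar R)
    (K : set (T -> R[i])) (eqK : (T -> R[i]) -> (T -> R[i]) -> Prop)
    (normK : (T -> R[i]) -> \bar R)
    (U : (S -> R[i]) -> (T -> R[i])) : Prop :=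
  [/\ forall f, M f -> K (U f),
      forall f g, M f -> M g -> (eqM f g <-> eqK (U f) (U g)),
      forall (a : R[i]) f g, M f -> M g ->
        eqK (U (fun s => a * f s + g s)) (fun t => a * U f t + U g t),
      forall f, M f -> normK (U f) = normM f &
      forall g, K g -> exists2 f, M f & eqK (U f) g].

(* Main.v *)
Require Import Defs.
From HB Require Import structures.
From mathcomp Require Import all_boot all_order all_algebra.
From mathcomp Require Import complex.
From mathcomp Require Import all_classical all_reals all_analysis.
From mathcomp Require Import measurable_realfun.
From mathcomp Require Import ring lra.

Set Implicit Arguments.
Unset Strict Implicit.
Unset Printing Implicit Defensive.

Import Order.TTheory GRing.Theory Num.Theory.
Import numFieldNormedType.Exports.

Local Open Scope classical_set_scope.
Local Open Scope ring_scope.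
Local Open Scope complex_scope.

(** Write [k_w(z) = 1 / (z + conj w)] for the reproducing kernel of the Hardy
    space at [w].  The transform sends the power [t ^ l] to [1 / (z + l + 1/2)],
    which is the kernel of the point [conj l + 1/2]; for the exponents [lam n]
    these points are exactly the prescribed zeros [nu n] of the Blaschke product
    [B].  So the theorem compares the closed span of the powers with the closed
    span of the kernels at the zeros of [B], which is the model space.

    Isometry.  By the reproducing property, the Gram matrix of the kernels [k_(nu
    n)] consists of their values at the points [nu m], and it coincides with the
    Gram matrix of the powers (nsq_mpoly).  Hence the transform preserves norms on
    linear combinations, and then on their closure (muntz_isometry), because the
    Hardy space is stable under norm bounded pointwise limits (H2_closure).

    Range.  A function [B g] vanishes at every [nu n], so it is orthogonal to the
    kernels at these points and to their closed span (mellin_orthogonal).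
    Conversely let [g] be in the model space.  The best approximation of [g] by
    combinations of kernels corresponds to some [f] in the Muntz space
    (muntz_interpolation, where completeness of L^2 provides [f]), and [h = g -
    mellin f] vanishes at all [nu n] and is orthogonal to [B H^2].  Such an [h] is
    zero (vanishing_orthogonal_eq0): divide out the first [N] zeros, which gives
    [h = B_N h_N], where [B_N] is the partial product and [h_N] has no larger norm
    than [h] (H2_divide).  Then [B h_N] tends to [h] pointwise, because [B / B_N]
    tends to [1] off the zeros, has norm at most that of [h] and is orthogonal to
    [h]; so [h + B h_N] has squared norm at most [2 |h|^2], while its limit [2 h]
    has squared norm [4 |h|^2].

    The inner product of the Hardy space is defined by polarizing a supremum of
    norms along vertical lines, and everything rests on that supremum being a
    limit at the boundary (hardy_on_mono).  This follows from Poisson's formula on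
    a half plane, obtained from Goursat's theorem on rectangles: Cauchy's formula
    (cauchy_halfplane) comes by subtracting from [f] a multiple of [K(z) = 2 xi /
    (z + conj w - 2 x0)], where [xi = Re w - x0] and so [K(w) = 1], and
    integrating the quotient by [z - w] over growing rectangles.  The reproducing
    property, bounded limits and division by a Blaschke factor are consequences of
    the two formulas.

    The Blaschke condition makes [1 - |b_n(z)|^2] summable at every point [z],
    where [b_n] is the factor vanishing at [nu n].  This gives the existence of
    [B] (blaschke_exists) and the absence of zeros off the points [nu n]
    (blaschke_neq0). *)

Local Notation Re := complex.Re.
Local Notation Im := complex.Im.

(** * Modulus, convergence and differentiability in the complex numbers *)

Section ComplexBasics.
Context {R : realType}.
Implicit Types z w : R[i].

Lemma cReD z w : Re (z + w) = Re z + Re w. Proof. by case: z w => ? ? [? ?]. Qed.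
Lemma cImD z w : Im (z + w) = Im z + Im w. Proof. by case: z w => ? ? [? ?]. Qed.
Lemma cReN z : Re (- z) = - Re z. Proof. by case: z. Qed.
Lemma cImN z : Im (- z) = - Im z. Proof. by case: z. Qed.
Lemma cReB z w : Re (z - w) = Re z - Re w. Proof. by rewrite cReD cReN. Qed.
Lemma cImB z w : Im (z - w) = Im z - Im w. Proof. by rewrite cImD cImN. Qed.
Lemma cReM z w : Re (z * w) = Re z * Re w - Im z * Im w.
Proof. by case: z w => ? ? [? ?]. Qed.
Lemma cImM z w : Im (z * w) = Re z * Im w + Im z * Re w.
Proof. by case: z w => ? ? [? ?]. Qed.
Lemma cReJ z : Re (conjc z) = Re z. Proof. by case: z. Qed.
Lemma cImJ z : Im (conjc z) = - Im z. Proof. by case: z. Qed.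
Lemma complexP z w : Re z = Re w -> Im z = Im w -> z = w.
Proof. by case: z w => ? ? [? ?] /= -> ->. Qed.

Lemma normc_ge0 z : 0 <= normc z.
Proof. by case: z => a b; rewrite /= sqrtr_ge0. Qed.
Hint Resolve normc_ge0 : core.

Lemma sqr_normcE z : normc z ^+ 2 = Re z ^+ 2 + Im z ^+ 2.
Proof. by case: z => a b; rewrite /= sqr_sqrtr// addr_ge0// sqr_ge0. Qed.

Lemma normc_eq0 z : (normc z == 0) = (z == 0).
Proof.
apply/eqP/eqP => [/ComplexField.Normc.eq0_normc//|->].
by rewrite ComplexField.Normc.normc0.
Qed.

Lemma normc_gt0 z : (0 < normc z) = (z != 0).
Proof. by rewrite lt_neqAle normc_ge0 andbT eq_sym normc_eq0. Qed.

Lemma normc_normr z : `|z| = (normc z)%:C.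
Proof. by rewrite normc_def; case: z. Qed.

Lemma normcM z w : normc (z * w) = normc z * normc w.
Proof. exact: ComplexField.Normc.normcM. Qed.

Lemma normc_conj z : normc (conjc z) = normc z.
Proof. by case: z => a b /=; rewrite sqrrN. Qed.

Lemma normc_real (x : R) : normc x%:C = `|x|.
Proof. by rewrite /= expr0n addr0 sqrtr_sqr. Qed.

Lemma normcB z w : normc (z - w) <= normc z + normc w.
Proof. by rewrite (le_trans (le_normcD _ _))// normcN. Qed.

Lemma normcBC z w : normc (z - w) = normc (w - z).
Proof. by rewrite -normcN opprB. Qed.

Lemma Re_le_normc z : `|Re z| <= normc z.
Proof.
rewrite -ler_sqr ?nnegrE// sqr_normcE real_normK ?num_real//.
by rewrite lerDl sqr_ge0.
Qed.

Lemma Im_le_normc z : `|Im z| <= normc z.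
Proof.
rewrite -ler_sqr ?nnegrE// sqr_normcE real_normK ?num_real//.
by rewrite lerDr sqr_ge0.
Qed.

Lemma normc_le_ReIm z : normc z <= `|Re z| + `|Im z|.
Proof.
rewrite -ler_sqr ?nnegrE ?addr_ge0// sqr_normcE sqrrD !real_normK ?num_real//.
by rewrite addrAC lerDl mulrn_wge0// mulr_ge0.
Qed.

Lemma mulc_conj z : z * conjc z = ((normc z) ^+ 2)%:C.
Proof. by rewrite -sqr_normc normc_normr -rmorphXn. Qed.

Lemma addlineE (x y : R) : x +i* y = x%:C + 'i * y%:C.
Proof. by apply: complexP; simpc. Qed.

(** The norm of [R[i]] has values in [R[i]], so its balls have complex radii;
    such radii are real, which allows real estimates throughout. *)
Lemma cvg_normcP (T : Type) (F : set_system T) (FF : Filter F)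
    (g : T -> R[i]^o) (l : R[i]^o) :
  g @ F --> l <-> forall e : R, 0 < e -> \forall t \near F, normc (g t - l) < e.
Proof.
split=> [/cvgrPdist_lt gl e e0|gl].
  have := gl e%:C; rewrite ltcR => /(_ e0); apply: filterS => t.
  by rewrite normc_normr ltcR normcBC.
apply/cvgrPdist_lt => e e0.
have eE : e = (Re e)%:C.
  by apply: complexP => //=; apply/ger0_Im/ltW.
rewrite eE; have /gl : 0 < Re e by move: e0; rewrite {1}eE ltcR.
by apply: filterS => t; rewrite normc_normr ltcR normcBC.
Qed.

Lemma cvg_complexP (T : Type) (F : set_system T) (FF : Filter F)
    (g : T -> R[i]^o) (l : R[i]^o) :
  g @ F --> l <-> ((fun t => Re (g t)) @ F --> Re l /\
                   (fun t => Im (g t)) @ F --> Im l).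
Proof.
rewrite cvg_normcP; split => [gl|[/cvgrPdist_lt gR /cvgrPdist_lt gI] e e0].
  split; apply/cvgrPdist_lt => e /gl; apply: filterS => t; apply: le_lt_trans.
    by rewrite distrC -cReB Re_le_normc.
  by rewrite distrC -cImB Im_le_normc.
have e20 : 0 < e / 2 by rewrite divr_gt0.
near=> t; rewrite (le_lt_trans (normc_le_ReIm _))// (splitr e) ltrD//.
  by rewrite cReB distrC; near: t; exact: gR.
by rewrite cImB distrC; near: t; exact: gI.
Unshelve. all: by end_near. Qed.

Lemma continuous_complexP (T : topologicalType) (g : T -> R[i]^o) :
  continuous g <-> (continuous (fun t => Re (g t)) /\
                    continuous (fun t => Im (g t))).
Proof.
split=> [cg|[cR cI] t]; last by apply/cvg_complexP; split; [exact: cR|exact: cI].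
by split => t; have /cvg_complexP[] := cg t.
Qed.

Lemma cvg_normc (T : Type) (F : set_system T) {FF : Filter F}
    (g : T -> R[i]^o) (l : R[i]^o) :
  g @ F --> l -> (fun t => normc (g t)) @ F --> normc l.
Proof.
move=> /cvg_normcP gl; apply/cvgrPdist_lt => e /gl; apply: filterS => t.
apply: le_lt_trans; rewrite ler_norml.
have := le_normcD (g t - l) l; rewrite subrK.
have := le_normcD (l - g t) (g t); rewrite subrK normcBC.
by move=> ? ?; apply/andP; split; lra.
Qed.

Lemma continuous_line (x : R) : continuous (fun y : R => (x +i* y) : R[i]^o).
Proof. by apply/continuous_complexP; split=> t /=; [exact: cvg_cst|exact: cvg_id]. Qed.

Lemma continuous_hline (y : R) : continuous (fun x : R => (x +i* y) : R[i]^o).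
Proof. by apply/continuous_complexP; split=> t /=; [exact: cvg_id|exact: cvg_cst]. Qed.

Lemma derivable_cts (f : R[i] -> R[i]) z :
  derivable (f : R[i]^o -> R[i]^o) z 1 -> {for z, continuous (f : R[i]^o -> R[i]^o)}.
Proof. by move=> /derivable1_diffP/differentiable_continuous. Qed.

Lemma derivable_normcP (f : R[i] -> R[i]) z :
  derivable (f : R[i]^o -> R[i]^o) z 1 <->
  exists l : R[i], forall e : R, 0 < e -> exists2 d : R, 0 < d &
    forall w, 0 < normc (w - z) -> normc (w - z) < d ->
      normc ((f w - f z) / (w - z) - l) < e.
Proof.
split=> [df|[l hl]].
  exists ('D_1 (f : R[i]^o -> R[i]^o) z) => e e0.
  have /cvg_ex[l hl] := df.
  have -> : 'D_1 (f : R[i]^o -> R[i]^o) z = l by rewrite /derive; exact: cvg_lim hl.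
  move/cvg_normcP : hl => /(_ e e0).
  move=> /nbhs_ballP[d /= d0 hd].
  have dE : d = (Re d)%:C by apply: complexP => //=; exact/ger0_Im/ltW.
  exists (Re d); first by move: d0; rewrite {1}dE ltcR.
  move=> w w0 wd; have := hd (w - z).
  rewrite /ball/= sub0r normrN normc_normr dE ltcR => /(_ wd).
  have -> : w - z != 0 by rewrite -normc_gt0.
  move=> /(_ isT); rewrite /= [_%:A]mulr1 subrK => h.
  by rewrite mulrC.
apply/cvg_ex; exists l; apply/cvg_normcP => e /hl[d d0 hd].
apply/nbhs_ballP; exists d%:C; first by rewrite /= ltcR.
move=> h; rewrite /ball/= sub0r normrN normc_normr ltcR => hd1 h0.
have := hd (z + h); rewrite addrAC subrr add0r normc_gt0 => /(_ h0 hd1).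
by rewrite mulrC [h%:A]mulr1 [h + z]addrC.
Qed.

End ComplexBasics.
#[global] Hint Resolve normc_ge0 : core.

(** * Integrals of complex-valued functions *)

Section ComplexIntegral.
Context {R : realType}.
Local Notation mu := (@lebesgue_measure R).
Implicit Types (D : set R) (f g : R -> R[i]).

Definition cmeasurable D f :=
  measurable_fun D (fun t => Re (f t)) /\ measurable_fun D (fun t => Im (f t)).

Definition cintegrable D f :=
  mu.-integrable D (EFin \o (fun t => Re (f t))) /\
  mu.-integrable D (EFin \o (fun t => Im (f t))).

Lemma cmeasurable_cst D (a : R[i]) : cmeasurable D (fun=> a).
Proof. by split; exact: measurable_cst. Qed.

Lemma cmeasurableD D f g : cmeasurable D f -> cmeasurable D g ->
  cmeasurable D (fun t => f t + g t).
Proof.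
move=> [fR fI] [gR gI]; split.
  by under eq_fun do rewrite cReD; exact: measurable_funD.
by under eq_fun do rewrite cImD; exact: measurable_funD.
Qed.

Lemma cmeasurableM D f g : cmeasurable D f -> cmeasurable D g ->
  cmeasurable D (fun t => f t * g t).
Proof.
move=> [fR fI] [gR gI]; split.
  by under eq_fun do rewrite cReM; apply: measurable_funB; exact: measurable_funM.
by under eq_fun do rewrite cImM; apply: measurable_funD; exact: measurable_funM.
Qed.

Lemma cmeasurableZ D (a : R[i]) f : cmeasurable D f ->
  cmeasurable D (fun t => a * f t).
Proof. exact/cmeasurableM/cmeasurable_cst. Qed.

Lemma cmeasurableJ D f : cmeasurable D f -> cmeasurable D (fun t => conjc (f t)).
Proof.
move=> [fR fI]; split.
  by under eq_fun do rewrite cReJ.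
by under eq_fun do rewrite cImJ; exact: measurable_funN.
Qed.

Lemma measurable_normc D f : cmeasurable D f -> measurable_fun D (fun t => normc (f t)).
Proof.
move=> [fR fI].
rewrite (_ : (fun _ => _) = Num.sqrt \o (fun t => Re (f t) ^+ 2 + Im (f t) ^+ 2)).
  apply: measurableT_comp; first by
    apply: continuous_measurable_fun; exact: sqrt_continuous.
  by apply: measurable_funD; exact: measurable_funX.
by apply/funext => t /=; case: (f t).
Qed.

Lemma measurable_normc_sqr D f : cmeasurable D f ->
  measurable_fun D (fun t => normc (f t) ^+ 2).
Proof. by move=> /measurable_normc; exact: measurable_funX. Qed.

Lemma continuous_cmeasurable D f : measurable D ->
  continuous (f : R -> R[i]^o) -> cmeasurable D f.
Proof.
move=> mD /continuous_complexP[cR cI]; split; apply: measurable_funTS;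
  exact: continuous_measurable_fun.
Qed.

Lemma cmeasurable_cvg D (f_ : nat -> R -> R[i]) f :
  (forall n, cmeasurable D (f_ n)) ->
  (forall t, D t -> (f_ n t : R[i]^o) @[n --> \oo] --> (f t : R[i]^o)) ->
  cmeasurable D f.
Proof.
move=> mf cf; split.
  apply: (@measurable_fun_cvg _ _ _ _ (fun n t => Re (f_ n t))) => [n|t /cf].
    by have [] := mf n.
  by move=> /cvg_complexP[].
apply: (@measurable_fun_cvg _ _ _ _ (fun n t => Im (f_ n t))) => [n|t /cf].
  by have [] := mf n.
by move=> /cvg_complexP[].
Qed.

Lemma cintegrable_cmeasurable D f : cintegrable D f -> cmeasurable D f.
Proof.
by move=> [/measurable_int/measurable_EFinP fR /measurable_int/measurable_EFinP fI].
Qed.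

Lemma le_cintegrable D f (g : R -> R) : measurable D -> cmeasurable D f ->
  mu.-integrable D (EFin \o g) -> (forall t, D t -> normc (f t) <= g t) ->
  cintegrable D f.
Proof.
move=> mD [fR fI] ig fg; split; apply: le_integrable ig => //=.
- exact/measurable_EFinP.
- move=> t Dt; rewrite lee_fin (le_trans (Re_le_normc _))//.
  by rewrite (le_trans (fg _ Dt)) ?ler_norm.
- exact/measurable_EFinP.
- move=> t Dt; rewrite lee_fin (le_trans (Im_le_normc _))//.
  by rewrite (le_trans (fg _ Dt)) ?ler_norm.
Qed.

Lemma integrable_normc D f : measurable D -> cintegrable D f ->
  mu.-integrable D (EFin \o (fun t => normc (f t))).
Proof.
move=> mD [fR fI].
have := integrableD (mu:=mu) mD (integrable_abse fR) (integrable_abse fI).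
apply: le_integrable => //=.
  apply/measurable_EFinP; apply: measurable_normc.
  exact: cintegrable_cmeasurable.
move=> t Dt; rewrite lee_fin ger0_norm ?normc_ge0//.
by rewrite (le_trans (normc_le_ReIm _))// ler_norm.
Qed.

Lemma rintegrableZ D (k : R) (g : R -> R) : measurable D ->
  mu.-integrable D (EFin \o g) -> mu.-integrable D (EFin \o (fun t => k * g t)).
Proof.
move=> mD ig; have := integrableZl (mu:=mu) mD k ig; exact: eq_integrable.
Qed.

Lemma rintegrableD D (f g : R -> R) : measurable D ->
  mu.-integrable D (EFin \o f) -> mu.-integrable D (EFin \o g) ->
  mu.-integrable D (EFin \o (fun t => f t + g t)).
Proof.
move=> mD fi ig; have := integrableD (mu:=mu) mD fi ig; exact: eq_integrable.
Qed.

Lemma cintegrableD D f g : measurable D -> cintegrable D f -> cintegrable D g ->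
  cintegrable D (fun t => f t + g t).
Proof.
move=> mD [fR fI] [gR gI]; split.
  by have := rintegrableD mD fR gR; apply: eq_integrable => // t _ /=; rewrite cReD.
by have := rintegrableD mD fI gI; apply: eq_integrable => // t _ /=; rewrite cImD.
Qed.

Lemma cintegrableZ D (a : R[i]) f : measurable D -> cintegrable D f ->
  cintegrable D (fun t => a * f t).
Proof.
move=> mD fi; apply: (@le_cintegrable _ _ (fun t => normc a * normc (f t))) => //.
- exact/cmeasurableZ/cintegrable_cmeasurable.
- by apply: rintegrableZ => //; exact: integrable_normc.
- by move=> t _; rewrite normcM.
Qed.

Lemma cintegrableB D f g : measurable D -> cintegrable D f -> cintegrable D g ->
  cintegrable D (fun t => f t - g t).
Proof.
move=> mD fi gi; apply: cintegrableD => //.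
rewrite (_ : (fun _ => _) = (fun t => -1 * g t)); first exact: cintegrableZ.
by apply/funext => t; rewrite mulN1r.
Qed.

Lemma Re_cintegral D f :
  Re (cintegral D f) = \int[mu]_(t in D) Re (f t).
Proof. by []. Qed.

Lemma Im_cintegral D f :
  Im (cintegral D f) = \int[mu]_(t in D) Im (f t).
Proof. by []. Qed.

Lemma eq_cintegral D f g : (forall t, D t -> f t = g t) ->
  cintegral D f = cintegral D g.
Proof.
move=> fg; rewrite /cintegral.
by congr Complex; apply: eq_Rintegral => t /set_mem Dt; rewrite fg.
Qed.

Lemma cintegralD D f g : measurable D -> cintegrable D f -> cintegrable D g ->
  cintegral D (fun t => f t + g t) = cintegral D f + cintegral D g.
Proof.
move=> mD [fR fI] [gR gI]; rewrite /cintegral; apply: complexP => /=.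
  by rewrite -RintegralD//; apply: eq_Rintegral => t _; rewrite cReD.
by rewrite -RintegralD//; apply: eq_Rintegral => t _; rewrite cImD.
Qed.

Lemma cintegralZ D (a : R[i]) f : measurable D -> cintegrable D f ->
  cintegral D (fun t => a * f t) = a * cintegral D f.
Proof.
move=> mD [fR fI]; apply: complexP.
  rewrite cReM !Re_cintegral Im_cintegral -!RintegralZl// -RintegralB//.
  - by apply: eq_Rintegral => t _; rewrite cReM.
  - exact: rintegrableZ.
  - exact: rintegrableZ.
rewrite cImM !Im_cintegral Re_cintegral -!RintegralZl// -RintegralD//.
- by apply: eq_Rintegral => t _; rewrite cImM.
- exact: rintegrableZ.
- exact: rintegrableZ.
Qed.

Lemma cintegralB D f g : measurable D -> cintegrable D f -> cintegrable D g ->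
  cintegral D (fun t => f t - g t) = cintegral D f - cintegral D g.
Proof.
move=> mD [fR fI] [gR gI]; apply: complexP.
  by rewrite cReB !Re_cintegral -RintegralB//; apply: eq_Rintegral => t _; rewrite cReB.
by rewrite cImB !Im_cintegral -RintegralB//; apply: eq_Rintegral => t _; rewrite cImB.
Qed.

Lemma cintegralJ D f : measurable D -> cintegrable D f ->
  cintegral D (fun t => conjc (f t)) = conjc (cintegral D f).
Proof.
move=> mD [fR fI]; apply: complexP; rewrite ?cReJ ?cImJ.
  by apply: eq_Rintegral => t _; rewrite cReJ.
rewrite !Im_cintegral -mulN1r -RintegralZl//.
by apply: eq_Rintegral => t _; rewrite cImJ mulN1r.
Qed.

Lemma cintegral0 D : cintegral D (fun=> 0 : R[i]) = 0.
Proof. by apply: complexP; rewrite /= /Rintegral integral0. Qed.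

Lemma cintegrable0 D : measurable D -> cintegrable D (fun=> 0 : R[i]).
Proof. by move=> mD; split; apply: integrable0. Qed.

Lemma cintegrable_sum D n (F : 'I_n -> R -> R[i]) : measurable D ->
  (forall i, cintegrable D (F i)) -> cintegrable D (fun t => \sum_(i < n) F i t).
Proof.
move=> mD; elim: n F => [|n IH] F iF.
  by under eq_fun do rewrite big_ord0; exact: cintegrable0.
by under eq_fun do rewrite big_ord_recr; apply: cintegrableD => //; exact: IH.
Qed.

Lemma cintegral_sum D n (F : 'I_n -> R -> R[i]) : measurable D ->
  (forall i, cintegrable D (F i)) ->
  cintegral D (fun t => \sum_(i < n) F i t) = \sum_(i < n) cintegral D (F i).
Proof.
move=> mD; elim: n F => [|n IH] F iF.
  by under eq_fun do rewrite big_ord0; rewrite big_ord0 cintegral0.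
under eq_fun do rewrite big_ord_recr; rewrite big_ord_recr/= cintegralD// ?IH//.
exact: cintegrable_sum.
Qed.

(** Rotate the integral onto the positive real axis; then only real parts
    contribute. *)
Lemma normc_cintegral_le D f : measurable D -> cintegrable D f ->
  normc (cintegral D f) <= \int[mu]_(t in D) normc (f t).
Proof.
move=> mD fi; have [->|I0] := eqVneq (cintegral D f) 0.
  rewrite ComplexField.Normc.normc0; apply: Rintegral_ge0 => t _.
  exact: normc_ge0.
set I := cintegral D f in I0 *.
have nI0 : 0 < normc I by rewrite normc_gt0.
pose u : R[i] := conjc I * ((normc I)^-1)%:C.
have nu : normc u = 1.
  by rewrite normcM normc_conj normc_real gtr0_norm ?invr_gt0// divff// gt_eqF.
have -> : normc I = Re (u * I).
  rewrite /u mulrAC [_ * I]mulrC mulc_conj -rmorphM/= expr2 -mulrA divff ?mulr1//.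
  by rewrite gt_eqF.
rewrite -cintegralZ//= le_Rintegral//.
- by have [] := cintegrableZ u mD fi.
- exact: integrable_normc.
- move=> t Dt; rewrite (le_trans (ler_norm _))// (le_trans (Re_le_normc _))//.
  by rewrite normcM nu mul1r.
Qed.

Lemma Rintegral_cvg D (f_ : nat -> R -> R) (f g : R -> R) : measurable D ->
  (forall n, measurable_fun D (f_ n)) ->
  (forall t, D t -> f_ n t @[n --> \oo] --> f t) ->
  mu.-integrable D (EFin \o g) ->
  (forall n t, D t -> `|f_ n t| <= g t) ->
  mu.-integrable D (EFin \o f) /\
  (\int[mu]_(t in D) f_ n t) @[n --> \oo] --> \int[mu]_(t in D) f t.
Proof.
move=> mD mf cf ig fg.
have mf' : measurable_fun D f by exact: measurable_fun_cvg cf.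
have [||||fi _ fc] := @dominated_convergence _ _ _ mu D mD
  (fun n => EFin \o f_ n) (EFin \o f) (EFin \o g) _ _ _ ig.
- by move=> n; apply/measurable_EFinP; exact: mf.
- by apply/measurable_EFinP.
- by apply: aeW => t Dt; apply: cvg_EFin; [exact: nearW|exact: cf].
- by apply: aeW => t n Dt /=; rewrite lee_fin fg.
split => //; apply: fine_cvg.
rewrite fineK//; exact: integrable_fin_num.
Qed.

Lemma cintegral_cvg D (f_ : nat -> R -> R[i]) f (g : R -> R) : measurable D ->
  (forall n, cmeasurable D (f_ n)) ->
  (forall t, D t -> (f_ n t : R[i]^o) @[n --> \oo] --> (f t : R[i]^o)) ->
  mu.-integrable D (EFin \o g) ->
  (forall n t, D t -> normc (f_ n t) <= g t) ->
  cintegrable D f /\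
  (cintegral D (f_ n) : R[i]^o) @[n --> \oo] --> (cintegral D f : R[i]^o).
Proof.
move=> mD mf cf ig fg.
have mf' : cmeasurable D f by apply: cmeasurable_cvg cf.
have [iR cR] := @Rintegral_cvg D (fun n t => Re (f_ n t)) (fun t => Re (f t)) g mD
  (fun n => (mf n).1)
  (fun t Dt => ((cvg_complexP _ _ _).1 (cf t Dt)).1) ig
  (fun n t Dt => le_trans (Re_le_normc _) (fg n t Dt)).
have [iI cI] := @Rintegral_cvg D (fun n t => Im (f_ n t)) (fun t => Im (f t)) g mD
  (fun n => (mf n).2)
  (fun t Dt => ((cvg_complexP _ _ _).1 (cf t Dt)).2) ig
  (fun n t Dt => le_trans (Im_le_normc _) (fg n t Dt)).
by split => //; apply/cvg_complexP; split.
Qed.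

End ComplexIntegral.

(** * Square integrable functions *)

(** The weighted bounds are sharpest at [t = x / A]; when [A = 0], letting [t]
    grow forces [x = 0]. *)
Lemma sqr_le_of_weighted (R : realFieldType) (x A B : R) :
  0 <= x -> 0 <= A -> 0 <= B ->
  (forall t, 0 < t -> 2 * x <= t * A + t^-1 * B) -> x ^+ 2 <= A * B.
Proof.
move=> x0 A0 B0 h; have [->|xn0] := eqVneq x 0.
  by rewrite expr0n mulr_ge0.
have {}x0 : 0 < x by rewrite lt_neqAle eq_sym xn0.
have [A00|An0] := eqVneq A 0.
  exfalso; have t0 : 0 < B / x + 1 by rewrite ltr_wpDl// divr_ge0// ltW.
  have := h _ t0; rewrite A00 mulr0 add0r [leRHS]mulrC ler_pdivlMr//.
  have -> : 2 * x * (B / x + 1) = 2 * (B + x) by field.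
  lra.
have {}A0 : 0 < A by rewrite lt_neqAle eq_sym An0.
have := h _ (divr_gt0 x0 A0); rewrite divfK// invf_div.
rewrite -(ler_pM2l x0).
have -> : x * (x + A / x * B) = x ^+ 2 + A * B by field.
nra.
Qed.

Section SquareIntegrable.
Context {R : realType}.
Local Notation mu := (@lebesgue_measure R).
Implicit Types (D : set R) (f g : R -> R[i]).

Definition sqint D f :=
  cmeasurable D f /\ mu.-integrable D (EFin \o (fun t => normc (f t) ^+ 2)).

Definition nsq D f := \int[mu]_(t in D) normc (f t) ^+ 2.

Lemma nsq_ge0 D f : 0 <= nsq D f.
Proof. by apply: Rintegral_ge0 => t _; exact: sqr_ge0. Qed.

Lemma eq_sqint D f g : (f =1 g) -> sqint D f -> sqint D g.
Proof. by move=> /funext ->. Qed.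

Lemma eq_nsq D f g : (forall t, D t -> normc (f t) = normc (g t)) -> nsq D f = nsq D g.
Proof. by move=> fg; apply: eq_Rintegral => t /set_mem Dt; rewrite fg. Qed.

Lemma le_sqint D f (g : R -> R) : measurable D -> cmeasurable D f ->
  mu.-integrable D (EFin \o g) -> (forall t, D t -> normc (f t) ^+ 2 <= g t) ->
  sqint D f.
Proof.
move=> mD mf ig fg; split => //; apply: le_integrable ig => //=.
  by apply/measurable_EFinP; exact: measurable_normc_sqr.
move=> t Dt; rewrite lee_fin ger0_norm ?sqr_ge0//.
by rewrite (le_trans (fg _ Dt))// ler_norm.
Qed.

Lemma sqintP D f (M : R) : measurable D -> cmeasurable D f ->
  (\int[mu]_(t in D) (normc (f t) ^+ 2)%:E <= M%:E)%E <->
  sqint D f /\ nsq D f <= M.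
Proof.
move=> mD mf; split=> [fM|[[_ fi] fM]].
  have fi : sqint D f.
    split => //; apply/integrableP; split.
      by apply/measurable_EFinP; exact: measurable_normc_sqr.
    under eq_integral do rewrite gee0_abs ?lee_fin ?sqr_ge0//.
    by rewrite (le_lt_trans fM)// ltry.
  split => //; rewrite -lee_fin /nsq /Rintegral fineK//.
  by apply: integrable_fin_num => //; have [] := fi.
have := fM; rewrite -lee_fin /nsq /Rintegral fineK//.
exact: integrable_fin_num.
Qed.

Lemma nsqE D f : measurable D -> sqint D f ->
  (\int[mu]_(t in D) (normc (f t) ^+ 2)%:E)%E = (nsq D f)%:E.
Proof.
move=> mD [_ fi]; rewrite /nsq /Rintegral fineK//; exact: integrable_fin_num.
Qed.

Lemma sqintZ D (a : R[i]) f : measurable D -> sqint D f ->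
  sqint D (fun t => a * f t).
Proof.
move=> mD [mf fi].
apply: (@le_sqint _ _ (fun t => normc a ^+ 2 * normc (f t) ^+ 2)) => //.
- exact: cmeasurableZ.
- exact: rintegrableZ.
- by move=> t _; rewrite normcM exprMn.
Qed.

Lemma sqr_normcD_le (z w : R[i]) :
  normc (z + w) ^+ 2 <= 2 * normc z ^+ 2 + 2 * normc w ^+ 2.
Proof.
have : normc (z + w) ^+ 2 <= (normc z + normc w) ^+ 2.
  by rewrite ler_sqr ?nnegrE ?addr_ge0 ?normc_ge0// le_normcD.
have := sqr_ge0 (normc z - normc w); nra.
Qed.

Lemma sqintD D f g : measurable D -> sqint D f -> sqint D g ->
  sqint D (fun t => f t + g t).
Proof.
move=> mD [mf fi] [mg gi].
apply: (@le_sqint _ _ (fun t => 2 * normc (f t) ^+ 2 + 2 * normc (g t) ^+ 2)) => //.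
- exact: cmeasurableD.
- by apply: rintegrableD => //; exact: rintegrableZ.
- by move=> t _; exact: sqr_normcD_le.
Qed.

Lemma sqintN D f : measurable D -> sqint D f -> sqint D (fun t => - f t).
Proof.
move=> mD fi; apply: (@eq_sqint _ (fun t => -1 * f t)) => [t|].
  by rewrite mulN1r.
exact: sqintZ.
Qed.

Lemma sqintB D f g : measurable D -> sqint D f -> sqint D g ->
  sqint D (fun t => f t - g t).
Proof. by move=> mD fi gi; apply: sqintD => //; exact: sqintN. Qed.

Lemma sqintJ D f : measurable D -> sqint D f -> sqint D (fun t => conjc (f t)).
Proof.
move=> mD [mf fi]; apply: (le_sqint _ _ fi) => //.
  exact: cmeasurableJ.
by move=> t _; rewrite normc_conj.
Qed.

Lemma sqint0 D : measurable D -> sqint D (fun=> 0).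
Proof.
move=> mD; apply: (@le_sqint _ _ (fun=> 0)) => //.
- exact: integrable0.
- by move=> t _; rewrite ComplexField.Normc.normc0 expr0n.
Qed.

Lemma sqint_sum D n (F : 'I_n -> R -> R[i]) : measurable D ->
  (forall i, sqint D (F i)) -> sqint D (fun t => \sum_(i < n) F i t).
Proof.
move=> mD; elim: n F => [|n IH] F iF.
  by under eq_fun do rewrite big_ord0; exact: sqint0.
by under eq_fun do rewrite big_ord_recr; apply: sqintD => //; exact: IH.
Qed.

Lemma sqintS D E f : measurable D -> measurable E -> E `<=` D ->
  sqint D f -> sqint E f.
Proof.
move=> mD mE ED [[mR mI] fi]; split.
  by split; exact: measurable_funS ED _.
exact: (integrableS (mu:=mu) mD mE ED).
Qed.

Lemma normcM_le_sqr (z w : R[i]) (t : R) : 0 < t ->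
  normc (z * w) <= 2^-1 * t * normc z ^+ 2 + 2^-1 * t^-1 * normc w ^+ 2.
Proof.
move=> t0; rewrite normcM.
have ht : t * t^-1 = 1 by rewrite divff// gt_eqF.
have t1 : 0 < t^-1 by rewrite invr_gt0.
have := sqr_ge0 (t * normc z - normc w); move: (normc z) (normc w) => a b h.
have h2 : 0 <= t^-1 * (t * a - b) ^+ 2 by rewrite mulr_ge0// ltW.
have : t^-1 * (t * a - b) ^+ 2 = (t * t^-1) * (t * a ^+ 2) - 2 * (t * t^-1) * a * b + t^-1 * b ^+ 2 by ring.
rewrite ht; lra.
Qed.

Lemma sqint_mul D f g : measurable D -> sqint D f -> sqint D g ->
  cintegrable D (fun t => f t * g t).
Proof.
move=> mD [mf fi] [mg gi].
apply: (@le_cintegrable _ _ _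
  (fun t => 2^-1 * 1 * normc (f t) ^+ 2 + 2^-1 * 1^-1 * normc (g t) ^+ 2)) => //.
- exact: cmeasurableM.
- by apply: rintegrableD => //; exact: rintegrableZ.
- by move=> t _; exact: normcM_le_sqr.
Qed.

(** Optimising the weight in the pointwise bound [normcM_le_sqr] gives the
    Cauchy-Schwarz inequality. *)
Lemma Rintegral_normcM D f g : measurable D -> sqint D f -> sqint D g ->
  (\int[mu]_(t in D) normc (f t * g t)) ^+ 2 <= nsq D f * nsq D g.
Proof.
move=> mD fi gi; have [mf ff] := fi; have [mg gg] := gi.
apply: sqr_le_of_weighted; rewrite ?nsq_ge0//.
  by apply: Rintegral_ge0 => t _; exact: normc_ge0.
move=> t t0; rewrite -ler_pdivlMl// mulrDr !mulrA -!RintegralZl//.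
rewrite -RintegralD//; first last.
- exact: rintegrableZ.
- exact: rintegrableZ.
apply: le_Rintegral => //.
- by apply: integrable_normc => //; exact: sqint_mul.
- by apply: rintegrableD => //; exact: rintegrableZ.
- by move=> x _; exact: normcM_le_sqr.
Qed.

Lemma cintegralM_CS D f g : measurable D -> sqint D f -> sqint D g ->
  normc (cintegral D (fun t => f t * g t)) ^+ 2 <= nsq D f * nsq D g.
Proof.
move=> mD fi gi; apply: le_trans (Rintegral_normcM mD fi gi).
rewrite ler_sqr ?nnegrE ?normc_ge0//; last first.
  by apply: Rintegral_ge0 => t _; exact: normc_ge0.
by apply: normc_cintegral_le => //; exact: sqint_mul.
Qed.

Lemma nsqZ D (a : R[i]) f : measurable D -> sqint D f ->
  nsq D (fun t => a * f t) = normc a ^+ 2 * nsq D f.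
Proof.
move=> mD [mf fi]; rewrite /nsq -RintegralZl//.
by apply: eq_Rintegral => t _; rewrite normcM exprMn.
Qed.

Lemma sqr_normcD (z w : R[i]) :
  normc (z + w) ^+ 2 = normc z ^+ 2 + normc w ^+ 2 + 2 * Re (z * conjc w).
Proof.
rewrite !sqr_normcE cReD cImD cReM cReJ cImJ; ring.
Qed.

Lemma nsqD D f g : measurable D -> sqint D f -> sqint D g ->
  nsq D (fun t => f t + g t) =
  nsq D f + nsq D g + 2 * Re (cintegral D (fun t => f t * conjc (g t))).
Proof.
move=> mD fi gi; have [mf ff] := fi; have [mg gg] := gi.
have [fgR _] := sqint_mul mD fi (sqintJ mD gi).
rewrite Re_cintegral -RintegralZl// /nsq -!RintegralD//; last 2 first.
- exact: rintegrableD.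
- exact: rintegrableZ.
by apply: eq_Rintegral => t _; rewrite sqr_normcD.
Qed.

Lemma cintegral_mul_conj D f : cintegral D (fun t => f t * conjc (f t)) = (nsq D f)%:C.
Proof.
apply: complexP; rewrite ?Re_cintegral ?Im_cintegral.
  by apply: eq_Rintegral => t _; rewrite mulc_conj.
transitivity (\int[mu]_(t in D) (0 : R)); first by apply: eq_Rintegral => t _; rewrite mulc_conj.
by rewrite /Rintegral integral0.
Qed.

Lemma nsqN D f : nsq D (fun t => - f t) = nsq D f.
Proof. by apply: eq_nsq => t _; rewrite normcN. Qed.

Lemma nsq_parallelogram D f g : measurable D -> sqint D f -> sqint D g ->
  nsq D (fun t => f t + g t) + nsq D (fun t => f t - g t) =
  2 * nsq D f + 2 * nsq D g.
Proof.
move=> mD fi gi; rewrite !nsqD ?nsqN//; last exact: sqintN.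
rewrite (_ : (fun t => f t * conjc (- g t)) = (fun t => -1 * (f t * conjc (g t)))); last first.
  by apply/funext => t; rewrite rmorphN mulrN mulN1r.
rewrite cintegralZ//; last by apply: sqint_mul => //; exact: sqintJ.
rewrite mulN1r cReN; ring.
Qed.

Lemma nsqD_le D f g : measurable D -> sqint D f -> sqint D g ->
  nsq D (fun t => f t + g t) <= 2 * nsq D f + 2 * nsq D g.
Proof. by move=> mD fi gi; rewrite -nsq_parallelogram// lerDl nsq_ge0. Qed.

(** After squaring, the triangle inequality for the mean square norm is the
    Cauchy-Schwarz inequality for the cross term of [nsqD]. *)
Lemma sqrt_nsqD D f g : measurable D -> sqint D f -> sqint D g ->
  Num.sqrt (nsq D (fun t => f t + g t)) <= Num.sqrt (nsq D f) + Num.sqrt (nsq D g).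
Proof.
move=> mD fi gi; rewrite -ler_sqr ?nnegrE ?addr_ge0 ?sqrtr_ge0//.
rewrite sqrrD !sqr_sqrtr ?nsq_ge0// nsqD//.
rewrite [leRHS]addrAC lerD2l -[leRHS]mulr_natl ler_pM2l// -sqrtrM ?nsq_ge0//.
rewrite (le_trans (ler_norm _))// (le_trans (Re_le_normc _))//.
have := cintegralM_CS mD fi (sqintJ mD gi).
rewrite (@eq_nsq _ (fun t => conjc (g t)) g); last by move=> t _; rewrite normc_conj.
move=> h.
by have := ler_wsqrtr h; rewrite sqrtr_sqr ger0_norm ?normc_ge0.
Qed.

(** Fatou's lemma, through which the limit functions below, all obtained
    pointwise, inherit square integrability. *)
Lemma sqint_fatou D (f_ : nat -> R -> R[i]) f (M : R) : measurable D ->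
  (forall n, sqint D (f_ n)) ->
  (forall t, D t -> (f_ n t : R[i]^o) @[n --> \oo] --> (f t : R[i]^o)) ->
  (\forall n \near \oo, nsq D (f_ n) <= M) ->
  sqint D f /\ nsq D f <= M.
Proof.
move=> mD fi cf fM.
have mf : cmeasurable D f by apply: cmeasurable_cvg cf => n; have [] := fi n.
apply/sqintP => //.
have mf_ n : measurable_fun D (fun t => (normc (f_ n t) ^+ 2)%:E).
  by apply/measurable_EFinP; apply: measurable_normc_sqr; have [] := fi n.
have := @fatou _ _ _ mu D mD (fun n t => (normc (f_ n t) ^+ 2)%:E) mf_
  (fun n t _ => sqr_ge0 _).
rewrite (@eq_integral _ _ _ mu _ (fun t => (normc (f t) ^+ 2)%:E)); last first.
  move=> t /set_mem Dt.
  have hc : (fun n => (normc (f_ n t) ^+ 2)%:E) @ \oo --> (normc (f t) ^+ 2)%:E.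
    apply: cvg_EFin; first exact: nearW.
    apply: (@cvg_comp _ _ _ (fun n => normc (f_ n t)) (fun x => x ^+ 2) _ (nbhs (normc (f t)))).
      by apply: cvg_normc; exact: cf.
    exact: exprn_continuous.
  by have [-> _] := cvg_limn_einf_sup hc.
move=> h; apply: (le_trans h).
have [N _ hN] := fM.
rewrite (_ : limn_einf _ = limn_einf (fun n => (nsq D (f_ n))%:E)); last first.
  by congr limn_einf; apply/funext => n; rewrite nsqE.
rewrite limn_einf_lim; apply: lime_le.
  exact: is_cvg_einfs.
near=> n; apply: ereal_inf_le; exists (nsq D (f_ n))%:E => //.
  by exists n => //=.
by rewrite lee_fin hN//; near: n; exact: nbhs_infty_ge.
Unshelve. all: by end_near. Qed.

End SquareIntegrable.

(** * Integrals over intervals, and joint measurability *)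

Section IntervalIntegral.
Context {R : realType}.
Local Notation mu := (@lebesgue_measure R).

Lemma Rintegral_itv_cat (f : R -> R) (a m b : R) : a <= m -> m <= b ->
  mu.-integrable `[a, b] (EFin \o f) ->
  \int[mu]_(t in `[a, b]) f t =
  \int[mu]_(t in `[a, m]) f t + \int[mu]_(t in `[m, b]) f t.
Proof.
move=> am mb fi; have := @Rintegral_itvB R f (BLeft a) (BRight b) m fi.
rewrite !bnd_simp => /(_ am mb).
rewrite Rintegral_itv_obnd_cbnd; last first.
  apply: (integrableS (mu:=mu) _ _ _ fi) => //.
  by apply: subset_itv; rewrite bnd_simp.
by move=> <-; rewrite addrC subrK.
Qed.

Lemma cintegral_itv_cat (f : R -> R[i]) (a m b : R) : a <= m -> m <= b ->
  cintegrable `[a, b] f ->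
  cintegral `[a, b] f = cintegral `[a, m] f + cintegral `[m, b] f.
Proof.
move=> am mb [fR fI]; apply: complexP; rewrite ?cReD ?cImD.
  exact: Rintegral_itv_cat.
exact: Rintegral_itv_cat.
Qed.

Lemma cintegrable_continuous (f : R -> R[i]) (a b : R) :
  (forall t, a <= t <= b -> {for t, continuous (f : R -> R[i]^o)}) ->
  cintegrable `[a, b] f.
Proof.
move=> cf; split; apply: continuous_compact_integrable; try exact: segment_compact.
  apply: continuous_in_subspaceT => t /set_mem /=; rewrite in_itv/= => tab.
  by have /cvg_complexP[] := cf _ tab.
apply: continuous_in_subspaceT => t /set_mem /=; rewrite in_itv/= => tab.
by have /cvg_complexP[] := cf _ tab.
Qed.

Lemma cintegral_cst (a b : R) (k : R[i]) : a <= b ->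
  cintegral `[a, b] (fun=> k) = k * (b - a)%:C.
Proof.
move=> ab.
have mab : mu `[a, b] = (b - a)%:E.
  rewrite lebesgue_measure_itv/= lte_fin; case: ltP => // ba.
  by have -> : b = a; [apply/eqP; rewrite eq_le ab ba|rewrite subrr].
have fab : fine (mu `[a, b]) = b - a by rewrite mab.
apply: complexP; rewrite ?Re_cintegral ?Im_cintegral Rintegral_cst//=.
  by rewrite cReM/= mulr0 subr0; congr (_ * _); exact: fab.
by rewrite cImM/= mulr0 add0r; congr (_ * _); exact: fab.
Qed.

(** Such a function is the limit of its samples at multiples of [1/n] in the first
    variable, and each sampled function is piecewise a function of the second
    variable alone.  This is what Tonelli's theorem needs for functions given by
    their values on lines. *)
Lemma measurable_fun_separately_continuous (f : R * R -> R) :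
  (forall y, continuous (fun x => f (x, y))) ->
  (forall x, continuous (fun y => f (x, y))) ->
  measurable_fun setT f.
Proof.
move=> cx cy.
pose s (n : nat) (x : R) : R := (Num.floor (x * n.+1%:R))%:~R / n.+1%:R.
apply: (@measurable_fun_cvg _ _ _ _ (fun n p => f (s n p.1, p.2))); last first.
  move=> [x y] _ /=.
  apply: (@cvg_comp _ _ _ (s^~ x) (fun t => f (t, y)) _ (nbhs x)); last exact: cx.
  apply/cvgrPdist_lt => e e0; near=> n.
  have n0 : (0 : R) < n.+1%:R by [].
  have /andP[h1 h2] := floor_itv (x * n.+1%:R).
  have h3 : n.+1%:R^-1 < e by near: n; exact: near_infty_natSinv_lt (PosNum e0).
  rewrite ger0_norm; last by rewrite subr_ge0 ler_pdivrMr.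
  apply: lt_trans h3; rewrite -(ltr_pM2r n0) mulrBl /s divfK ?gt_eqF//.
  rewrite mulVf ?gt_eqF//; move: h2; rewrite intrD; lra.
move=> n _ Y mY; rewrite setTI.
rewrite (_ : _ @^-1` _ = \bigcup_(k : int)
    ((fun x : R => Num.floor (x * n.+1%:R)) @^-1` [set k] `*`
     (fun y => f (k%:~R / n.+1%:R, y)) @^-1` Y)); last first.
  apply/seteqP; split => [[x y] /= h|[x y] [k _ [/= <-]]//].
  by exists (Num.floor (x * n.+1%:R)).
apply: countable_bigcupT_measurable => // k; apply: measurableX.
  rewrite (_ : _ @^-1` _ = `[k%:~R / n.+1%:R, (k + 1)%:~R / n.+1%:R[%classic) //.
  apply/seteqP; split => x /=.
    move=> <-; rewrite in_itv/= ler_pdivrMr// ltr_pdivlMr//.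
    exact: floor_itv.
  rewrite in_itv/= ler_pdivrMr// ltr_pdivlMr// => h.
  exact: floor_def.
have := continuous_measurable_fun (cy (k%:~R / n.+1%:R)) measurableT mY.
by rewrite setTI.
Unshelve. all: by end_near. Qed.

End IntervalIntegral.

(** * Goursat's theorem on rectangles *)

Section Goursat.
Context {R : realType}.
Local Notation mu := (@lebesgue_measure R).
Implicit Types (f g : R[i] -> R[i]) (a b c d : R).

Definition cts_at f z := {for z, continuous (f : R[i]^o -> R[i]^o)}.
Definition cdiff f z := derivable (f : R[i]^o -> R[i]^o) z 1.

Lemma cdiffE f z : cdiff f z = derivable (f : R[i]^o -> R[i]^o) z 1.
Proof. by []. Qed.

Lemma cdiffP f z : cdiff f z <->
  exists l : R[i], forall e : R, 0 < e -> exists2 d : R, 0 < d &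
    forall w, 0 < normc (w - z) -> normc (w - z) < d ->
      normc ((f w - f z) / (w - z) - l) < e.
Proof. exact: derivable_normcP. Qed.

Lemma cdiff_cts f z : cdiff f z -> cts_at f z.
Proof. exact: derivable_cts. Qed.

Lemma cts_atP f z : cts_at f z <-> forall e : R, 0 < e ->
  exists2 d : R, 0 < d & forall w, normc (w - z) < d -> normc (f w - f z) < e.
Proof.
have P := @cvg_normcP R R[i]^o (nbhs (z : R[i]^o)) _ f (f z).
split=> [/P h e /h|h].
  move=> /nbhs_ballP[d /= d0 hd].
  have dE : d = (Re d)%:C by apply: complexP => //=; exact/ger0_Im/ltW.
  exists (Re d) => [|w wd]; first by move: d0; rewrite {1}dE ltcR.
  by apply: hd; rewrite /ball/= normc_normr dE ltcR normcBC.
apply/P => e /h[d d0 hd]; apply/nbhs_ballP; exists d%:C; first by rewrite /= ltcR.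
by move=> v; rewrite /ball/= normc_normr ltcR normcBC => /hd.
Qed.

Lemma cts_cst (k : R[i]) z : cts_at (fun=> k) z.
Proof. exact: (@cst_continuous R[i]^o R[i]^o k z). Qed.

Lemma cts_id z : cts_at id z.
Proof. by move=> A. Qed.

Lemma cts_atD f g z : cts_at f z -> cts_at g z -> cts_at (fun w => f w + g w) z.
Proof. by move=> cf cg; exact: (cvgD cf cg). Qed.

Lemma cts_atB f g z : cts_at f z -> cts_at g z -> cts_at (fun w => f w - g w) z.
Proof. by move=> cf cg; exact: (cvgB cf cg). Qed.

Lemma cts_atM f g z : cts_at f z -> cts_at g z -> cts_at (fun w => f w * g w) z.
Proof. by move=> cf cg; exact: (cvgM cf cg). Qed.

Lemma cts_affine (p q : R[i]) z : cts_at (fun w => p + q * w) z.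
Proof.
by apply: cts_atD; [exact: cts_cst|apply: cts_atM; [exact: cts_cst|exact: cts_id]].
Qed.

Lemma cdiff_cst (k : R[i]) z : cdiff (fun=> k) z.
Proof. exact: derivable_cst. Qed.

Lemma cdiff_id z : cdiff id z.
Proof. exact: derivable_id. Qed.

Lemma cdiffD f g z : cdiff f z -> cdiff g z -> cdiff (fun w => f w + g w) z.
Proof. by move=> df dg; exact: (derivableD df dg). Qed.

Lemma cdiffB f g z : cdiff f z -> cdiff g z -> cdiff (fun w => f w - g w) z.
Proof. by move=> df dg; exact: (derivableB df dg). Qed.

Lemma cdiffM f g z : cdiff f z -> cdiff g z -> cdiff (fun w => f w * g w) z.
Proof. by move=> df dg; exact: (derivableM df dg). Qed.

Lemma cdiffZ (k : R[i]) f z : cdiff f z -> cdiff (fun w => k * f w) z.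
Proof. by move=> df; exact: (cdiffM (@cdiff_cst k z) df). Qed.

Lemma cdiffV f z : f z != 0 -> cdiff f z -> cdiff (fun w => (f w)^-1) z.
Proof. by move=> fz df; exact: (@derivableV _ _ (f : R[i]^o -> R[i]^o) z 1 fz df). Qed.

Lemma cts_hline f x y : cts_at f (x +i* y) ->
  {for x, continuous ((fun t => f (t +i* y)) : R -> R[i]^o)}.
Proof.
move=> cf; apply: (@continuous_comp R R[i]^o R[i]^o (fun t => t +i* y) f);
  [exact: continuous_hline|exact: cf].
Qed.

Lemma cts_vline f x y : cts_at f (x +i* y) ->
  {for y, continuous ((fun t => f (x +i* t)) : R -> R[i]^o)}.
Proof.
move=> cf; apply: (@continuous_comp R R[i]^o R[i]^o (fun t => x +i* t) f);
  [exact: continuous_line|exact: cf].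
Qed.

#[local] Opaque cts_at cdiff.

Definition in_rect a b c d (z : R[i]) := a <= Re z <= b /\ c <= Im z <= d.

(** The integral of [f] over the positively oriented boundary of
    [[a, b] x [c, d]]. *)
Definition rect_int f a b c d : R[i] :=
  cintegral `[a, b] (fun t => f (t +i* c)) - cintegral `[a, b] (fun t => f (t +i* d))
  + 'i * (cintegral `[c, d] (fun t => f (b +i* t)) -
          cintegral `[c, d] (fun t => f (a +i* t))).

Lemma hseg_cintegrable f a b c d y : (forall z, in_rect a b c d z -> cts_at f z) ->
  c <= y <= d -> cintegrable `[a, b] (fun t => f (t +i* y)).
Proof.
by move=> cf cyd; apply: cintegrable_continuous => t atb; apply: cts_hline; apply: cf.
Qed.

Lemma vseg_cintegrable f a b c d x : (forall z, in_rect a b c d z -> cts_at f z) ->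
  a <= x <= b -> cintegrable `[c, d] (fun t => f (x +i* t)).
Proof.
by move=> cf axb; apply: cintegrable_continuous => t ctd; apply: cts_vline; apply: cf.
Qed.

Lemma rect_int_hcat f a m b c d : a <= m -> m <= b -> c <= d ->
  (forall z, in_rect a b c d z -> cts_at f z) ->
  rect_int f a b c d = rect_int f a m c d + rect_int f m b c d.
Proof.
move=> am mb cd cf; rewrite /rect_int.
rewrite (cintegral_itv_cat am mb (hseg_cintegrable cf _)) ?lexx ?cd//.
rewrite (cintegral_itv_cat am mb (hseg_cintegrable cf _)) ?lexx ?cd//.
ring.
Qed.

Lemma rect_int_vcat f a b c m d : c <= m -> m <= d -> a <= b ->
  (forall z, in_rect a b c d z -> cts_at f z) ->
  rect_int f a b c d = rect_int f a b c m + rect_int f a b m d.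
Proof.
move=> cm md ab cf; rewrite /rect_int.
rewrite (cintegral_itv_cat cm md (vseg_cintegrable cf _)) ?lexx ?ab//.
rewrite (cintegral_itv_cat cm md (vseg_cintegrable cf _)) ?lexx ?ab//.
ring.
Qed.

Lemma rect_intB f g a b c d : a <= b -> c <= d ->
  (forall z, in_rect a b c d z -> cts_at f z) ->
  (forall z, in_rect a b c d z -> cts_at g z) ->
  rect_int (fun z => f z - g z) a b c d = rect_int f a b c d - rect_int g a b c d.
Proof.
move=> ab cd cf cg.
have cc : c <= c <= d by rewrite lexx.
have dd : c <= d <= d by rewrite cd lexx.
have aa : a <= a <= b by rewrite lexx.
have bb : a <= b <= b by rewrite ab lexx.
rewrite /rect_int.
rewrite (cintegralB _ (hseg_cintegrable cf cc) (hseg_cintegrable cg cc))//.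
rewrite (cintegralB _ (hseg_cintegrable cf dd) (hseg_cintegrable cg dd))//.
rewrite (cintegralB _ (vseg_cintegrable cf aa) (vseg_cintegrable cg aa))//.
rewrite (cintegralB _ (vseg_cintegrable cf bb) (vseg_cintegrable cg bb))//.
ring.
Qed.

(** Affine functions are the only ones integrated explicitly; Goursat's
    argument compares [f] with them. *)
Lemma rect_int_affine (p q : R[i]) a b c d : a <= b -> c <= d ->
  rect_int (fun w => p + q * w) a b c d = 0.
Proof.
move=> ab cd; have cl z : in_rect a b c d z -> cts_at (fun w => p + q * w) z.
  by move=> _; exact: cts_affine.
have cc : c <= c <= d by rewrite lexx.
have dd : c <= d <= d by rewrite cd lexx.
have aa : a <= a <= b by rewrite lexx.
have bb : a <= b <= b by rewrite ab lexx.
rewrite /rect_int.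
rewrite -(cintegralB _ (hseg_cintegrable cl cc) (hseg_cintegrable cl dd))//.
rewrite -(cintegralB _ (vseg_cintegrable cl bb) (vseg_cintegrable cl aa))//.
rewrite (@eq_cintegral _ `[a, b]%classic _ (fun=> q * 'i * (c - d)%:C)); last first.
  move=> t _; rewrite (addlineE t c) (addlineE t d) rmorphB/=; ring.
rewrite (@eq_cintegral _ `[c, d]%classic _ (fun=> q * (b - a)%:C)); last first.
  move=> t _; rewrite (addlineE a t) (addlineE b t) rmorphB/=; ring.
rewrite !cintegral_cst// !rmorphB/=; ring.
Qed.

Lemma normc_cintegral_itv_le (f : R -> R[i]) a b (e : R) : a <= b ->
  cintegrable `[a, b] f -> (forall t, a <= t <= b -> normc (f t) <= e) ->
  normc (cintegral `[a, b] f) <= e * (b - a).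
Proof.
move=> ab fi fe; apply: (le_trans (normc_cintegral_le _ fi)) => //.
have mab : mu `[a, b] = (b - a)%:E.
  rewrite lebesgue_measure_itv/= lte_fin; case: ltP => // ba.
  by have -> : b = a; [apply/eqP; rewrite eq_le ab ba|rewrite subrr].
have -> : e * (b - a) = \int[mu]_(t in `[a, b]) e.
  by rewrite Rintegral_cst//; congr (_ * _); rewrite /= -[b - a]/(fine (b - a)%:E); congr fine.
apply: le_Rintegral => //.
- exact: integrable_normc.
- by apply: continuous_compact_integrable; [exact: segment_compact|apply: continuous_subspaceT => ?; exact: cvg_cst].
Qed.

Lemma rect_int_le f a b c d (e : R) : a <= b -> c <= d ->
  (forall z, in_rect a b c d z -> cts_at f z) ->
  (forall z, in_rect a b c d z -> normc (f z) <= e) ->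
  normc (rect_int f a b c d) <= 2 * e * ((b - a) + (d - c)).
Proof.
move=> ab cd cf fe.
have hb y : c <= y <= d ->
    normc (cintegral `[a, b] (fun t => f (t +i* y))) <= e * (b - a).
  move=> cyd; apply: normc_cintegral_itv_le => //.
    exact: (hseg_cintegrable cf).
  by move=> t atb; apply: fe.
have vb x : a <= x <= b ->
    normc (cintegral `[c, d] (fun t => f (x +i* t))) <= e * (d - c).
  move=> axb; apply: normc_cintegral_itv_le => //.
    exact: (vseg_cintegrable cf).
  by move=> t ctd; apply: fe.
rewrite /rect_int (le_trans (le_normcD _ _))//.
have ni : normc ('i : R[i]) = 1 by rewrite /= expr0n add0r expr1n sqrtr1.
rewrite normcM ni mul1r.
have := normcB (cintegral `[a, b] (fun t => f (t +i* c))) (cintegral `[a, b] (fun t => f (t +i* d))).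
have := normcB (cintegral `[c, d] (fun t => f (b +i* t))) (cintegral `[c, d] (fun t => f (a +i* t))).
have := hb c; have := hb d; have := vb a; have := vb b.
rewrite !lexx ab cd => /(_ isT) ? /(_ isT) ? /(_ isT) ? /(_ isT) ? ? ?.
lra.
Qed.

Definition half (u : R * R) (s : bool) : R * R :=
  if s then ((u.1 + u.2) / 2, u.2) else (u.1, (u.1 + u.2) / 2).

(** The bisection is run on each side of the rectangle separately; [s n] tells
    which half is kept at step [n]. *)
Lemma nested_halves (u : nat -> R * R) (s : nat -> bool) : (u 0).1 <= (u 0).2 ->
  (forall n, u n.+1 = half (u n) (s n)) ->
  exists x, forall n, [/\ (u n).1 <= x, x <= (u n).2, (u 0).1 <= (u n).1,
    (u n).2 <= (u 0).2 & (u n).2 - (u n).1 = ((u 0).2 - (u 0).1) / 2 ^+ n].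
Proof.
move=> u0 hu.
have len n : (u n).2 - (u n).1 = ((u 0).2 - (u 0).1) / 2 ^+ n.
  elim: n => [|n IH]; first by rewrite expr0 divr1.
  by rewrite exprS invfM mulrCA -IH hu /half; case: (s n) => /=; field.
have le12 n : (u n).1 <= (u n).2.
  by rewrite -subr_ge0 len divr_ge0 ?exprn_ge0// subr_ge0.
have mono n k : (u n).1 <= (u (n + k)%N).1 /\ (u (n + k)%N).2 <= (u n).2.
  elim: k => [|k [IH1 IH2]]; first by rewrite addn0.
  rewrite addnS hu /half; have := le12 (n + k)%N.
  by case: (s _) => /= h; split; lra.
have le_any n m : (u n).1 <= (u m).2.
  have [h1 _] := mono n m; have [_] := mono m n; rewrite addnC => h2.
  exact: (le_trans h1 (le_trans (le12 _) h2)).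
exists (sup (range (fun n => (u n).1))) => n.
have hs : has_sup (range (fun n => (u n).1)).
  by split; [exists (u 0).1, 0|exists (u 0).2 => _ [m _ <-]].
split => //.
- by apply: sup_upper_bound => //; exists n.
- by apply: ge_sup; [exists (u 0).1, 0|move=> _ [m _ <-]].
- by have [] := mono 0 n.
- by have [] := mono 0 n.
Qed.

Lemma linear_approx f z : cdiff f z -> exists l : R[i], forall e : R, 0 < e ->
  exists2 del : R, 0 < del &
    forall w, normc (w - z) < del -> normc (f w - f z - l * (w - z)) <= e * normc (w - z).
Proof.
move=> /cdiffP[l hl]; exists l => e /hl[del del0 hd]; exists del => // w wd.
have [->|wz] := eqVneq w z; first by rewrite !subrr mulr0 subrr ComplexField.Normc.normc0 mulr0.
have wz0 : w - z != 0 by rewrite subr_eq0.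
have -> : f w - f z - l * (w - z) = ((f w - f z) / (w - z) - l) * (w - z).
  by rewrite mulrBl divfK.
rewrite normcM ler_wpM2r ?normc_ge0// ltW// hd// normc_gt0//.
Qed.

(** Goursat's bisection: nested rectangles keep a fixed share of the integral
    relative to their area, while near their common point [f] is affine up to an
    error that is small compared with their size. *)
Lemma goursat f a b c d : a <= b -> c <= d ->
  (forall z, in_rect a b c d z -> cdiff f z) -> rect_int f a b c d = 0.
Proof.
move=> ab cd df.
have mid (u v : R) : u <= v -> u <= (u + v) / 2 /\ (u + v) / 2 <= v.
  by move=> uv; split; lra.
have four (e e1 e2 e3 e4 : R) : 4 * e1 < e -> 4 * e2 < e -> 4 * e3 < e -> 4 * e4 < e ->
  e <= e1 + e2 + (e3 + e4) -> False by lra.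
pose E (r : (R * R) * (R * R)) := normc (rect_int f r.1.1 r.1.2 r.2.1 r.2.2).
(* [q r s] is a quarter of the rectangle [r]; [ch r] selects one carrying at
   least a quarter of the integral *)
pose q (r : (R * R) * (R * R)) (s : bool * bool) := (half r.1 s.1, half r.2 s.2).
pose ch (r : (R * R) * (R * R)) : bool * bool :=
  if E r <= 4 * E (q r (false, false)) then (false, false) else
  if E r <= 4 * E (q r (false, true)) then (false, true) else
  if E r <= 4 * E (q r (true, false)) then (true, false) else (true, true).
pose r n := iter n (fun r => q r (ch r)) ((a, b), (c, d)).
have [x hx] := @nested_halves (fun n => (r n).1) (fun n => (ch (r n)).1) ab (fun n => erefl).
have [y hy] := @nested_halves (fun n => (r n).2) (fun n => (ch (r n)).2) cd (fun n => erefl).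
have sub n z : in_rect (r n).1.1 (r n).1.2 (r n).2.1 (r n).2.2 z -> in_rect a b c d z.
  move=> [/andP[h1 h2] /andP[h3 h4]].
  have [_ _ /= a1 a2 _] := hx n; have [_ _ /= b1 b2 _] := hy n.
  by split; apply/andP; split; [exact: le_trans h1|exact: le_trans a2|exact: le_trans h3|exact: le_trans b2].
have cfn n z : in_rect (r n).1.1 (r n).1.2 (r n).2.1 (r n).2.2 z -> cts_at f z.
  by move=> /sub/df/cdiff_cts.
have len1 n : (r n).1.1 <= (r n).1.2 by have [h1 h2 _ _ _] := hx n; exact: le_trans h2.
have len2 n : (r n).2.1 <= (r n).2.2 by have [h1 h2 _ _ _] := hy n; exact: le_trans h2.
have step n : E (r n) <= 4 * E (r n.+1).
  rewrite [r n.+1]/= -/(r n) /ch; set rn := r n.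
  case: ifPn => // /negP/negP; rewrite -ltNge => h1.
  case: ifPn => // /negP/negP; rewrite -ltNge => h2.
  case: ifPn => // /negP/negP; rewrite -ltNge => h3.
  rewrite leNgt; apply/negP => h4.
  have [m1 m2] := mid _ _ (len1 n); have [m3 m4] := mid _ _ (len2 n).
  have : E rn <= E (q rn (false, false)) + E (q rn (false, true)) +
                (E (q rn (true, false)) + E (q rn (true, true))).
    rewrite {1}/E (rect_int_hcat m1 m2 (len2 n) (cfn n)).
    rewrite (rect_int_vcat m3 m4 m1) => [|z hz]; last first.
      apply: (cfn n); move: hz; rewrite /in_rect -/rn => -[/andP[-> hz2] ->]; split => //=.
      exact: le_trans m2.
    rewrite (rect_int_vcat m3 m4 m2) => [|z hz]; last first.
      apply: (cfn n); move: hz; rewrite /in_rect -/rn => -[/andP[hz1 ->] ->]; split => //=.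
      by rewrite andbT; exact: le_trans hz1.
    by rewrite (le_trans (le_normcD _ _))// lerD// le_normcD.
  exact: four h1 h2 h3 h4.
have E0n n : E (r 0) <= 4 ^+ n * E (r n).
  elim: n => [|n IH]; first by rewrite expr0 mul1r.
  by rewrite (le_trans IH)// exprSr -mulrA ler_wpM2l ?exprn_ge0.
pose L := (b - a) + (d - c).
have hxy : in_rect a b c d (x +i* y).
  have [? ? _ _ _] := hx 0; have [? ? _ _ _] := hy 0.
  by split => /=; apply/andP.
have [l hl] := linear_approx (df _ hxy).
have key e : 0 < e -> E (r 0) <= 2 * L ^+ 2 * e.
  move=> e0; have [del del0 hd] := hl e e0.
  have [n nlt] : exists n : nat, L / 2 ^+ n < del.
    have : (fun n => L * (2^-1 : R) ^+ n) @ \oo --> L * 0.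
      apply: cvgMl_tmp; apply: cvg_expr; rewrite ger0_norm//; lra.
    rewrite mulr0 => /cvgrPdist_lt/(_ _ del0)[n _ /(_ n (leqnn n))] /=.
    rewrite sub0r normrN => h; exists n; rewrite -exprVn; exact: le_lt_trans (ler_norm _) h.
  apply: (le_trans (E0n n)).
  (* subtracting the affine approximation at the common point of all rectangles
     does not change the integral, and leaves an error small against the size of
     the rectangle *)
  pose g w := (f (x +i* y) - l * (x +i* y)) + l * w.
  have Eg : rect_int f (r n).1.1 (r n).1.2 (r n).2.1 (r n).2.2 =
      rect_int (fun w => f w - g w) (r n).1.1 (r n).1.2 (r n).2.1 (r n).2.2.
    rewrite rect_intB//; last by move=> z _; exact: cts_affine.
      by rewrite rect_int_affine ?subr0.
    exact: cfn.
  have Ln : ((r n).1.2 - (r n).1.1) + ((r n).2.2 - (r n).2.1) = L / 2 ^+ n.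
    by have [_ _ _ _ ->] := hx n; have [_ _ _ _ ->] := hy n; rewrite -mulrDl.
  rewrite /E Eg; apply: (@le_trans _ _ (4 ^+ n * (2 * (e * (L / 2 ^+ n)) * (L / 2 ^+ n)))).
    rewrite ler_wpM2l ?exprn_ge0// -{2}Ln; apply: rect_int_le => //.
      move=> z hz; apply: cts_atB; first exact: cfn hz.
      exact: cts_affine.
    move=> z [/andP[z1 z2] /andP[z3 z4]].
    have zd : normc (z - (x +i* y)) <= L / 2 ^+ n.
      rewrite (le_trans (normc_le_ReIm _))// cReB cImB/= -Ln.
      have [h1 h2 _ _ _] := hx n; have [h3 h4 _ _ _] := hy n.
      have near_mid (u v s t : R) : u <= s -> s <= v -> u <= t -> t <= v -> `|s - t| <= v - u.
        by move=> *; rewrite ler_norml; apply/andP; split; lra.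
      by rewrite lerD// near_mid.
    have -> : f z - g z = f z - f (x +i* y) - l * (z - (x +i* y)) by rewrite /g; ring.
    apply: (le_trans (hd _ (le_lt_trans zd nlt))).
    by rewrite ler_wpM2l// ltW.
  rewrite le_eqVlt; apply/orP; left; apply/eqP.
  have -> : (4 : R) = 2 ^+ 2 by ring.
  rewrite -exprM mulnC exprM; field.
  by rewrite expf_neq0.
have [->//|E0] := eqVneq (rect_int f a b c d) 0.
exfalso; have Ep : 0 < E (r 0) by rewrite /E normc_gt0.
have k0 : 0 <= 2 * L ^+ 2 by rewrite mulr_ge0 ?sqr_ge0.
have k1 : 0 < 2 * L ^+ 2 + 1 by lra.
have := key (E (r 0) / (2 * L ^+ 2 + 1)) (divr_gt0 Ep k1).
rewrite mulrA ler_pdivlMr//; lra.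
Qed.

(** An isolated point where [f] is merely continuous is harmless: shrink a
    square around it. *)
Lemma goursat_punctured f a b c d p : a < Re p < b -> c < Im p < d ->
  (forall z, in_rect a b c d z -> cts_at f z) ->
  (forall z, in_rect a b c d z -> z != p -> cdiff f z) -> rect_int f a b c d = 0.
Proof.
move=> /andP[ap pb] /andP[cp pd] cf df.
have pin : in_rect a b c d p by split; apply/andP; split; exact: ltW.
have [del del0 hdel] : exists2 del : R, 0 < del &
    forall w, normc (w - p) < del -> normc (f w) <= normc (f p) + 1.
  have /cts_atP/(_ 1 ltr01)[e e0 he] := cf p pin.
  exists e => // w wp; have h := he w wp.
  have := le_normcD (f w - f p) (f p); rewrite subrK; lra.
pose M := normc (f p) + 1.
have M0 : 0 < M by rewrite /M ltr_wpDl ?normc_ge0.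
have key s : 0 < s -> s <= del / 4 -> s <= Re p - a -> s <= b - Re p ->
    s <= Im p - c -> s <= d - Im p ->
    normc (rect_int f a b c d) <= 8 * M * s.
  move=> s0 s1 s2 s3 s4 s5.
  have cut a' b' c' d' : a <= a' -> b' <= b -> c <= c' -> d' <= d ->
      forall z, in_rect a' b' c' d' z -> in_rect a b c d z.
    move=> ? ? ? ? z [/andP[? ?] /andP[? ?]]; split; apply/andP; split; lra.
  have zero a' b' c' d' : a <= a' -> b' <= b -> c <= c' -> d' <= d -> a' <= b' -> c' <= d' ->
      ~ in_rect a' b' c' d' p -> rect_int f a' b' c' d' = 0.
    move=> h1 h2 h3 h4 h5 h6 np; apply: goursat => // z hz.
    apply: df; first exact: cut hz.
    by apply/eqP => zp; apply: np; rewrite -zp.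
  rewrite (@rect_int_hcat f a (Re p - s) b) //; [|lra..].
  rewrite [rect_int f a _ _ _]zero ?add0r //; try lra; last by move=> [/andP[? ?] _]; lra.
  rewrite (@rect_int_hcat f _ (Re p + s) b); [|lra..|]; last by move=> z hz; apply: cf; apply: cut hz; lra.
  rewrite [rect_int f (Re p + s) _ _ _]zero ?addr0 //; try lra; last by move=> [/andP[? ?] _]; lra.
  rewrite (@rect_int_vcat f _ _ c (Im p - s) d); [|lra..|]; last by move=> z hz; apply: cf; apply: cut hz; lra.
  rewrite [rect_int f _ _ c _]zero ?add0r //; try lra; last by move=> [_ /andP[? ?]]; lra.
  rewrite (@rect_int_vcat f _ _ _ (Im p + s) d); [|lra..|]; last by move=> z hz; apply: cf; apply: cut hz; lra.
  rewrite [rect_int f _ _ (Im p + s) _]zero ?addr0 //; try lra; last by move=> [_ /andP[? ?]]; lra.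
  have -> : 8 * M * s = 2 * M * (((Re p + s) - (Re p - s)) + ((Im p + s) - (Im p - s))) by ring.
  apply: rect_int_le; [lra|lra| |].
    by move=> z hz; apply: cf; apply: cut hz; lra.
  move=> z [/andP[? ?] /andP[? ?]]; apply: hdel.
  rewrite (le_lt_trans (normc_le_ReIm _))// cReB cImB.
  have : `|Re z - Re p| <= s by rewrite ler_norml; apply/andP; split; lra.
  have : `|Im z - Im p| <= s by rewrite ler_norml; apply/andP; split; lra.
  lra.
apply/eqP; rewrite -normc_eq0 eq_le normc_ge0 andbT leNgt; apply/negP => E0.
pose E := normc (rect_int f a b c d).
pose s := Num.min (E / (16 * M)) (Num.min (del / 4) (Num.min (Num.min (Re p - a) (b - Re p)) (Num.min (Im p - c) (d - Im p)))).
have M16 : 0 < 16 * M by rewrite mulr_gt0.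
have s0 : 0 < s.
  rewrite /s !lt_min !subr_gt0 ap pb cp pd !andbT divr_gt0//=; lra.
have := lexx s; rewrite {2}/s !le_min => /and3P[h1 h2 /andP[/andP[h3 h4] /andP[h5 h6]]].
have := key s s0 h2 h3 h4 h5 h6; move: h1; rewrite ler_pdivlMr// -/E.
move: E0; rewrite -/E; lra.
Qed.

End Goursat.
#[global] Opaque cts_at cdiff.

(** * Cauchy and Poisson kernels on vertical lines *)

Section PoissonKernel.
Context {R : realType}.
Local Notation mu := (@lebesgue_measure R).

Lemma integral_oneDsqr : (\int[mu]_x (oneDsqr x)^-1%:E = (pi : R)%:E)%E.
Proof.
rewrite (@ge0_symfun_integralT _ (fun x => (oneDsqr x)^-1)).
- rewrite (_ : [set x | 0 <= x] = `[0, +oo[%classic); last first.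
    by apply/seteqP; split => x /=; rewrite in_itv/= andbT.
  rewrite integral0y_oneDsqr -EFinM; congr EFin; by field.
- by move=> x; rewrite invr_ge0 (le_trans _ (oneDsqr_ge1 _)).
- exact: continuous_oneDsqrV.
- by move=> x; rewrite /oneDsqr/= sqrrN.
Qed.

(** The substitution [u = (x - y) / xi] reduces the mass of the kernel to the
    integral of [1 / (1 + u^2)]. *)
Lemma integral_poisson (xi y : R) : 0 < xi ->
  (\int[mu]_x (xi / (xi ^+ 2 + (x - y) ^+ 2))%:E = (pi : R)%:E)%E.
Proof.
move=> xi0; rewrite -integral_oneDsqr.
pose F (x : R) := (x - y) / xi.
have dF x : is_derive x (1:R) F (xi^-1).
  have -> : F = xi^-1 *: (id - cst y) by apply/funext => t; rewrite /F mulrC.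
  by apply: is_derive_eq; rewrite subr0 [_%:A]mulr1.
have F'E : derive1 F = cst xi^-1 by apply/funext => x; rewrite derive1E; exact: derive_val.
rewrite (@increasing_ge0_integration_by_substitutionT _ F (fun x => (oneDsqr x)^-1)).
- apply: eq_integral => x _; congr EFin; rewrite /= F'E /F /oneDsqr /=.
  rewrite -[RHS]/((1 + ((x - y) / xi) ^+ 2)^-1 * xi^-1).
  field; rewrite gt_eqF//= gt_eqF//= ltr_wpDr ?sqr_ge0// exprn_gt0//.
- by move=> a b ab; rewrite /F ltr_pM2r ?invr_gt0// ltrD2r.
- by rewrite F'E => x; exact: cvg_cst.
- by rewrite F'E; exact: is_cvg_cst.
- by rewrite F'E; exact: is_cvg_cst.
- by move=> x; exact: ex_derive.
- apply/cvgrNyPle => A; near=> x; rewrite /F ler_pdivrMr// lerBlDr.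
  by near: x; exact: nbhs_ninfty_le (num_real _).
- apply/cvgryPge => A; near=> x; rewrite /F ler_pdivlMr// lerBrDr.
  by near: x; exact: nbhs_pinfty_ge (num_real _).
- exact: continuous_oneDsqrV.
- by move=> x; rewrite invr_ge0 (le_trans _ (oneDsqr_ge1 _)).
Unshelve. all: by end_near. Qed.

End PoissonKernel.

Section HalfPlane.
Context {R : realType}.
Local Notation mu := (@lebesgue_measure R).
Implicit Types (f g : R[i] -> R[i]) (w z : R[i]) (x y : R).

Lemma line_ctsP f x : (forall y, cts_at f (x +i* y)) ->
  continuous ((fun y => f (x +i* y)) : R -> R[i]^o).
Proof. by move=> cf y; exact: cts_vline. Qed.

Lemma line_cmeasurable f x : (forall y, cts_at f (x +i* y)) ->
  cmeasurable setT (fun y => f (x +i* y)).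
Proof. by move=> cf; apply: continuous_cmeasurable => //; exact: line_ctsP. Qed.

Lemma sqr_normc_line w x y :
  normc (w - (x +i* y)) ^+ 2 = `|Re w - x| ^+ 2 + (y - Im w) ^+ 2.
Proof. by rewrite sqr_normcE cReB cImB/= real_normK ?num_real//; ring. Qed.

Lemma line_neq0 w x y : Re w != x -> w - (x +i* y) != 0.
Proof.
by apply: contra => /eqP/(congr1 (@complex.Re R)); rewrite cReB/= => /eqP; rewrite subr_eq0.
Qed.

Lemma kernel_cdiff w z : w - z != 0 -> cdiff (fun z => (w - z)^-1) z.
Proof.
by move=> wz; apply: cdiffV => //; apply: cdiffB; [exact: cdiff_cst|exact: cdiff_id].
Qed.

Lemma kernel_cmeasurable w x : Re w != x ->
  cmeasurable setT (fun y => (w - (x +i* y))^-1).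
Proof.
move=> wx; apply: (@line_cmeasurable (fun z => (w - z)^-1)) => y.
by apply: cdiff_cts; apply: kernel_cdiff; exact: line_neq0.
Qed.

Lemma kernel_int w x : Re w != x ->
  (\int[mu]_y (normc ((w - (x +i* y))^-1) ^+ 2)%:E = (pi / `|Re w - x|)%:E)%E.
Proof.
move=> wx; set c := `|Re w - x|.
have c0 : 0 < c by rewrite normr_gt0 subr_eq0.
have := integral_poisson (Im w) c0.
rewrite (_ : (fun y => _) = (fun y => c%:E * (normc ((w - (x +i* y))^-1) ^+ 2)%:E)%E); last first.
  apply/funext => y; rewrite -EFinM; congr EFin.
  by rewrite ComplexField.Normc.normcV exprVn sqr_normc_line.
have mk := measurable_normc_sqr (kernel_cmeasurable wx).
rewrite (@ge0_integralZl _ _ _ mu _ measurableT).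
- move=> h; rewrite EFinM -h muleC muleA -EFinM mulVf ?gt_eqF// mul1e//.
- exact/measurable_EFinP.
- by move=> y _; rewrite lee_fin sqr_ge0.
- by rewrite lee_fin ltW.
Qed.

Lemma kernel_sqint w x : Re w != x ->
  sqint setT (fun y => (w - (x +i* y))^-1) /\
  nsq setT (fun y => (w - (x +i* y))^-1) = pi / `|Re w - x|.
Proof.
move=> wx; have mk := kernel_cmeasurable wx.
have hi : (\int[mu]_y (normc ((w - (x +i* y))^-1) ^+ 2)%:E <= (pi / `|Re w - x|)%:E)%E.
  by rewrite kernel_int.
have [h _] := (sqintP _ measurableT mk).1 hi.
split => //; apply: EFin_inj; rewrite -nsqE//.
exact: kernel_int.
Qed.

Lemma cvg_normc_sqr (T : Type) (F : set_system T) {FF : Filter F}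
    (g : T -> R[i]^o) (l : R[i]^o) :
  g @ F --> l -> (fun t => normc (g t) ^+ 2) @ F --> normc l ^+ 2.
Proof.
move=> /cvg_normc h; rewrite expr2; under eq_fun do rewrite expr2.
exact: (cvgM h h).
Qed.

(** The line [Re z = x0] belongs to the domain, so boundary values are plain
    values of [f]; functions of the Hardy space satisfy this for every [x0 >
    0]. *)
Definition hardy_on (x0 M : R) f :=
  (forall z, x0 <= Re z -> cdiff f z) /\
  (forall x, x0 <= x -> sqint setT (fun y => f (x +i* y)) /\
                        nsq setT (fun y => f (x +i* y)) <= M).

(** Horizontal segments carrying little mass of [f]: by Tonelli their average
    is controlled by the integrals over vertical lines. *)
Lemma good_height x0 M f (u T : R) : 0 < T -> hardy_on x0 M f ->
  exists d, [/\ u <= d, d <= u + T, sqint `[x0, x0 + T] (fun x => f (x +i* d)) &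
    nsq `[x0, x0 + T] (fun x => f (x +i* d)) <= M + 1].
Proof.
move=> T0 [df fM].
have sq d : sqint `[x0, x0 + T] (fun x => f (x +i* d)).
  have fi : cintegrable `[x0, x0 + T] (fun x => f (x +i* d)).
    apply: cintegrable_continuous => t /andP[h _]; apply: cts_hline.
    exact/cdiff_cts/df.
  split; first exact: cintegrable_cmeasurable.
  apply: continuous_compact_integrable; first exact: segment_compact.
  apply: continuous_in_subspaceT => t /set_mem /=; rewrite in_itv/= => /andP[h _].
  exact: (cvg_normc_sqr (cts_hline (cdiff_cts (df (t +i* d) h)))).
apply: contrapT => /forallNP h.
have {}h d : u <= d <= u + T -> M + 1 < nsq `[x0, x0 + T] (fun x => f (x +i* d)).
  move=> /andP[h1 h2]; rewrite ltNge; apply/negP => h3; apply: (h d); split => //.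
pose A : set R := `[x0, x0 + T]%classic; pose B : set R := `[u, u + T]%classic.
have mA : measurable A by exact: measurable_itv.
have mB : measurable B by exact: measurable_itv.
have mIA : measurable_fun setT (\1_A : R -> R).
  by apply: measurable_indic; exact: measurable_itv.
have mIB : measurable_fun setT (\1_B : R -> R).
  by apply: measurable_indic; exact: measurable_itv.
(* [Num.max] extends [f] to the left of the line, so that [F] is continuous in
   each variable everywhere *)
pose F (p : R * R) := normc (f (Num.max p.1 x0 +i* p.2)) ^+ 2.
have mF : measurable_fun setT F.
  apply: measurable_fun_separately_continuous => [y|x] t; rewrite /F/=.
    have hm : x0 <= Num.max t x0 by rewrite le_max lexx orbT.
    have hc : {for t, continuous ((fun t => f (Num.max t x0 +i* y)) : R -> R[i]^o)}.
      apply: (@continuous_comp R R R[i]^o (fun t => Num.max t x0) (fun s => f (s +i* y))).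
        by apply: continuous_max; [exact: cvg_id|exact: cvg_cst].
      by apply: cts_hline; exact/cdiff_cts/df.
    exact: (cvg_normc_sqr hc).
  have hm : x0 <= Num.max x x0 by rewrite le_max lexx orbT.
  exact: (cvg_normc_sqr (cts_vline (cdiff_cts (df (Num.max x x0 +i* t) hm)))).
pose G (p : R * R) : \bar R := (F p * \1_A p.1 * \1_B p.2)%:E.
have mG : measurable_fun setT G.
  apply/measurable_EFinP; apply: measurable_funM; first apply: measurable_funM => //.
    exact: (measurableT_comp mIA measurable_fst).
  exact: (measurableT_comp mIB measurable_snd).
have G0 p : (0 <= G p)%E.
  rewrite lee_fin; apply: mulr_ge0; first apply: mulr_ge0.
  - exact: sqr_ge0.
  - by rewrite indicE.
  - by rewrite indicE.
have := @fubini_tonelli _ _ _ _ R mu mu G mG G0.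
have M0 : 0 <= M by have [_] := fM x0 (lexx _); apply: le_trans; exact: nsq_ge0.
have mT (a : R) : mu `[a, a + T] = T%:E.
  by rewrite lebesgue_measure_itv/= lte_fin ltrDl T0 -EFinB addrAC subrr add0r.
have hA : (\int[mu]_x (\1_A x)%:E = T%:E)%E.
  by rewrite integral_indic// setIT; exact: mT.
have hB : (\int[mu]_x (\1_B x)%:E = T%:E)%E.
  by rewrite integral_indic// setIT; exact: mT.
have up : (\int[mu]_x \int[mu]_y G (x, y) <= (M * T)%:E)%E.
  apply: (@le_trans _ _ (\int[mu]_x (M * \1_A x)%:E)%E).
    apply: ge0_le_integral => //.
    - by move=> x _; exact: integral_ge0.
    - exact: measurable_fun_fubini_tonelli_F.
    - apply/measurable_EFinP; apply: measurable_funM; [exact: measurable_cst|exact: mIA].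
    move=> x _; have [xA|xA] := boolP (x \in A); last first.
      rewrite indicE (negbTE xA) mulr0 integral0_eq// => y _.
      by rewrite /G/= indicE (negbTE xA) mulr0 mul0r.
    rewrite indicE xA mulr1.
    have /andP[x0x _] : x0 <= x <= x0 + T by move: xA => /set_mem /=; rewrite /A/= in_itv.
    have [fx1 fx2] := fM x x0x.
    apply: (@le_trans _ _ (\int[mu]_y (normc (f (x +i* y)) ^+ 2)%:E)%E).
      apply: ge0_le_integral => //.
      - exact: (measurableT_comp mG (pair1_measurable x)).
      - apply/measurable_EFinP; apply: measurable_normc_sqr; by case: fx1.
      move=> y _; rewrite lee_fin/= /F/= (max_idPl x0x) indicE xA mulr1.
      by rewrite ler_piMr ?sqr_ge0// indicE; case: (_ \in _).
    by rewrite nsqE// lee_fin.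
  under eq_integral do rewrite EFinM.
  rewrite ge0_integralZl//; last first.
    by apply/measurable_EFinP; exact: mIA.
  by rewrite hA.
have dn : (((M + 1) * T)%:E <= \int[mu]_y \int[mu]_x G (x, y))%E.
  have -> : ((M + 1) * T)%:E = (\int[mu]_y ((M + 1) * \1_B y)%:E)%E.
    under eq_integral do rewrite EFinM.
    rewrite ge0_integralZl//; last 2 first.
    - by apply/measurable_EFinP; exact: mIB.
    - by rewrite lee_fin addr_ge0.
    by rewrite hB.
  apply: ge0_le_integral => //.
  - by move=> y _; rewrite lee_fin mulr_ge0 ?addr_ge0// indicE.
  - apply/measurable_EFinP; apply: measurable_funM; [exact: measurable_cst|exact: mIB].
  - exact: measurable_fun_fubini_tonelli_G.
  move=> y _; rewrite indicE; have [yB|_] := boolP (y \in B); last first.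
    by rewrite mulr0; apply: integral_ge0.
  rewrite mulr1; move: (yB) => /set_mem /=; rewrite /B/= in_itv/= => /h/ltW hy.
  apply: (@le_trans _ _ (nsq `[x0, (x0 + T)%R] (fun x : R => f (x +i* y)))%:E).
    by rewrite lee_fin.
  rewrite -nsqE// integral_mkcond le_eqVlt; apply/orP; left; apply/eqP.
  apply: eq_integral => x _; rewrite /G/= /patch /= !indicE yB mulr1 -/A.
  case: ifPn => [xA|_]; last by rewrite mulr0.
  move: (xA) => /set_mem; rewrite /A/= in_itv/= => /andP[x0x _].
  by rewrite mulr1 /F/= (max_idPl x0x).
move=> e; rewrite -{}e in dn.
by have := le_trans dn up; rewrite lee_fin ler_pM2r// gerDl ler10.
Qed.

End HalfPlane.

(** * Cauchy's and Poisson's formulas on a half plane *)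

Section Cauchy.
Context {R : realType}.
Local Notation mu := (@lebesgue_measure R).
Implicit Types (f g : R[i] -> R[i]) (w z : R[i]) (x y : R).

(** The Cauchy-Schwarz bound for the integral of [h / (z - p)] along a segment at
    distance at least [del] from [p]. *)
Lemma cintegral_weighted_le (g h : R -> R[i]) (a b del N : R) : a <= b -> 0 < del ->
  cintegrable `[a, b] g -> sqint `[a, b] h -> nsq `[a, b] h <= N ->
  (forall t, a <= t <= b -> normc (g t) * del <= normc (h t)) ->
  normc (cintegral `[a, b] g) ^+ 2 <= N * (b - a) / del ^+ 2.
Proof.
move=> ab d0 gi hi hN gh.
have mab : fine (mu `[a, b]) = b - a.
  rewrite lebesgue_measure_itv/= lte_fin; case: ltP => //= ba.
  by have -> : b = a; [apply/eqP; rewrite eq_le ab ba|rewrite subrr].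
have one_i : sqint `[a, b] (fun=> 1 : R[i]).
  split; first exact: cmeasurable_cst.
  apply: continuous_compact_integrable; first exact: segment_compact.
  by apply: continuous_subspaceT => ?; exact: cvg_cst.
have one_n : nsq `[a, b] (fun=> 1 : R[i]) = b - a.
  by rewrite /nsq Rintegral_cst// ComplexField.Normc.normc1 expr1n mul1r; exact: mab.
have N0 : 0 <= N by apply: le_trans hN; exact: nsq_ge0.
rewrite ler_pdivlMr ?exprn_gt0// -exprMn.
have hi1 := sqint_mul (measurable_itv _) hi one_i.
have := Rintegral_normcM (measurable_itv `[a, b]) hi one_i.
rewrite one_n => CS.
apply: (@le_trans _ _ ((\int[mu]_(t in `[a, b]) normc (h t * 1)) ^+ 2)).
  rewrite lerXn2r ?nnegrE//.
  - by rewrite mulr_ge0 ?normc_ge0// ltW.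
  - by apply: Rintegral_ge0 => t _; exact: normc_ge0.
  apply: (@le_trans _ _ (\int[mu]_(t in `[a, b]) (del * normc (g t)))).
    rewrite RintegralZl//; last exact: integrable_normc.
    by rewrite mulrC ler_pM2l// normc_cintegral_le.
  apply: le_Rintegral => //.
  - by apply: rintegrableZ => //; exact: integrable_normc.
  - exact: integrable_normc.
  - by move=> t /=; rewrite in_itv/= mulr1 mulrC; exact: gh.
by apply: (le_trans CS); rewrite ler_wpM2r// subr_ge0.
Qed.

(** Dominated convergence, the modulus of [g] being the dominating function. *)
Lemma cintegral_exhaust (g : R -> R[i]) (c d : nat -> R) :
  cintegrable setT g ->
  (forall t, \forall n \near \oo, c n <= t <= d n) ->
  (cintegral `[c n, d n] g : R[i]^o) @[n --> \oo] --> (cintegral setT g : R[i]^o).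
Proof.
move=> gi cd.
pose G n t := (\1_(`[c n, d n]%classic) t)%:C * g t : R[i].
have GE n : cintegral `[c n, d n] g = cintegral setT (G n).
  apply: complexP; rewrite ?Re_cintegral ?Im_cintegral Rintegral_mkcond;
    apply: eq_Rintegral => t _; rewrite /G /patch indicE;
    by case: ifPn => _; rewrite ?mul1r ?mul0r.
have [||||_] := @cintegral_cvg R setT G g (fun t => normc (g t)) measurableT.
- move=> n; apply: cmeasurableM; last exact: cintegrable_cmeasurable.
  split => /=; last exact: measurable_cst.
  exact: measurable_indic.
- move=> t _; apply/cvg_normcP => e e0; near=> n.
  rewrite /G indicE mem_set ?mul1r ?subrr ?ComplexField.Normc.normc0//=.
  by rewrite in_itv/=; near: n; exact: cd.
- exact: integrable_normc.
- move=> n t _; rewrite /G normcM normc_real indicE.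
  by rewrite ler_piMl ?normc_ge0//; case: (_ \in _); rewrite ?normr1 ?normr0.
by under eq_fun do rewrite -GE.
Unshelve. all: by end_near. Qed.

Lemma cvg_normc_le0 (u : nat -> R[i]) (l : R[i]) (C : R) :
  (u n : R[i]^o) @[n --> \oo] --> (l : R[i]^o) ->
  (\forall n \near \oo, normc (u n) ^+ 2 <= C / n.+1%:R) -> l = 0.
Proof.
move=> /cvg_normc_sqr ul uC; apply/eqP; rewrite -normc_eq0 -sqrf_eq0 eq_le sqr_ge0 andbT.
have h0 : (fun n : nat => C / n.+1%:R) @ \oo --> C * 0.
  by apply: cvgMl_tmp; exact: cvg_harmonic.
rewrite mulr0 in h0; exact: (ler_cvg_to ul h0 uC).
Qed.

(** On large rectangles with left side on the line, the other three sides
    contribute little: they are at distance of the order of the size [T] from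
    [p], and the horizontal ones lie at heights where [phi] has bounded mean
    square. *)
Lemma cauchy_contour x0 M (Q phi : R[i] -> R[i]) p : hardy_on x0 M phi -> x0 < Re p ->
  (forall z, x0 <= Re z -> cts_at Q z) ->
  (forall z, x0 <= Re z -> z != p -> cdiff Q z) ->
  (forall z, x0 <= Re z -> normc (Q z) * normc (z - p) <= normc (phi z)) ->
  cintegrable setT (fun y => Q (x0 +i* y)) ->
  cintegral setT (fun y => Q (x0 +i* y)) = 0.
Proof.
move=> hphi xp cQ dQ Qphi Qi.
have T0 (n : nat) : (0 : R) < n.+1%:R by rewrite ltr0n.
have hd n := @good_height R x0 M phi n.+1%:R n.+1%:R (T0 n) hphi.
have hc n := @good_height R x0 M phi (- (2 * n.+1%:R)) n.+1%:R (T0 n) hphi.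
have [d d_spec] := choice hd; have [c c_spec] := choice hc.
have M0 : 0 <= M by have [_ /(_ x0 (lexx _))[_]] := hphi; apply: le_trans; exact: nsq_ge0.
have cdn n : [/\ n.+1%:R <= d n, d n <= 2 * n.+1%:R, - (2 * n.+1%:R) <= c n & c n <= - n.+1%:R].
  by have [? ? _ _] := d_spec n; have [? ? _ _] := c_spec n; split; lra.
have ex : forall t : R, \forall n \near \oo, c n <= t <= d n.
  move=> t; near=> n; have [h1 h2 h3 h4] := cdn n.
  have : `|t| <= n.+1%:R.
    by apply: (@le_trans _ _ n%:R); [near: n; exact: nbhs_infty_ger|rewrite ler_nat].
  by rewrite ler_norml => /andP[? ?]; apply/andP; split; lra.
have lim := cintegral_exhaust Qi ex.
apply: (cvg_normc_le0 lim (C := 3 * (3 * (16 * (M + 1))))).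
near=> n; set T : R := n.+1%:R.
(* then the three other sides stay at distance [T / 2] from [p] *)
have TT : 2 * `|Im p| + 2 * (Re p - x0) + 1 <= T.
  apply: (@le_trans _ _ n%:R); last by rewrite ler_nat.
  by near: n; exact: nbhs_infty_ger.
have [h1 h2 h3 h4] := cdn n; rewrite -/T in h1 h2 h3 h4.
have T0n : 0 < T by exact: T0.
have /andP[ip1 ip2] : - `|Im p| <= Im p <= `|Im p| by rewrite -ler_norml.
have ipn : 0 <= `|Im p| by [].
have cd : c n <= d n by lra.
have xT : x0 <= x0 + T by lra.
have cQ' : forall z, in_rect x0 (x0 + T) (c n) (d n) z -> cts_at Q z.
  by move=> z [/andP[? _] _]; exact: cQ.
have E0 : rect_int Q x0 (x0 + T) (c n) (d n) = 0.
  apply: (@goursat_punctured R Q _ _ _ _ p); last 2 first.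
  - exact: cQ'.
  - by move=> z [/andP[? _] _]; exact: dQ.
  - by apply/andP; split; lra.
  - by apply/andP; split; lra.
have T20 : 0 < T / 2 by rewrite divr_gt0.
have hor y : c n <= y <= d n -> T / 2 <= `|y - Im p| ->
    sqint `[x0, x0 + T] (fun x => phi (x +i* y)) ->
    nsq `[x0, x0 + T] (fun x => phi (x +i* y)) <= M + 1 ->
    normc (cintegral `[x0, x0 + T] (fun x => Q (x +i* y))) ^+ 2 <= 16 * (M + 1) / T.
  move=> hy yp fs fn.
  have h := cintegral_weighted_le xT T20 (hseg_cintegrable cQ' hy) fs fn.
  apply: (le_trans (h _)).
    move=> t /andP[xt _]; apply: le_trans (Qphi (t +i* y) xt).
    rewrite ler_wpM2l ?normc_ge0// (le_trans yp)// (le_trans _ (Im_le_normc _))//.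
    by rewrite cImB.
  have -> : (M + 1) * (x0 + T - x0) / (T / 2) ^+ 2 = 4 * (M + 1) / T by field; rewrite gt_eqF.
  by rewrite ler_wpM2r ?invr_ge0 ?ltW//; lra.
have H1 : normc (cintegral `[x0, x0 + T] (fun x => Q (x +i* c n))) ^+ 2 <= 16 * (M + 1) / T.
  have [_ _ s1 s2] := c_spec n; apply: hor => //; first by rewrite lexx.
  rewrite distrC (le_trans _ (ler_norm _))//; lra.
have H2 : normc (cintegral `[x0, x0 + T] (fun x => Q (x +i* d n))) ^+ 2 <= 16 * (M + 1) / T.
  have [_ _ s1 s2] := d_spec n; apply: hor => //; first by rewrite lexx andbT.
  rewrite (le_trans _ (ler_norm _))//; lra.
have H3 : normc (cintegral `[c n, d n] (fun y => Q ((x0 + T) +i* y))) ^+ 2 <= 16 * (M + 1) / T.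
  have [_ /(_ (x0 + T) xT)[fs fn]] := hphi.
  have fs' : sqint `[c n, d n] (fun y => phi ((x0 + T) +i* y)).
    by apply: sqintS fs.
  have fn' : nsq `[c n, d n] (fun y => phi ((x0 + T) +i* y)) <= M.
    apply: le_trans fn; rewrite -lee_fin -nsqE//.
    rewrite -nsqE//; apply: ge0_subset_integral => //.
      by apply/measurable_EFinP; apply: measurable_normc_sqr; case: fs.
    by move=> y _; rewrite lee_fin sqr_ge0.
  have bb : x0 <= x0 + T <= x0 + T by rewrite lexx andbT.
  have h := cintegral_weighted_le cd T20 (vseg_cintegrable cQ' bb) fs' fn'.
  apply: (le_trans (h _)).
    move=> t _; apply: le_trans (Qphi ((x0 + T) +i* t) xT).
    rewrite ler_wpM2l ?normc_ge0// (le_trans _ (Re_le_normc _))//.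
    rewrite cReB/= (le_trans _ (ler_norm _))//; lra.
  have -> : M * (d n - c n) / (T / 2) ^+ 2 = 4 * M * (d n - c n) / T / T by field; rewrite gt_eqF.
  rewrite ler_wpM2r ?invr_ge0 ?(ltW T0n)// ler_pdivrMr//.
  have : M * (d n - c n) <= M * (4 * T) by rewrite ler_wpM2l//; lra.
  nra.
have ni : normc ('i : R[i]) = 1 by rewrite /= expr0n add0r expr1n sqrtr1.
have : normc (cintegral `[c n, d n] (fun y => Q (x0 +i* y))) <=
    normc (cintegral `[x0, x0 + T] (fun x => Q (x +i* c n))) +
    normc (cintegral `[x0, x0 + T] (fun x => Q (x +i* d n))) +
    normc (cintegral `[c n, d n] (fun y => Q ((x0 + T) +i* y))).
  move: E0; rewrite /rect_int; set u1 := cintegral _ _; set u2 := cintegral _ _.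
  set u3 := cintegral _ _; set u4 := cintegral _ _ => E0.
  have -> : normc u4 = normc (u1 - u2 + 'i * u3).
    have -> : u1 - u2 + 'i * u3 = 'i * u4.
      apply/eqP; rewrite -subr_eq0; apply/eqP; rewrite -[RHS]E0; ring.
    by rewrite normcM ni mul1r.
  by rewrite (le_trans (le_normcD _ _))// normcM ni mul1r lerD2r normcB.
move: H1 H2 H3; set a1 := normc _; set a2 := normc _; set a3 := normc _; set a4 := normc _.
move=> H1 H2 H3 H4.
have p1 : 0 <= a1 := normc_ge0 _.
have p2 : 0 <= a2 := normc_ge0 _.
have p3 : 0 <= a3 := normc_ge0 _.
have p4 : 0 <= a4 := normc_ge0 _.
have -> : 3 * (3 * (16 * (M + 1))) / T = 3 * (3 * (16 * (M + 1) / T)) by rewrite !mulrA.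
move: (16 * (M + 1) / T) H1 H2 H3 => W H1 H2 H3.
apply: (@le_trans _ _ (3 * (a1 ^+ 2 + a2 ^+ 2 + a3 ^+ 2))); last by lra.
have : a4 ^+ 2 <= (a1 + a2 + a3) ^+ 2 by rewrite lerXn2r// nnegrE !addr_ge0.
have := sqr_ge0 (a1 - a2); have := sqr_ge0 (a1 - a3); have := sqr_ge0 (a2 - a3).
move: (a1) (a2) (a3) (a4) => b1 b2 b3 b4; nra.
Unshelve. all: by end_near. Qed.

Lemma cdiff_local f g z : (exists2 e : R, 0 < e & forall w, normc (w - z) < e -> f w = g w) ->
  cdiff f z -> cdiff g z.
Proof.
move=> [e e0 fg] /cdiffP[l hl]; apply/cdiffP; exists l => r /hl[d d0 hd].
exists (Num.min d e) => [|w w0]; first by rewrite lt_min d0.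
rewrite lt_min => /andP[wd we]; rewrite -!fg ?hd//.
by rewrite subrr ComplexField.Normc.normc0.
Qed.

(** The product of the Cauchy kernel with its conjugate is positive: up to
    normalisation it is the Poisson kernel of [w]. *)
Lemma poisson_mass w x0 : x0 < Re w ->
  cintegrable setT (fun y => (2 * (Re w - x0))%:C * ((w - (x0 +i* y))^-1 * conjc ((w - (x0 +i* y))^-1))) /\
  cintegral setT (fun y => (2 * (Re w - x0))%:C * ((w - (x0 +i* y))^-1 * conjc ((w - (x0 +i* y))^-1)))
   = (2 * pi)%:C.
Proof.
move=> xw; have wx : Re w != x0 by rewrite gt_eqF.
have [ks kn] := kernel_sqint wx.
have ki := sqint_mul measurableT ks (sqintJ measurableT ks).
split; first exact: cintegrableZ.
rewrite cintegralZ//.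
rewrite cintegral_mul_conj.
rewrite kn -rmorphM/= gtr0_norm ?subr_gt0//; congr (_%:C); field.
by rewrite subr_eq0 gt_eqF.
Qed.

(** The function [K] equal to [1] at [w] whose boundary values on the line turn
    the Cauchy kernel of [w] into the Poisson kernel. *)
Definition poisson_factor w (x0 : R) z : R[i] :=
  (2 * (Re w - x0))%:C * (z + conjc w - (2 * x0)%:C)^-1.

Lemma poisson_factor_denom w x0 z : x0 < Re w -> x0 <= Re z ->
  Re w - x0 <= normc (z + conjc w - (2 * x0)%:C).
Proof.
move=> xw xz; rewrite (le_trans _ (Re_le_normc _))// (le_trans _ (ler_norm _))//.
rewrite cReB cReD cReJ/=; lra.
Qed.

Lemma poisson_factor_denom_neq0 w x0 z : x0 < Re w -> x0 <= Re z ->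
  z + conjc w - (2 * x0)%:C != 0.
Proof.
move=> xw xz; rewrite -normc_gt0; apply: lt_le_trans (poisson_factor_denom xw xz).
by rewrite subr_gt0.
Qed.

Lemma poisson_factor_le w x0 z : x0 < Re w -> x0 <= Re z ->
  normc (poisson_factor w x0 z) <= 2.
Proof.
move=> xw xz; have h := poisson_factor_denom xw xz.
have xi0 : 0 < Re w - x0 by rewrite subr_gt0.
have p2 : 0 <= 2 * (Re w - x0) by rewrite mulr_ge0// ltW.
rewrite normcM normc_real ComplexField.Normc.normcV ger0_norm//.
rewrite ler_pdivrMr ?(lt_le_trans xi0)//; lra.
Qed.

Lemma poisson_factor_cdiff w x0 z : x0 < Re w -> x0 <= Re z ->
  cdiff (poisson_factor w x0) z.
Proof.
move=> xw xz; apply: cdiffZ; apply: cdiffV; first exact: poisson_factor_denom_neq0.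
by apply: cdiffB; [apply: cdiffD; [exact: cdiff_id|exact: cdiff_cst]|exact: cdiff_cst].
Qed.

Lemma poisson_factor1 w x0 : x0 < Re w -> poisson_factor w x0 w = 1.
Proof.
move=> xw; rewrite /poisson_factor.
have -> : w + conjc w - (2 * x0)%:C = (2 * (Re w - x0))%:C.
  by apply: complexP; rewrite ?cReB ?cImB ?cReD ?cImD ?cReJ ?cImJ/=; ring.
rewrite divff// -normc_eq0 normc_real normr_eq0 mulf_neq0// subr_eq0 gt_eqF//.
Qed.

Lemma poisson_factor_line w x0 y :
  poisson_factor w x0 (x0 +i* y) = (2 * (Re w - x0))%:C * conjc ((w - (x0 +i* y))^-1).
Proof.
rewrite /poisson_factor conjc_inv; congr (_ * _^-1).
by apply: complexP; rewrite ?cReB ?cImB ?cReJ ?cImJ ?cReD ?cImD ?cReB ?cImB ?cReJ ?cImJ/=; ring.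
Qed.

Lemma hardy_onM x0 M C f g : hardy_on x0 M f -> 0 <= C ->
  (forall z, x0 <= Re z -> cdiff g z) ->
  (forall z, x0 <= Re z -> normc (g z) <= C) ->
  hardy_on x0 (C ^+ 2 * M) (fun z => f z * g z).
Proof.
move=> [df fM] C0 dg gC; split; first by move=> z xz; apply: cdiffM; [exact: df|exact: dg].
move=> x xx; have [fi fn] := fM x xx.
have mfg : cmeasurable setT (fun y => f (x +i* y) * g (x +i* y)).
  apply: cmeasurableM; first by case: fi.
  by apply: line_cmeasurable => y; exact/cdiff_cts/dg.
have le t : normc (f (x +i* t) * g (x +i* t)) ^+ 2 <= C ^+ 2 * normc (f (x +i* t)) ^+ 2.
  rewrite normcM exprMn mulrC ler_wpM2r ?sqr_ge0// lerXn2r ?nnegrE ?normc_ge0//.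
  exact: gC.
have fgi : sqint setT (fun y => f (x +i* y) * g (x +i* y)).
  apply: (le_sqint _ mfg (g := fun t => C ^+ 2 * normc (f (x +i* t)) ^+ 2)) => //.
  by apply: rintegrableZ => //; case: fi.
split => //; apply: (@le_trans _ _ (C ^+ 2 * nsq setT (fun y => f (x +i* y)))); last first.
  by rewrite ler_wpM2l ?sqr_ge0.
rewrite /nsq -RintegralZl//; last by case: fi.
apply: le_Rintegral => //; first by case: fgi.
by apply: rintegrableZ => //; case: fi.
Qed.

(** Cauchy's formula on a half plane.  Subtracting [f w * K], with [K] the
    factor above, makes the numerator vanish at [w], so that the quotient [Q]
    by [z - w] is continuous there and integrates to zero; the constant [2 pi]
    is the mass of the Poisson kernel. *)
Lemma cauchy_halfplane x0 M f w : hardy_on x0 M f -> x0 < Re w ->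
  cintegral setT (fun y => f (x0 +i* y) * (w - (x0 +i* y))^-1) = (2 * pi)%:C * f w.
Proof.
move=> hf xw; have [df fM] := hf.
pose K := poisson_factor w x0.
pose phi z := f z - f w * K z.
have wx : Re w != x0 by rewrite gt_eqF.
have xi0 : 0 < Re w - x0 by rewrite subr_gt0.
have dphi z : x0 <= Re z -> cdiff phi z.
  move=> xz; apply: cdiffB; first exact: df.
  by apply: cdiffZ; exact: poisson_factor_cdiff.
have phiw : phi w = 0 by rewrite /phi /K poisson_factor1// mulr1 subrr.
have KE x y : K (x +i* y) = (- (2 * (Re w - x0))%:C) * (((2 * x0)%:C - conjc w) - (x +i* y))^-1.
  rewrite /K /poisson_factor mulNr -mulrN -invrN; congr (_ * _^-1); ring.
have ww x : x0 <= x -> Re ((2 * x0)%:C - conjc w) != x.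
  by move=> xx; rewrite cReB cReJ/= lt_eqF//; lra.
have hphi : hardy_on x0 (2 * M + 2 * (normc (f w) ^+ 2 * ((2 * (Re w - x0)) ^+ 2 * (pi / (Re w - x0))))) phi.
  split => // x xx; have [fs fn] := fM x xx.
  have [ks kn] := kernel_sqint (ww x xx).
  have Ks : sqint setT (fun y => K (x +i* y)).
    apply: eq_sqint (sqintZ (- (2 * (Re w - x0))%:C) measurableT ks) => y.
    by rewrite KE.
  have Kn : nsq setT (fun y => K (x +i* y)) <= (2 * (Re w - x0)) ^+ 2 * (pi / (Re w - x0)).
    rewrite (@eq_nsq _ _ _ (fun y => - (2 * (Re w - x0))%:C * (((2 * x0)%:C - conjc w) - (x +i* y))^-1)); last first.
      by move=> y _; rewrite KE.
    rewrite nsqZ// kn normcN normc_real ger0_norm; last by rewrite mulr_ge0// ltW.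
    rewrite ler_wpM2l ?sqr_ge0// ler_wpM2l ?pi_ge0// lef_pV2 ?posrE ?normr_gt0 ?subr_eq0 ?ww//.
    rewrite cReB cReJ/= distrC (le_trans _ (ler_norm _))//; lra.
  have fKs := sqintZ (f w) measurableT Ks.
  split; first exact: sqintB.
  apply: (le_trans (nsqD_le measurableT fs (sqintN measurableT fKs))).
  by rewrite nsqN nsqZ// lerD// ler_pM2l// ler_wpM2l// sqr_ge0.
(* the difference quotient of [phi] at its zero [w], continuous at [w] but not
   known to be differentiable there *)
have /cdiffP[l hl] := dphi w (ltW xw).
pose Q z := if z == w then l else phi z / (z - w).
have dQ z : x0 <= Re z -> z != w -> cdiff Q z.
  move=> xz zw; apply: (@cdiff_local (fun z => phi z / (z - w))).
    exists (normc (w - z)) => [|v vz]; first by rewrite normc_gt0 subr_eq0 eq_sym.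
    rewrite /Q; case: eqP => // vw; move: vz; rewrite vw normcBC ltxx//.
  apply: cdiffM; first exact: dphi.
  apply: cdiffV; first by rewrite subr_eq0.
  by apply: cdiffB; [exact: cdiff_id|exact: cdiff_cst].
have cQ z : x0 <= Re z -> cts_at Q z.
  move=> xz; have [->|zw] := eqVneq z w; last exact/cdiff_cts/dQ.
  apply/cts_atP => e e0; have [d d0 hd] := hl e e0.
  exists d => // v; rewrite /Q eqxx => vd.
  case: eqP => [_|/eqP vw]; first by rewrite subrr ComplexField.Normc.normc0.
  by have := hd v; rewrite phiw subr0; apply => //; rewrite normc_gt0 subr_eq0.
have lw y : x0 +i* y != w.
  by apply/eqP => /(congr1 (@complex.Re R))/= h; move: xw; rewrite -h ltxx.
have QE y : Q (x0 +i* y) = - (f (x0 +i* y) * (w - (x0 +i* y))^-1) +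
   f w * ((2 * (Re w - x0))%:C * ((w - (x0 +i* y))^-1 * conjc ((w - (x0 +i* y))^-1))).
  rewrite /Q (negbTE (lw y)) /phi /K poisson_factor_line.
  rewrite -[_ - w]opprB invrN; ring.
have [fs _] := fM x0 (lexx _).
have [ks _] := kernel_sqint wx.
have fk := sqint_mul measurableT fs ks.
have [Pi Pm] := poisson_mass xw.
have Qi : cintegrable setT (fun y => Q (x0 +i* y)).
  under eq_fun do rewrite QE -mulN1r.
  by apply: cintegrableD => //; exact: cintegrableZ.
have Q0 : cintegral setT (fun y => Q (x0 +i* y)) = 0.
  apply: (@cauchy_contour x0 _ Q phi w hphi xw cQ dQ) => // z xz.
  rewrite /Q; case: eqP => [->|/eqP zw].
    by rewrite subrr ComplexField.Normc.normc0 mulr0 normc_ge0.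
  by rewrite -normcM divfK// subr_eq0.
move: Q0; under eq_fun do rewrite QE -mulN1r.
rewrite cintegralD//; [|exact: cintegrableZ|exact: cintegrableZ].
rewrite (@cintegralZ _ _ (-1))// (@cintegralZ _ _ (f w))// Pm mulN1r => /eqP; rewrite addrC subr_eq0 => /eqP <-.
by rewrite mulrC.
Qed.

(** Cauchy's formula for the product of [f] and [poisson_factor w x0], which has
    the value [f w] at [w] and turns the Cauchy kernel into the Poisson kernel. *)
Lemma poisson_formula x0 M f w : hardy_on x0 M f -> x0 < Re w ->
  cintegral setT (fun y => f (x0 +i* y) *
    ((2 * (Re w - x0))%:C * ((w - (x0 +i* y))^-1 * conjc ((w - (x0 +i* y))^-1))))
  = (2 * pi)%:C * f w.
Proof.
move=> hf xw.
have hfK := hardy_onM hf (ler0n _ 2) (fun z => @poisson_factor_cdiff w x0 z xw)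
  (fun z => @poisson_factor_le w x0 z xw).
have := cauchy_halfplane hfK xw; rewrite poisson_factor1// mulr1 => <-.
apply: eq_cintegral => y _; rewrite poisson_factor_line; ring.
Qed.

End Cauchy.

(** * Square means along vertical lines *)

Section HardySpace.
Context {R : realType}.
Local Notation mu := (@lebesgue_measure R).
Implicit Types (f g : R[i] -> R[i]) (w z : R[i]) (x y : R).

Definition line f x : R -> R[i] := fun y => f (x +i* y).

(** Jensen's inequality for the Poisson integral, from the nonnegativity of the
    variance. *)
Lemma poisson_jensen x0 M f w : hardy_on x0 M f -> x0 < Re w ->
  (((2 * pi) * normc (f w) ^+ 2)%:E <=
   \int[mu]_y (normc (f (x0 +i* y)) ^+ 2 *
      (2 * ((Re w - x0) / ((Re w - x0) ^+ 2 + (Im w - y) ^+ 2))))%:E)%E.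
Proof.
move=> hf xw; have [df fM] := hf; have [[mu_ ui] _] := fM x0 (lexx _).
set xi := Re w - x0; have xi0 : 0 < xi by rewrite subr_gt0.
pose k y := (w - (x0 +i* y))^-1.
pose p y := 2 * xi * normc (k y) ^+ 2.
have pE y : p y = 2 * (xi / (xi ^+ 2 + (Im w - y) ^+ 2)).
  rewrite /p /k ComplexField.Normc.normcV exprVn sqr_normc_line (gtr0_norm xi0).
  by rewrite -(sqrrN (y - _)) opprB mulrA.
have p0 y : 0 <= p y by rewrite mulr_ge0 ?sqr_ge0// mulr_ge0// ltW.
have pP y : (2 * xi)%:C * (k y * conjc (k y)) = (p y)%:C by rewrite mulc_conj -rmorphM.
have wx : Re w != x0 by rewrite gt_eqF.
have [[mk ki] kn] := kernel_sqint wx.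
have [Pi Pm] := poisson_mass xw; have Pf := poisson_formula hf xw.
rewrite -/xi in Pi Pm Pf.
have p_le y : p y <= 2 / xi.
  rewrite pE ler_pM2l// ler_pdivrMr; last by rewrite ltr_wpDr ?sqr_ge0// exprn_gt0.
  by rewrite mulrDr expr2 mulrA mulVf ?gt_eqF// mul1r lerDl mulr_ge0 ?sqr_ge0// invr_ge0 ltW.
have mp : measurable_fun setT p by apply: measurable_funM => //; exact: measurable_normc_sqr.
have ip : mu.-integrable setT (EFin \o p) by exact: rintegrableZ.
have iup : mu.-integrable setT (EFin \o (fun y => normc (f (x0 +i* y)) ^+ 2 * p y)).
  apply: (le_integrable (mu:=mu) _ _ _ (rintegrableZ (2 / xi) measurableT ui)) => //=.
    by apply/measurable_EFinP; apply: measurable_funM => //; exact: measurable_normc_sqr.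
  move=> y _; rewrite lee_fin ger0_norm; last by rewrite mulr_ge0 ?sqr_ge0.
  rewrite ger0_norm; last by rewrite mulr_ge0 ?sqr_ge0 ?divr_ge0// ltW.
  by rewrite mulrC ler_wpM2r ?sqr_ge0.
have iup' : cintegrable setT (fun y => f (x0 +i* y) * (p y)%:C).
  apply: (@le_cintegrable _ _ _ (fun y => 2^-1 * p y + 2^-1 * (normc (f (x0 +i* y)) ^+ 2 * p y))) => //.
  - by apply: cmeasurableM => //; split => //; exact: measurable_cst.
  - by apply: rintegrableD => //; exact: rintegrableZ.
  move=> y _; rewrite normcM normc_real (ger0_norm (p0 y)).
  have := mulr_ge0 (p0 y) (sqr_ge0 (normc (f (x0 +i* y)) - 1)).
  move: (normc _) (p y) => a b; nra.
have -> : (\int[mu]_y (normc (f (x0 +i* y)) ^+ 2 *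
      (2 * (xi / (xi ^+ 2 + (Im w - y) ^+ 2))))%:E =
   (\int[mu]_y (normc (f (x0 +i* y)) ^+ 2 * p y))%:E)%E.
  rewrite /Rintegral fineK; last exact: integrable_fin_num.
  by apply: eq_integral => y _; rewrite -pE.
rewrite lee_fin.
set m := f w.
have Ip : \int[mu]_y p y = 2 * pi.
  have /(congr1 (@complex.Re R)) := Pm; rewrite Re_cintegral /= => <-.
  by apply: eq_Rintegral => y _; rewrite pP.
have Iup : cintegral setT (fun y => f (x0 +i* y) * (p y)%:C) = (2 * pi)%:C * m.
  by rewrite -Pf; apply: eq_cintegral => y _; rewrite pP.
have cm : Re (cintegral setT (fun y => conjc m * (f (x0 +i* y) * (p y)%:C))) = 2 * pi * normc m ^+ 2.
  rewrite cintegralZ// Iup mulrCA [conjc m * m]mulrC mulc_conj -rmorphM//.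
have [iR _] := cintegrableZ (conjc m) measurableT iup'.
have : \int[mu]_y (2 * Re (conjc m * (f (x0 +i* y) * (p y)%:C)) + (- normc m ^+ 2) * p y) <=
       \int[mu]_y (normc (f (x0 +i* y)) ^+ 2 * p y).
  apply: le_Rintegral => //.
    by apply: rintegrableD => //; exact: rintegrableZ.
  move=> y _; have := mulr_ge0 (p0 y) (sqr_ge0 (normc (f (x0 +i* y) - m))).
  have -> : Re (conjc m * (f (x0 +i* y) * (p y)%:C)) = Re (f (x0 +i* y) * conjc m) * p y.
    by rewrite mulrA cReM/= mulr0 subr0 [conjc m * _]mulrC.
  have := sqr_normcD (f (x0 +i* y)) (- m); rewrite normcN => ->.
  have -> : Re (f (x0 +i* y) * conjc (- m)) = - Re (f (x0 +i* y) * conjc m).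
    by rewrite rmorphN mulrN cReN.
  move: (Re _) (p y) (normc (f _) ^+ 2) (normc m ^+ 2) => a b c d; nra.
rewrite RintegralD//; [|exact: rintegrableZ|exact: rintegrableZ].
rewrite (@RintegralZl _ _ _ mu _ (fun y => Re (conjc m * (f (x0 +i* y) * (p y)%:C))) 2)//.
rewrite (@RintegralZl _ _ _ mu _ p)// -Re_cintegral cm Ip.
move: (normc m ^+ 2) (pi : R) (\int[mu]_y _) => a b c; lra.
Qed.

(** Integrate Jensen's inequality over the line through [x] and exchange the two
    integrals: the Poisson kernel has mass [2 pi] in either variable. *)
Lemma hardy_on_mono x0 M f x : hardy_on x0 M f -> x0 <= x ->
  nsq setT (line f x) <= nsq setT (line f x0).
Proof.
move=> hf; rewrite le_eqVlt => /predU1P[->//|xx].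
have [df fM] := hf; have [si _] := fM x0 (lexx _); have [sx _] := fM x (ltW xx).
set xi := x - x0; have xi0 : 0 < xi by rewrite subr_gt0.
rewrite -lee_fin -!nsqE//.
have den (t : R) : 0 < xi ^+ 2 + t ^+ 2 by rewrite ltr_wpDr ?sqr_ge0// exprn_gt0.
pose F (q : R * R) := normc (f (x0 +i* q.2)) ^+ 2 * (2 * (xi / (xi ^+ 2 + (q.1 - q.2) ^+ 2))).
have cu : continuous (fun y => normc (f (x0 +i* y)) ^+ 2).
  move=> y; apply: (@cvg_normc_sqr R _ _ _ (fun y => f (x0 +i* y))).
  by apply: cts_vline; apply: cdiff_cts; exact: df.
have ck (g : R -> R) : continuous g -> continuous (fun y => xi / (xi ^+ 2 + (g y) ^+ 2)).
  move=> cg y; apply: cvgM; first exact: cvg_cst.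
  apply: cvgV; first by rewrite gt_eqF.
  apply: cvgD; first exact: cvg_cst.
  by rewrite expr2; under eq_fun do rewrite expr2; exact: (cvgM (cg y) (cg y)).
have cl (y : R) : continuous (fun t : R => t - y).
  by move=> t; apply: cvgB; [exact: cvg_id|exact: cvg_cst].
have cr (e : R) : continuous (fun t : R => e - t).
  by move=> t; apply: cvgB; [exact: cvg_cst|exact: cvg_id].
have mF : measurable_fun setT F.
  apply: measurable_fun_separately_continuous => [y|e] t; rewrite /F/=.
    apply: cvgM; first exact: cvg_cst.
    apply: cvgM; first exact: cvg_cst.
    exact: (ck _ (cl y)).
  apply: cvgM; first exact: cu.
  apply: cvgM; first exact: cvg_cst.
  exact: (ck _ (cr e)).
have mG : measurable_fun setT (fun q => (F q)%:E) by exact/measurable_EFinP.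
have F0 q : (0 <= (F q)%:E)%E.
  by rewrite lee_fin mulr_ge0 ?sqr_ge0// mulr_ge0// divr_ge0 ?ltW.
have two_pi : (0 : R) < 2 * pi by rewrite mulr_gt0// pi_gt0.
have lo : (\int[mu]_e ((2 * pi) * normc (f (x +i* e)) ^+ 2)%:E <= \int[mu]_e \int[mu]_y (F (e, y))%:E)%E.
  apply: ge0_le_integral => //.
  - by move=> e _; rewrite lee_fin mulr_ge0 ?sqr_ge0// ltW.
  - apply/measurable_EFinP; apply: measurable_funM => //.
    by apply: measurable_normc_sqr; case: sx.
  - exact: (@measurable_fun_fubini_tonelli_F _ _ _ _ R mu (fun q => (F q)%:E) mG F0).
  - by move=> e _; exact: (poisson_jensen (w := x +i* e) hf xx).
have hi y : (\int[mu]_e (F (e, y))%:E = ((2 * pi) * normc (f (x0 +i* y)) ^+ 2)%:E)%E.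
  rewrite (_ : (fun e => (F (e, y))%:E) = (fun e => (2 * normc (f (x0 +i* y)) ^+ 2)%:E * (xi / (xi ^+ 2 + (e - y) ^+ 2))%:E)%E); last first.
    by apply/funext => e; rewrite /F/= -EFinM; congr EFin; ring.
  rewrite (@ge0_integralZl _ _ _ mu _ measurableT).
  - by rewrite integral_poisson// -EFinM; congr EFin; ring.
  - apply/measurable_EFinP; apply: continuous_measurable_fun.
    exact: (ck _ (cl y)).
  - by move=> e _; rewrite lee_fin divr_ge0 ?ltW.
  - by rewrite lee_fin mulr_ge0 ?sqr_ge0.
have Z (g : R -> R[i]) : sqint setT g ->
    (\int[mu]_e ((2 * pi) * normc (g e) ^+ 2)%:E = ((2 * pi) * nsq setT g)%:E)%E.
  move=> gi; rewrite EFinM -nsqE// -(@ge0_integralZl _ _ _ mu _ measurableT).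
  - by apply: eq_integral => e _; rewrite EFinM.
  - by apply/measurable_EFinP; apply: measurable_normc_sqr; case: gi.
  - by move=> e _; rewrite lee_fin sqr_ge0.
  - by rewrite lee_fin ltW.
have I2 : (\int[mu]_y \int[mu]_e (F (e, y))%:E = ((2 * pi) * nsq setT (line f x0))%:E)%E.
  by rewrite -Z//; apply: eq_integral => y _; exact: hi.
have FT := @fubini_tonelli _ _ _ _ R mu mu _ mG F0.
move: lo; rewrite {}FT I2 (Z (line f x) sx) lee_fin ler_pM2l//.
by move=> h; rewrite !nsqE// lee_fin.
Qed.

End HardySpace.

(** * The Hardy space and its inner product *)

Section HardyNorm.
Context {R : realType}.
Local Notation mu := (@lebesgue_measure R).
Implicit Types (f g : R[i] -> R[i]) (w z : R[i]) (x y : R).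

Lemma two_pi_gt0 : (0 : R) < 2 * pi.
Proof. by rewrite mulr_gt0// pi_gt0. Qed.

Lemma two_pi_neq0 : 2 * pi != 0 :> R.
Proof. by rewrite gt_eqF// two_pi_gt0. Qed.

Lemma two_piC_neq0 : (2 * pi : R)%:C != 0.
Proof. by rewrite -normc_gt0 normc_real normr_gt0 two_pi_neq0. Qed.

Lemma cvgC_unique (u : nat -> R[i]) (a b : R[i]) :
  (u n : R[i]^o) @[n --> \oo] --> (a : R[i]^o) ->
  (u n : R[i]^o) @[n --> \oo] --> (b : R[i]^o) -> a = b.
Proof. by move=> ua ub; exact: (cvg_unique _ ua ub). Qed.

Lemma cvgR_unique (u : nat -> R) (a b : R) : u @ \oo --> a -> u @ \oo --> b -> a = b.
Proof. by move=> ua ub; exact: (cvg_unique _ ua ub). Qed.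

Lemma cvgC_D (u v : nat -> R[i]) (a b : R[i]) :
  (u n : R[i]^o) @[n --> \oo] --> (a : R[i]^o) ->
  (v n : R[i]^o) @[n --> \oo] --> (b : R[i]^o) ->
  (u n + v n : R[i]^o) @[n --> \oo] --> (a + b : R[i]^o).
Proof. by move=> ua vb; exact: (cvgD ua vb). Qed.

Lemma cvgC_M (u v : nat -> R[i]) (a b : R[i]) :
  (u n : R[i]^o) @[n --> \oo] --> (a : R[i]^o) ->
  (v n : R[i]^o) @[n --> \oo] --> (b : R[i]^o) ->
  (u n * v n : R[i]^o) @[n --> \oo] --> (a * b : R[i]^o).
Proof. by move=> ua vb; exact: (cvgM ua vb). Qed.

Lemma cvgC_cst (c : R[i]) : ((fun _ : nat => c) n : R[i]^o) @[n --> \oo] --> (c : R[i]^o).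
Proof. exact: (@cvg_cst R[i]^o c _ \oo). Qed.

Lemma cvgC_Ml (c : R[i]) (u : nat -> R[i]) (a : R[i]) :
  (u n : R[i]^o) @[n --> \oo] --> (a : R[i]^o) ->
  (c * u n : R[i]^o) @[n --> \oo] --> (c * a : R[i]^o).
Proof. by move=> ua; exact: (@cvgC_M (fun=> c) u c a (@cvgC_cst c) ua). Qed.

Lemma cvgC_sum k (u : 'I_k -> nat -> R[i]) (a : 'I_k -> R[i]) :
  (forall i, (u i n : R[i]^o) @[n --> \oo] --> (a i : R[i]^o)) ->
  (\sum_(i < k) u i n : R[i]^o) @[n --> \oo] --> (\sum_(i < k) a i : R[i]^o).
Proof.
elim: k u a => [|k IH] u a ua.
  by under eq_fun do rewrite big_ord0; rewrite big_ord0; exact: cvgC_cst.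
under eq_fun do rewrite big_ord_recr/=; rewrite big_ord_recr/=.
by apply: cvgC_D; [exact: IH|exact: ua].
Qed.

Lemma sqrte_le (I : \bar R) (k c : R) : (0 <= I)%E -> 0 < k -> 0 <= c ->
  ((k^-1%:E * I) `^ 2^-1 <= c%:E)%E <-> (I <= (k * c ^+ 2)%:E)%E.
Proof.
move=> I0 k0 c0; have k10 : 0 < k^-1 by rewrite invr_gt0.
rewrite poweR12_sqrt; last by rewrite mule_ge0// lee_fin ltW.
case: I I0 => [r| |]//.
- rewrite lee_fin => r0; rewrite -EFinM /= !lee_fin.
  have -> : c = Num.sqrt (c ^+ 2) by rewrite sqrtr_sqr ger0_norm.
  rewrite sqr_sqrtr ?sqr_ge0// ler_sqrt ?sqr_ge0//.
  by rewrite ler_pdivrMl.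
- by rewrite gt0_muley ?lte_fin//=.
Qed.

Lemma hardy_norm_le f (c : R) : 0 <= c ->
  (hardy_norm f <= c%:E)%E <->
  forall x, 0 < x ->
    (\int[mu]_y (normc (f (x +i* y)) ^+ 2)%:E <= (2 * pi * c ^+ 2)%:E)%E.
Proof.
move=> c0; have I0 x : (0 <= \int[mu]_y (normc (f (x +i* y)) ^+ 2)%:E)%E.
  by apply: integral_ge0 => y _; rewrite lee_fin sqr_ge0.
split=> [/ereal_supP h x x0|h].
  by apply/(sqrte_le (I0 x) two_pi_gt0 c0); apply: h; exists x.
apply/ereal_supP => _ [x /= x0 <-].
by apply/(sqrte_le (I0 x) two_pi_gt0 c0); exact: h.
Qed.

Lemma hardy_norm_ge0 f : (0 <= hardy_norm f)%E.
Proof.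
apply: le_trans (ereal_sup_ubound _); last by exists 1 => //=; exact: ltr01.
exact: poweR_ge0.
Qed.

(** The squared norm as a real number.  Squares are what polarization and the
    parallelogram law speak of. *)
Definition hsq f : R := fine (hardy_norm f) ^+ 2.

Lemma hsq_ge0 f : 0 <= hsq f. Proof. exact: sqr_ge0. Qed.

Lemma H2_analytic f z : H2 f -> 0 < Re z -> cdiff f z.
Proof. by move=> [af _] z0; rewrite cdiffE; exact: af. Qed.

Lemma H2_line_cmeasurable f x : (forall z, 0 < Re z -> cdiff f z) -> 0 < x ->
  cmeasurable setT (line f x).
Proof.
move=> df x0; apply: (@line_cmeasurable R f) => y; apply: cdiff_cts.
exact: df.
Qed.

Lemma hardy_normE f : H2 f -> hardy_norm f = (Num.sqrt (hsq f))%:E.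
Proof.
move=> [_ fo]; rewrite sqrtr_sqr ger0_norm; last exact/fine_ge0/hardy_norm_ge0.
by rewrite fineK// ge0_fin_numE// hardy_norm_ge0.
Qed.

Lemma H2_line f x : H2 f -> 0 < x ->
  sqint setT (line f x) /\ nsq setT (line f x) <= 2 * pi * hsq f.
Proof.
move=> Hf x0.
apply: (sqintP _ measurableT (H2_line_cmeasurable (fun z => H2_analytic Hf) x0)).1.
have := (@hardy_norm_le f (Num.sqrt (hsq f)) (sqrtr_ge0 _)).1.
rewrite -hardy_normE// => /(_ (lexx _)) /(_ x x0).
by rewrite sqr_sqrtr ?hsq_ge0.
Qed.

(** The norm is a supremum of normalised square roots; all membership proofs use
    this form, with plain integrals over lines. *)
Lemma H2_intro f (C : R) : 0 <= C -> (forall z, 0 < Re z -> cdiff f z) ->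
  (forall x, 0 < x -> sqint setT (line f x) /\ nsq setT (line f x) <= 2 * pi * C) ->
  H2 f /\ hsq f <= C.
Proof.
move=> C0 df fC.
have h : (hardy_norm f <= (Num.sqrt C)%:E)%E.
  apply/hardy_norm_le; first exact: sqrtr_ge0.
  move=> x x0; rewrite sqr_sqrtr//.
  apply: (sqintP _ measurableT (H2_line_cmeasurable df x0)).2.
  exact: fC.
have Hf : H2 f.
  split; last by rewrite (le_lt_trans h)// ltry.
  by move=> z z0; rewrite -cdiffE; exact: df.
split => //; move: h; rewrite hardy_normE// lee_fin ler_sqrt//.
Qed.

Lemma H2_hardy_on f x : H2 f -> 0 < x -> hardy_on x (2 * pi * hsq f) f.
Proof.
move=> Hf x0; split => [z xz|x' xx'].
  by apply: H2_analytic Hf _; exact: lt_le_trans xz.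
by apply: H2_line => //; exact: lt_le_trans xx'.
Qed.

(** Abscissae of lines approaching the boundary. *)
Definition xs (n : nat) : R := n.+1%:R^-1.
Lemma xs_gt0 n : 0 < xs n. Proof. by rewrite invr_gt0. Qed.

(** The supremum defining the norm is a limit along the lines [x = 1/(n+1)];
    this is what makes the polarized norm an inner product. *)
Lemma hsq_cvg f : H2 f -> nsq setT (line f (xs n)) @[n --> \oo] --> 2 * pi * hsq f.
Proof.
move=> Hf.
have nd : nondecreasing_seq (fun n => nsq setT (line f (xs n))).
  move=> n m nm; apply: (@hardy_on_mono R _ _ f _ (H2_hardy_on Hf (xs_gt0 m))).
  by rewrite /xs lef_pV2 ?posrE// ler_nat ltnS.
have ub : has_ubound (range (fun n => nsq setT (line f (xs n)))).
  exists (2 * pi * hsq f) => _ [n _ <-].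
  by have [] := H2_line Hf (xs_gt0 n).
have := nondecreasing_cvgn nd ub; set S := sup _ => hS.
suff -> : 2 * pi * hsq f = S by [].
have S0 : 0 <= S.
  apply: (le_trans (nsq_ge0 setT (line f (xs 0)))).
  by apply: sup_upper_bound; [split => //; exists (nsq setT (line f (xs 0))), 0%N|exists 0%N].
apply/eqP; rewrite eq_le; apply/andP; split; last first.
  apply: ge_sup; first by exists (nsq setT (line f (xs 0))), 0%N.
  by move=> _ [n _ <-]; have [] := H2_line Hf (xs_gt0 n).
have hx x : 0 < x -> sqint setT (line f x) /\ nsq setT (line f x) <= 2 * pi * (S / (2 * pi)).
  move=> x0; have [sf _] := H2_line Hf x0; split => //.
  rewrite mulrC divfK ?two_pi_neq0//.
  have [n nx] : exists n, xs n <= x.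
    have := @cvg_harmonic R => /cvgrPdist_lt/(_ _ x0)[n _ /(_ n (leqnn n))] /=.
    by rewrite sub0r normrN ger0_norm ?invr_ge0// => /ltW h; exists n.
  apply: (le_trans (hardy_on_mono (H2_hardy_on Hf (xs_gt0 n)) nx)).
  by apply: sup_upper_bound; [split => //; exists (nsq setT (line f (xs 0))), 0%N|exists n].
have [_] := @H2_intro f _ (divr_ge0 S0 (ltW two_pi_gt0)) (fun z => H2_analytic Hf) hx.
by rewrite ler_pdivlMr ?two_pi_gt0// mulrC.
Qed.

Lemma H2Z (a : R[i]) f : H2 f -> H2 (fun z => a * f z) /\ hsq (fun z => a * f z) = normc a ^+ 2 * hsq f.
Proof.
move=> Hf.
have [Haf _] : H2 (fun z => a * f z) /\ hsq (fun z => a * f z) <= normc a ^+ 2 * hsq f.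
  apply: H2_intro; first by rewrite mulr_ge0 ?sqr_ge0 ?hsq_ge0.
    by move=> z z0; apply: cdiffZ; exact: H2_analytic.
  move=> x x0; have [sf nf] := H2_line Hf x0; split; first exact: (sqintZ a measurableT sf).
  by rewrite nsqZ// mulrCA ler_wpM2l ?sqr_ge0.
split => //.
have h1 := hsq_cvg Haf.
have h2 : nsq setT (line (fun z => a * f z) (xs n)) @[n --> \oo] --> normc a ^+ 2 * (2 * pi * hsq f).
  rewrite (_ : (fun n => _) = (fun n => normc a ^+ 2 * nsq setT (line f (xs n)))).
    by apply: cvgMl_tmp; exact: hsq_cvg.
  apply/funext => n; have [sf _] := H2_line Hf (xs_gt0 n).
  exact: (nsqZ a measurableT sf).
by apply: (mulfI two_pi_neq0); rewrite (cvgR_unique h1 h2) mulrCA.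
Qed.

Lemma H2D f g : H2 f -> H2 g ->
  H2 (fun z => f z + g z) /\ hsq (fun z => f z + g z) <= 2 * hsq f + 2 * hsq g.
Proof.
move=> Hf Hg; apply: H2_intro.
- by rewrite addr_ge0// mulr_ge0// hsq_ge0.
- by move=> z z0; apply: cdiffD; exact: H2_analytic.
move=> x x0; have [sf nf] := H2_line Hf x0; have [sg ng] := H2_line Hg x0.
split; first exact: (sqintD measurableT sf sg).
apply: (le_trans (nsqD_le measurableT sf sg)).
by rewrite mulrDr lerD// mulrCA ler_pM2l.
Qed.

Lemma H2B f g : H2 f -> H2 g -> H2 (fun z => f z - g z).
Proof.
move=> Hf Hg; have [Hg' _] := H2Z (-1) Hg.
have [h _] := H2D Hf Hg'; rewrite (_ : (fun _ => _) = (fun z => f z + -1 * g z))//.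
by apply/funext => z; rewrite mulN1r.
Qed.

Lemma H2_0 : H2 (fun=> 0 : R[i]) /\ hsq (fun=> 0 : R[i]) = 0.
Proof.
have [h1 h2] : H2 (fun=> 0 : R[i]) /\ hsq (fun=> 0 : R[i]) <= 0.
  apply: H2_intro => //; first by move=> z _; exact: cdiff_cst.
  move=> x x0; split; first exact: sqint0.
  rewrite mulr0 /nsq (@eq_Rintegral _ _ _ _ _ (fun=> 0)) ?Rintegral_cst//= ?mul0r//.
  by move=> y _; rewrite !expr0n /= addr0 sqrtr0 expr0n.
by split => //; apply/eqP; rewrite eq_le h2 hsq_ge0.
Qed.

Lemma H2_sum n (F : 'I_n -> R[i] -> R[i]) : (forall i, H2 (F i)) ->
  H2 (fun z => \sum_(i < n) F i z).
Proof.
elim: n F => [|n IH] F HF.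
  by under eq_fun do rewrite big_ord0; exact: H2_0.1.
under eq_fun do rewrite big_ord_recr/=.
by apply: (H2D _ _).1 => //; apply: IH.
Qed.

Lemma eq_H2 f g : (forall z, 0 < Re z -> f z = g z) -> H2 f -> H2 g /\ hsq g = hsq f.
Proof.
move=> fg Hf.
have hn : hardy_norm g = hardy_norm f.
  rewrite /hardy_norm; congr ereal_sup; apply/seteqP.
  by split => _ [x /= x0 <-]; exists x => //; congr ((_ * _) `^ _)%E;
    apply: eq_integral => y _; rewrite fg.
split; last by rewrite /hsq hn.
split; last by rewrite hn; case: Hf.
move=> z z0; rewrite -cdiffE; apply: (@cdiff_local R f); last exact: H2_analytic.
exists (Re z) => // w wz; apply: fg.
have := le_lt_trans (Re_le_normc _) wz; rewrite cReB ltr_norml => /andP[? _]; lra.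
Qed.

Lemma hsq_parallelogram f g : H2 f -> H2 g ->
  hsq (fun z => f z + g z) + hsq (fun z => f z - g z) = 2 * hsq f + 2 * hsq g.
Proof.
move=> Hf Hg; have [Hp _] := H2D Hf Hg; have Hm := H2B Hf Hg.
have h1 : (nsq setT (line (fun z => f z + g z) (xs n)) + nsq setT (line (fun z => f z - g z) (xs n)))
    @[n --> \oo] --> 2 * pi * hsq (fun z => f z + g z) + 2 * pi * hsq (fun z => f z - g z).
  by apply: cvgD; exact: hsq_cvg.
have h2 : (nsq setT (line (fun z => f z + g z) (xs n)) + nsq setT (line (fun z => f z - g z) (xs n)))
    @[n --> \oo] --> 2 * (2 * pi * hsq f) + 2 * (2 * pi * hsq g).
  rewrite (_ : (fun n => _) = (fun n => 2 * nsq setT (line f (xs n)) + 2 * nsq setT (line g (xs n)))).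
    by apply: cvgD; apply: cvgMl_tmp; exact: hsq_cvg.
  apply/funext => n; have [sf _] := H2_line Hf (xs_gt0 n); have [sg _] := H2_line Hg (xs_gt0 n).
  by rewrite -nsq_parallelogram.
apply: (mulfI two_pi_neq0); rewrite mulrDr (cvgR_unique h1 h2); ring.
Qed.

Lemma polarization (z w : R[i]) :
  z * conjc w = 4^-1 * \sum_(k < 4) 'i ^+ k * ((normc (z + 'i ^+ k * w)) ^+ 2)%:C.
Proof.
rewrite !big_ord_recl big_ord0 /= !sqr_normcE.
case: z => a b; case: w => c d.
rewrite /bump/= !exprS expr0; simpc => /=.
by apply: complexP => /=; field.
Qed.

(** Polarization holds pointwise, hence for the integrals along each line;
    letting the line tend to the boundary identifies the polarized norm with a
    limit of integrals, from which it inherits sesquilinearity and the Cauchy-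
    Schwarz inequality. *)
Lemma hardy_inner_cvg f g : H2 f -> H2 g ->
  (cintegral setT (fun y => line f (xs n) y * conjc (line g (xs n) y)) : R[i]^o)
    @[n --> \oo] --> ((2 * pi)%:C * hardy_inner f g : R[i]^o).
Proof.
move=> Hf Hg.
pose h k z := f z + 'i ^+ k * g z.
have Hh k : H2 (h k) by have [+ _] := H2Z ('i ^+ k) Hg => Hk; have [] := H2D Hf Hk.
have E n : cintegral setT (fun y => line f (xs n) y * conjc (line g (xs n) y)) =
    4^-1 * \sum_(k < 4) 'i ^+ k * (nsq setT (line (h k) (xs n)))%:C.
  have I k : cintegrable setT (fun y => (normc (line (h k) (xs n) y) ^+ 2)%:C).
    have [[_ hi] _] := H2_line (Hh k) (xs_gt0 n).
    by split => //; exact: integrable0.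
  under eq_fun => y do rewrite polarization.
  rewrite cintegralZ//; last by apply: cintegrable_sum => // k; exact/cintegrableZ/I.
  rewrite cintegral_sum//; last by move=> k; exact/cintegrableZ/I.
  congr (_ * _); apply: eq_bigr => k _; rewrite cintegralZ//; last exact: I.
  congr (_ * _); apply: complexP; first by [].
  by rewrite /= Rintegral_cst//= mul0r.
under eq_fun do rewrite E.
have -> : (2 * pi)%:C * hardy_inner f g = 4^-1 * \sum_(k < 4) 'i ^+ k * (2 * pi * hsq (h k))%:C.
  rewrite /hardy_inner mulrCA; congr (_ * _); rewrite mulr_sumr; apply: eq_bigr => k _.
  by rewrite mulrCA -rmorphM.
apply: cvgC_Ml; apply: cvgC_sum => k; apply: cvgC_Ml.
by apply/cvg_complexP; split => /=; [exact: hsq_cvg|exact: cvg_cst].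
Qed.

(** Cauchy's formula on the line half way to the boundary, estimated by the
    Cauchy-Schwarz inequality. *)
Lemma H2_eval_le f w : H2 f -> 0 < Re w -> normc (f w) ^+ 2 * Re w <= hsq f.
Proof.
move=> Hf w0; pose x0 := Re w / 2.
have x00 : 0 < x0 by rewrite divr_gt0.
have xw : x0 < Re w by rewrite /x0; lra.
have wx : Re w != x0 by rewrite gt_eqF.
have [sf nf] := H2_line Hf x00; have [sk nk] := kernel_sqint wx.
have := cintegralM_CS measurableT sf sk.
rewrite (cauchy_halfplane (H2_hardy_on Hf x00) xw) normcM normc_real nk.
have -> : `|Re w - x0| = Re w / 2 by rewrite gtr0_norm ?subr_gt0// /x0; field.
rewrite gtr0_norm ?two_pi_gt0// => h.
have {}h : (2 * pi * normc (f w)) ^+ 2 <= (2 * pi * hsq f) * (pi / (Re w / 2)).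
  apply: (le_trans h); rewrite ler_wpM2r// divr_ge0 ?pi_ge0// divr_ge0// ltW//.
move: h; have -> : (2 * pi * hsq f) * (pi / (Re w / 2)) = (2 * pi) ^+ 2 * hsq f / Re w.
  by field; rewrite gt_eqF.
rewrite ler_pdivlMr// exprMn -mulrA ler_pM2l// exprn_gt0// two_pi_gt0//.
Qed.

(** The reproducing kernel of the point [w]. *)
Definition rkernel w : R[i] -> R[i] := fun z => (z + conjc w)^-1.

Lemma rkernelE w z : rkernel w z = - ((- conjc w) - z)^-1.
Proof. by rewrite /rkernel -invrN; congr (_^-1); ring. Qed.

Lemma H2_rkernel w : 0 < Re w -> H2 (rkernel w).
Proof.
move=> w0; have [] // := @H2_intro (rkernel w) (2^-1 / Re w) _ _ _.
- by rewrite divr_ge0// ltW.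
- move=> z z0; apply: cdiffV; last by apply: cdiffD; [exact: cdiff_id|exact: cdiff_cst].
  rewrite -normc_gt0 (lt_le_trans _ (Re_le_normc _))// normr_gt0 cReD cReJ gt_eqF// addr_gt0//.
move=> x x0; have wx : Re (- conjc w) != x by rewrite cReN cReJ lt_eqF//; lra.
have [sk nk] := kernel_sqint wx.
have e : line (rkernel w) x = fun y => -1 * ((- conjc w) - (x +i* y))^-1.
  by apply/funext => y; rewrite /line rkernelE mulN1r.
rewrite e; split; first exact: sqintZ.
rewrite nsqZ// nk normcN ComplexField.Normc.normc1 expr1n mul1r cReN cReJ.
have -> : `|- Re w - x| = Re w + x by rewrite ltr0_norm; lra.
rewrite mulrA [2 * pi * _]mulrC mulrA mulVf// mul1r ler_pM2l ?pi_gt0// lef_pV2 ?posrE ?addr_gt0//.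
by rewrite lerDl ltW.
Qed.

Lemma cts_xs f w : 0 < Re w -> cts_at f w ->
  (f (w + (2 * xs n)%:C) : R[i]^o) @[n --> \oo] --> (f w : R[i]^o).
Proof.
move=> w0 /cts_atP cf; apply/cvg_normcP => e /cf[d d0 hd].
have d20 : 0 < d / 2 by rewrite divr_gt0.
near=> n; apply: hd; rewrite addrAC subrr add0r normc_real ger0_norm; last first.
  by rewrite mulr_ge0// ltW// xs_gt0.
rewrite mulrC -ltr_pdivlMr//; near: n.
exact: near_infty_natSinv_lt (PosNum d20).
Unshelve. all: by end_near. Qed.

(** The reproducing property: on each line it is Cauchy's formula. *)
Lemma hardy_inner_rkernel f w : H2 f -> 0 < Re w -> hardy_inner f (rkernel w) = f w.
Proof.
move=> Hf w0; have Hk := H2_rkernel w0.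
have h1 := hardy_inner_cvg Hf Hk.
have E n : cintegral setT (fun y => line f (xs n) y * conjc (line (rkernel w) (xs n) y)) =
    (2 * pi)%:C * f (w + (2 * xs n)%:C).
  rewrite -(cauchy_halfplane (H2_hardy_on Hf (xs_gt0 n))); last first.
    by rewrite cReD/=; have := xs_gt0 n; lra.
  apply: eq_cintegral => y _; rewrite /line /rkernel conjc_inv; congr (_ * _^-1).
  by apply: complexP; rewrite ?cReJ ?cImJ ?cReB ?cImB ?cReD ?cImD ?cReJ ?cImJ/=; ring.
move: h1; under eq_fun do rewrite E.
have h2 : ((2 * pi)%:C * f (w + (2 * xs n)%:C) : R[i]^o) @[n --> \oo] --> ((2 * pi)%:C * f w : R[i]^o).
  apply: cvgC_Ml; by apply: cts_xs => //; apply: cdiff_cts; exact: H2_analytic.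
by move=> h1; apply: (mulfI two_piC_neq0); exact: cvgC_unique h1 h2.
Qed.

Lemma hardy_inner_conj f g : H2 f -> H2 g -> hardy_inner g f = conjc (hardy_inner f g).
Proof.
move=> Hf Hg; have h1 := hardy_inner_cvg Hg Hf; have h2 := hardy_inner_cvg Hf Hg.
have h3 : (cintegral setT (fun y => line g (xs n) y * conjc (line f (xs n) y)) : R[i]^o)
    @[n --> \oo] --> (conjc ((2 * pi)%:C * hardy_inner f g) : R[i]^o).
  have E n : cintegral setT (fun y => line g (xs n) y * conjc (line f (xs n) y)) =
      conjc (cintegral setT (fun y => line f (xs n) y * conjc (line g (xs n) y))).
    have [sf _] := H2_line Hf (xs_gt0 n); have [sg _] := H2_line Hg (xs_gt0 n).
    rewrite -cintegralJ//; last by apply: sqint_mul => //; exact: sqintJ.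
    by apply: eq_cintegral => y _; rewrite rmorphM/= conjcK mulrC.
  under eq_fun do rewrite E.
  move/cvg_complexP : h2 => [hR hI]; apply/cvg_complexP; split.
    by rewrite cReJ; under eq_fun do rewrite cReJ.
  by rewrite cImJ; under eq_fun do rewrite cImJ; exact: cvgN.
apply: (mulfI two_piC_neq0); rewrite (cvgC_unique h1 h3).
by case: (hardy_inner f g) => a b; apply: complexP => /=; ring.
Qed.

Lemma hsqD f g : H2 f -> H2 g ->
  hsq (fun z => f z + g z) = hsq f + hsq g + 2 * Re (hardy_inner f g).
Proof.
move=> Hf Hg; have [Hp _] := H2D Hf Hg.
have h1 := hsq_cvg Hp.
have /cvg_complexP[hR _] := hardy_inner_cvg Hf Hg.
have h2 : nsq setT (line (fun z => f z + g z) (xs n)) @[n --> \oo] -->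
    2 * pi * hsq f + 2 * pi * hsq g + 2 * Re ((2 * pi)%:C * hardy_inner f g).
  rewrite (_ : (fun n => _) = (fun n => nsq setT (line f (xs n)) + nsq setT (line g (xs n)) +
    2 * Re (cintegral setT (fun y => line f (xs n) y * conjc (line g (xs n) y))))).
    apply: cvgD; first by apply: cvgD; exact: hsq_cvg.
    by apply: cvgMl_tmp; exact: hR.
  apply/funext => n; rewrite -nsqD//.
    by have [] := H2_line Hf (xs_gt0 n).
  by have [] := H2_line Hg (xs_gt0 n).
apply: (mulfI two_pi_neq0); rewrite (cvgR_unique h1 h2) cReM/= mul0r subr0; ring.
Qed.

Lemma hardy_innerDl f1 f2 g : H2 f1 -> H2 f2 -> H2 g ->
  hardy_inner (fun z => f1 z + f2 z) g = hardy_inner f1 g + hardy_inner f2 g.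
Proof.
move=> H1 H2' Hg; have [Hp _] := H2D H1 H2'.
have h1 := hardy_inner_cvg Hp Hg.
have h2 := cvgC_D (hardy_inner_cvg H1 Hg) (hardy_inner_cvg H2' Hg).
have h3 : (cintegral setT (fun y => line (fun z => f1 z + f2 z) (xs n) y * conjc (line g (xs n) y)) : R[i]^o)
    @[n --> \oo] --> ((2 * pi)%:C * hardy_inner f1 g + (2 * pi)%:C * hardy_inner f2 g : R[i]^o).
  rewrite (_ : (fun n => _) = (fun n => cintegral setT (fun y => line f1 (xs n) y * conjc (line g (xs n) y)) +
     cintegral setT (fun y => line f2 (xs n) y * conjc (line g (xs n) y)))); first exact: h2.
  apply/funext => n; rewrite -cintegralD//.
  - by apply: eq_cintegral => y _; rewrite mulrDl.
  - have [s1 _] := H2_line H1 (xs_gt0 n); have [sg _] := H2_line Hg (xs_gt0 n).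
    by apply: sqint_mul => //; exact: sqintJ.
  - have [s1 _] := H2_line H2' (xs_gt0 n); have [sg _] := H2_line Hg (xs_gt0 n).
    by apply: sqint_mul => //; exact: sqintJ.
by apply: (mulfI two_piC_neq0); rewrite [RHS]mulrDr; exact: cvgC_unique h1 h3.
Qed.

Lemma hardy_innerZl (a : R[i]) f g : H2 f -> H2 g ->
  hardy_inner (fun z => a * f z) g = a * hardy_inner f g.
Proof.
move=> Hf Hg; have [Hp _] := H2Z a Hf.
have h1 := hardy_inner_cvg Hp Hg.
have h3 : (cintegral setT (fun y => line (fun z => a * f z) (xs n) y * conjc (line g (xs n) y)) : R[i]^o)
    @[n --> \oo] --> (a * ((2 * pi)%:C * hardy_inner f g) : R[i]^o).
  rewrite (_ : (fun n => _) = (fun n => a * cintegral setT (fun y => line f (xs n) y * conjc (line g (xs n) y)))).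
    by apply: cvgC_Ml; exact: hardy_inner_cvg.
  apply/funext => n; rewrite -cintegralZ//.
    by apply: eq_cintegral => y _; rewrite mulrA.
  have [s1 _] := H2_line Hf (xs_gt0 n); have [sg _] := H2_line Hg (xs_gt0 n).
  by apply: sqint_mul => //; exact: sqintJ.
by apply: (mulfI two_piC_neq0); rewrite (cvgC_unique h1 h3) mulrCA.
Qed.

Lemma hardy_inner_CS f g : H2 f -> H2 g ->
  normc (hardy_inner f g) ^+ 2 <= hsq f * hsq g.
Proof.
move=> Hf Hg.
have h1 : (fun n => normc (cintegral setT (fun y => line f (xs n) y * conjc (line g (xs n) y))) ^+ 2) @ \oo -->
    normc ((2 * pi)%:C * hardy_inner f g) ^+ 2.
  by apply: cvg_normc_sqr; exact: hardy_inner_cvg.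
have h2 : (fun n => nsq setT (line f (xs n)) * nsq setT (line g (xs n))) @ \oo -->
    (2 * pi * hsq f) * (2 * pi * hsq g).
  by apply: cvgM; exact: hsq_cvg.
have : normc ((2 * pi)%:C * hardy_inner f g) ^+ 2 <= (2 * pi * hsq f) * (2 * pi * hsq g).
  apply: (ler_cvg_to h1 h2); apply: nearW => n.
  have [sf _] := H2_line Hf (xs_gt0 n); have [sg _] := H2_line Hg (xs_gt0 n).
  have := cintegralM_CS measurableT sf (sqintJ measurableT sg).
  by rewrite (@eq_nsq _ _ (fun t => conjc (line g (xs n) t)) (line g (xs n)))// => t _; rewrite normc_conj.
rewrite normcM normc_real exprMn real_normK ?num_real//.
have -> : 2 * pi * hsq f * (2 * pi * hsq g) = (2 * pi) ^+ 2 * (hsq f * hsq g) by ring.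
by rewrite ler_pM2l// exprn_gt0// two_pi_gt0.
Qed.

Lemma hardy_inner_self f : H2 f -> hardy_inner f f = (hsq f)%:C.
Proof.
move=> Hf; have h1 := hardy_inner_cvg Hf Hf.
have h2 : (cintegral setT (fun y => line f (xs n) y * conjc (line f (xs n) y)) : R[i]^o)
    @[n --> \oo] --> ((2 * pi * hsq f)%:C : R[i]^o).
  under eq_fun do rewrite cintegral_mul_conj.
  by apply/cvg_complexP; split => /=; [exact: hsq_cvg|exact: cvg_cst].
by apply: (mulfI two_piC_neq0); rewrite (cvgC_unique h1 h2) -rmorphM.
Qed.

End HardyNorm.

(** * Bounded limits in the Hardy space, and division by a Blaschke factor *)

Section HardyClosure.
Context {R : realType}.
Local Notation mu := (@lebesgue_measure R).
Implicit Types (f g : R[i] -> R[i]) (w z : R[i]) (x y : R).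

Lemma cintegrable_bddM (f m : R -> R[i]) (C : R) : cintegrable setT f ->
  cmeasurable setT m -> (forall y, normc (m y) <= C) ->
  cintegrable setT (fun y => f y * m y).
Proof.
move=> fi mm mC; apply: (@le_cintegrable _ _ _ (fun y => C * normc (f y))) => //.
- by apply: cmeasurableM => //; exact: cintegrable_cmeasurable.
- by apply: rintegrableZ => //; exact: integrable_normc.
- by move=> y _; rewrite normcM mulrC ler_wpM2r ?normc_ge0.
Qed.

Lemma kernel_le w x y : x < Re w -> normc ((w - (x +i* y))^-1) <= (Re w - x)^-1.
Proof.
move=> xw; rewrite ComplexField.Normc.normcV lef_pV2 ?posrE ?subr_gt0//.
  by rewrite (le_trans _ (Re_le_normc _))// cReB/= ler_norm.
by rewrite normc_gt0 line_neq0// gt_eqF.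
Qed.

(** By the resolvent identity for Cauchy kernels, the error of the difference
    quotient is [z - w] times an absolutely convergent integral, bounded near
    [w]. *)
Lemma cauchy_integral_cdiff (v : R -> R[i]) x0 w : sqint setT v -> x0 < Re w ->
  cdiff (fun z => cintegral setT (fun y => v y * (z - (x0 +i* y))^-1)) w.
Proof.
move=> sv xw; pose xi := Re w - x0; have xi0 : 0 < xi by rewrite subr_gt0.
pose k z y := (z - (x0 +i* y))^-1.
have kn z : x0 < Re z -> Re z != x0 by move=> ?; rewrite gt_eqF.
have sk z : x0 < Re z -> sqint setT (k z) by move=> /kn/kernel_sqint[].
have ck z : x0 < Re z -> cmeasurable setT (k z) by move=> /sk[].
have vk z : x0 < Re z -> cintegrable setT (fun y => v y * k z y).
  by move=> xz; apply: sqint_mul => //; exact: sk.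
have vkk z : x0 < Re z -> cintegrable setT (fun y => v y * k w y * k z y).
  move=> xz; apply: (@cintegrable_bddM _ _ (Re z - x0)^-1); [exact: vk|exact: ck|].
  by move=> y; exact: kernel_le.
have vkkk z : x0 < Re z -> cintegrable setT (fun y => v y * k w y * k w y * k z y).
  move=> xz; apply: (@cintegrable_bddM _ _ (Re z - x0)^-1); [exact: vkk|exact: ck|].
  by move=> y; exact: kernel_le.
pose C := \int[mu]_y normc (v y * k w y).
have C0 : 0 <= C by apply: Rintegral_ge0 => y _; exact: normc_ge0.
apply/cdiffP; exists (- cintegral setT (fun y => v y * k w y * k w y)) => e e0.
pose D := C * xi^-1 * (2 / xi).
have D0 : 0 <= D by rewrite !mulr_ge0 ?invr_ge0 ?(ltW xi0)// divr_ge0// ltW.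
exists (Num.min (xi / 2) (e / (D + 1))).
  by rewrite lt_min !divr_gt0// ltr_wpDl.
move=> z zw; rewrite lt_min => /andP[z1 z2].
have zx : x0 + xi / 2 <= Re z.
  have := le_lt_trans (Re_le_normc _) z1; rewrite cReB ltr_norml /xi => /andP[? _]; lra.
have xz : x0 < Re z by lra.
have zwn : z - w != 0 by rewrite -normc_gt0.
have E : (cintegral setT (fun y => v y * k z y) - cintegral setT (fun y => v y * k w y)) / (z - w)
    - - cintegral setT (fun y => v y * k w y * k w y) =
    (z - w) * cintegral setT (fun y => v y * k w y * k w y * k z y).
  rewrite -cintegralB//; [|exact: vk|exact: vk].
  rewrite opprK -cintegralZ//; last exact: vkkk.
  rewrite mulrC -cintegralZ//; last by apply: cintegrableB => //; exact: vk.
  rewrite -cintegralD//; [|by apply: cintegrableZ => //; apply: cintegrableB => //; exact: vk|exact: vkk].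
  apply: eq_cintegral => y _; rewrite /k.
  have h1 : z - (x0 +i* y) != 0 by rewrite line_neq0// gt_eqF.
  have h2 : w - (x0 +i* y) != 0 by rewrite line_neq0// gt_eqF.
  by move: (x0 +i* y) h1 h2 => s h1 h2; field; rewrite h1 h2 zwn.
rewrite E normcM (@le_lt_trans _ _ (normc (z - w) * D))//.
  rewrite ler_wpM2l ?normc_ge0// (le_trans (normc_cintegral_le _ (vkkk _ xz)))//.
  rewrite /D -mulrA mulrC -RintegralZl//; last exact/integrable_normc/vk.
  apply: le_Rintegral => //.
  - by apply: integrable_normc => //; exact: vkkk.
  - by apply: rintegrableZ => //; apply: integrable_normc => //; exact: vk.
  move=> y _; rewrite 2!(normcM (_ * _)) mulrC -mulrA mulrC -mulrA.
  rewrite [leRHS](_ : _ = normc (v y * k w y) * (xi^-1 * (2 / xi))); last by ring.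
  rewrite ler_wpM2l ?normc_ge0// ler_pM ?normc_ge0//; first exact: kernel_le.
  rewrite (le_trans (kernel_le _ xz))// -[leRHS]invf_div lef_pV2 ?posrE ?divr_gt0 ?subr_gt0//.
  lra.
rewrite (@le_lt_trans _ _ (e / (D + 1) * D))//.
  by rewrite ler_wpM2r// ltW.
rewrite mulrAC ltr_pdivrMr ?ltr_wpDl// ltr_pM2l//; lra.
Qed.

(** Multiplication by a holomorphic function bounded by [1] shrinks the square
    mean on every line. *)
Lemma H2_bddM g m : H2 g -> (forall z, 0 < Re z -> cdiff m z) ->
  (forall z, 0 < Re z -> normc (m z) <= 1) ->
  H2 (fun z => m z * g z) /\ hsq (fun z => m z * g z) <= hsq g.
Proof.
move=> Hg dm m1; apply: H2_intro; first exact: hsq_ge0.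
  by move=> z z0; apply: cdiffM; [exact: dm|exact: H2_analytic].
move=> x x0; have [_ /(_ x (lexx _))] := @hardy_onM R x _ 1 g m (H2_hardy_on Hg x0) ler01
  (fun z xz => dm z (lt_le_trans x0 xz)) (fun z xz => m1 z (lt_le_trans x0 xz)).
rewrite expr1n mul1r => -[s n].
have e : line (fun z => m z * g z) x = (fun y => g (x +i* y) * m (x +i* y)).
  by apply/funext => y; rewrite /line mulrC.
by rewrite e.
Qed.

(** On lines, the norm bound is Fatou's lemma.  For holomorphy, Cauchy's
    formula passes to the limit under the integral sign once an extra factor
    [1 / (z + 1)] makes the integrands dominated, and a Cauchy integral is
    holomorphic. *)
Lemma H2_closure (f_ : nat -> R[i] -> R[i]) f (C : R) :
  (forall k, H2 (f_ k)) -> (forall k, hsq (f_ k) <= C) ->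
  (forall z, 0 < Re z -> (f_ k z : R[i]^o) @[k --> \oo] --> (f z : R[i]^o)) ->
  H2 f /\ hsq f <= C.
Proof.
move=> Hf fC cf; have C0 : 0 <= C by apply: le_trans (fC 0%N); exact: hsq_ge0.
have lf x : 0 < x -> sqint setT (line f x) /\ nsq setT (line f x) <= 2 * pi * C.
  move=> x0; apply: (@sqint_fatou R setT (fun k => line (f_ k) x)) => //.
  - by move=> k; have [] := H2_line (Hf k) x0.
  - by move=> y _; apply: cf.
  - apply: nearW => k; have [_ h] := H2_line (Hf k) x0.
    by rewrite (le_trans h)// ler_pM2l// two_pi_gt0.
apply: (H2_intro C0 _ lf) => w w0.
pose x0 := Re w / 2; have x00 : 0 < x0 by rewrite divr_gt0.
have xw : x0 < Re w by rewrite /x0; lra.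
pose r z : R[i] := (z + 1)^-1.
have r1 z : x0 <= Re z -> 1 <= normc (z + 1).
  by move=> xz; rewrite (le_trans _ (Re_le_normc _))// (le_trans _ (ler_norm _))// cReD/=; lra.
have rn z : x0 <= Re z -> z + 1 != 0.
  by move=> /r1 h; rewrite -normc_gt0 (lt_le_trans _ h).
have dr z : x0 <= Re z -> cdiff r z.
  move=> xz; apply: cdiffV; first exact: rn.
  by apply: cdiffD; [exact: cdiff_id|exact: cdiff_cst].
have rle z : x0 <= Re z -> normc (r z) <= 1.
  by move=> xz; rewrite /r ComplexField.Normc.normcV invf_le1 ?r1// (lt_le_trans _ (r1 _ xz)).
pose v y := f (x0 +i* y) * r (x0 +i* y).
pose rl y := (- 1 - (x0 +i* y))^-1.
have rlE y : r (x0 +i* y) = - rl y.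
  by rewrite /r /rl -invrN; congr (_^-1); ring.
have wx1 : Re (- 1 : R[i]) != x0 by rewrite /= lt_eqF//; lra.
have [srl _] := kernel_sqint wx1.
have mr : cmeasurable setT (fun y => r (x0 +i* y)).
  by apply: line_cmeasurable => y; apply: cdiff_cts; exact: dr.
have sv : sqint setT v.
  have [[mf fi] _] := lf x0 x00.
  apply: (le_sqint _ _ fi) => //; first exact: cmeasurableM.
  move=> y _; rewrite normcM exprMn ler_piMr ?sqr_ge0// -[leRHS](expr1n _ 2).
  by rewrite lerXn2r ?nnegrE ?normc_ge0// rle.
pose F z := cintegral setT (fun y => v y * (z - (x0 +i* y))^-1).
have key z : x0 < Re z -> (2 * pi)%:C * (f z * r z) = F z.
  move=> xz.
  have z0 : 0 < Re z by lra.
  have hk k : cintegral setT (fun y => (f_ k (x0 +i* y) * r (x0 +i* y)) * (z - (x0 +i* y))^-1)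
     = (2 * pi)%:C * (f_ k z * r z).
    exact: (cauchy_halfplane (hardy_onM (H2_hardy_on (Hf k) x00) ler01 dr rle) xz).
  have zx : Re z != x0 by rewrite gt_eqF.
  have [sk _] := kernel_sqint zx.
  have A0 : 0 <= C / x0 by rewrite divr_ge0// ltW.
  have fb k y : normc (f_ k (x0 +i* y)) <= Num.sqrt (C / x0).
    have := @H2_eval_le R (f_ k) (x0 +i* y) (Hf k) x00.
    move=> /le_trans/(_ (fC k)); rewrite -ler_pdivlMr//= => h.
    by have := ler_wsqrtr h; rewrite sqrtr_sqr ger0_norm// normc_ge0.
  have [||||_ lim] := @cintegral_cvg R setT
    (fun k y => (f_ k (x0 +i* y) * r (x0 +i* y)) * (z - (x0 +i* y))^-1)
    (fun y => v y * (z - (x0 +i* y))^-1)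
    (fun y => Num.sqrt (C / x0) * normc (rl y * (z - (x0 +i* y))^-1)) measurableT.
  - move=> k; apply: cmeasurableM; last by case: sk.
    by apply: cmeasurableM => //; have [[]] := H2_line (Hf k) x00.
  - move=> y _; under eq_fun do rewrite mulrC mulrCA mulrC.
    rewrite /v; have -> : f (x0 +i* y) * r (x0 +i* y) / (z - x0 +i* y) =
      r (x0 +i* y) / (z - x0 +i* y) * f (x0 +i* y) by ring.
    rewrite (_ : (fun k => _) = (fun k => r (x0 +i* y) / (z - x0 +i* y) * f_ k (x0 +i* y))); last first.
      by apply/funext => k; ring.
    by apply: cvgC_Ml; apply: cf.
  - by apply: rintegrableZ => //; apply: integrable_normc => //; exact: sqint_mul.
  - move=> k y _; rewrite -mulrA normcM ler_pM ?normc_ge0//.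
    by rewrite !normcM rlE normcN.
  have lim2 : ((2 * pi)%:C * (f_ k z * r z) : R[i]^o) @[k --> \oo] --> ((2 * pi)%:C * (f z * r z) : R[i]^o).
    apply: cvgC_Ml; rewrite mulrC.
    by under eq_fun do rewrite mulrC; apply: cvgC_Ml; exact: cf.
  by apply: cvgC_unique lim2 _; under eq_fun do rewrite -hk.
apply: (@cdiff_local R (fun z => ((2 * pi)%:C^-1 * (z + 1)) * F z)).
  exists (Re w - x0) => [|z zw]; first by rewrite subr_gt0.
  have xz : x0 < Re z.
    have := le_lt_trans (Re_le_normc _) zw; rewrite cReB ltr_norml => /andP[? _]; lra.
  rewrite -key//; have := rn z (ltW xz); have := @two_piC_neq0 R.
  move: (2 * pi)%:C => p p0 z1; rewrite /r; field; by rewrite z1.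
apply: cdiffM; last exact: cauchy_integral_cdiff.
by apply: cdiffZ; apply: cdiffD; [exact: cdiff_id|exact: cdiff_cst].
Qed.

Definition bfactor (nu z : R[i]) : R[i] := (z - nu) / (z + conjc nu).

Lemma bfactor_denom nu z : 0 < Re nu -> 0 < Re z -> Re z + Re nu <= normc (z + conjc nu).
Proof.
by move=> nu0 z0; rewrite (le_trans _ (Re_le_normc _))// cReD cReJ ler_norm.
Qed.

Lemma bfactor_denom_neq0 nu z : 0 < Re nu -> 0 < Re z -> z + conjc nu != 0.
Proof.
move=> nu0 z0; rewrite -normc_gt0 (lt_le_trans _ (bfactor_denom nu0 z0))//.
by rewrite addr_gt0.
Qed.

(** Since [|z + conj nu|^2 - |z - nu|^2 = 4 Re z Re nu]. *)
Lemma bfactor_sqr nu z : 0 < Re nu -> 0 < Re z ->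
  normc (bfactor nu z) ^+ 2 = 1 - 4 * Re z * Re nu / normc (z + conjc nu) ^+ 2.
Proof.
move=> nu0 z0; have d0 := bfactor_denom_neq0 nu0 z0.
have d1 : 0 < normc (z + conjc nu) by rewrite normc_gt0.
rewrite normcM ComplexField.Normc.normcV exprMn exprVn.
have -> : normc (z - nu) ^+ 2 = normc (z + conjc nu) ^+ 2 - 4 * Re z * Re nu.
  by rewrite !sqr_normcE !cReD !cImD cReN cImN cReJ cImJ; ring.
by field; rewrite gt_eqF.
Qed.

Lemma bfactor_le1 nu z : 0 < Re nu -> 0 < Re z -> normc (bfactor nu z) <= 1.
Proof.
move=> nu0 z0; rewrite -(ler_pXn2r (n := 2)) ?nnegrE ?normc_ge0// expr1n bfactor_sqr//.
rewrite lerBlDr lerDl divr_ge0 ?sqr_ge0//; by rewrite mulr_ge0 ?(ltW nu0)// mulr_ge0// ltW.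
Qed.

Lemma bfactor_cdiff nu z : 0 < Re nu -> 0 < Re z -> cdiff (bfactor nu) z.
Proof.
move=> nu0 z0; apply: cdiffM.
  by apply: cdiffB; [exact: cdiff_id|exact: cdiff_cst].
apply: cdiffV; first exact: bfactor_denom_neq0.
by apply: cdiffD; [exact: cdiff_id|exact: cdiff_cst].
Qed.

(** The quotient [h z / (z - nu)] is the Cauchy integral of [- h(s) / (nu -
    s)], hence holomorphic at [nu] too; and the norm does not increase because
    [|bfactor nu|] tends to [1] at the boundary, where the norm is computed. *)
Lemma H2_divide h nu : H2 h -> 0 < Re nu -> h nu = 0 ->
  exists h1, [/\ H2 h1, hsq h1 <= hsq h &
    forall z, 0 < Re z -> h z = bfactor nu z * h1 z].
Proof.
move=> Hh nu0 hnu; pose x0 := Re nu / 2.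
have x00 : 0 < x0 by rewrite divr_gt0.
have xnu : x0 < Re nu by rewrite /x0; lra.
have nx : Re nu != x0 by rewrite gt_eqF.
have [su _] := H2_line Hh x00; have [sk _] := kernel_sqint nx.
pose u y := h (x0 +i* y) * (nu - (x0 +i* y))^-1.
have ssu : sqint setT u.
  apply: (@le_sqint R _ _ (fun y => (Re nu - x0)^-1 ^+ 2 * normc (h (x0 +i* y)) ^+ 2)) => //.
  - by apply: cmeasurableM; [case: su|case: sk].
  - by apply: rintegrableZ => //; case: su.
  move=> y _; rewrite normcM exprMn mulrC ler_wpM2r ?sqr_ge0// lerXn2r ?nnegrE ?normc_ge0//.
    by rewrite invr_ge0 subr_ge0 ltW.
  exact: kernel_le.
pose G z := - (2 * pi)%:C^-1 * cintegral setT (fun y => u y * (z - (x0 +i* y))^-1).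
have GE z : x0 < Re z -> h z = (z - nu) * G z.
  move=> xz; have zx : Re z != x0 by rewrite gt_eqF.
  have [skz _] := kernel_sqint zx.
  have iz := sqint_mul measurableT su skz; have inu := sqint_mul measurableT su sk.
  have hz := cauchy_halfplane (H2_hardy_on Hh x00) xz.
  have hn := cauchy_halfplane (H2_hardy_on Hh x00) xnu.
  apply: (mulfI (@two_piC_neq0 R)); rewrite -hz /G.
  have -> : (2 * pi)%:C * ((z - nu) * (- (2 * pi)%:C^-1 * cintegral setT (fun y => u y * (z - (x0 +i* y))^-1)))
     = (nu - z) * cintegral setT (fun y => u y * (z - (x0 +i* y))^-1).
    by have := @two_piC_neq0 R; move: (2 * pi)%:C => p p0; field.
  rewrite -[LHS]subr0 -[X in _ - X](_ : (2 * pi)%:C * h nu = _); last by rewrite hnu mulr0.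
  rewrite -hn -cintegralB// -cintegralZ//; last exact: sqint_mul.
  apply: eq_cintegral => y _; rewrite /u.
  have h1 : z - (x0 +i* y) != 0 by rewrite line_neq0.
  have h2 : nu - (x0 +i* y) != 0 by rewrite line_neq0.
  by move: (h (x0 +i* y)) (x0 +i* y) h1 h2 => t s h1 h2; field; rewrite h1 h2.
have dG z : x0 < Re z -> cdiff G z by move=> xz; apply: cdiffZ; exact: cauchy_integral_cdiff.
pose q z := if z == nu then G nu else h z / (z - nu).
have hq z : h z = (z - nu) * q z.
  rewrite /q; case: eqP => [->|/eqP zn]; first by rewrite subrr mul0r.
  by rewrite mulrCA divff ?mulr1// subr_eq0.
have dq z : 0 < Re z -> cdiff q z.
  move=> z0; have [->|zn] := eqVneq z nu.
    apply: (@cdiff_local R G); last exact: dG.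
    exists (Re nu - x0) => [|v vn]; first by rewrite subr_gt0.
    have xv : x0 < Re v.
      have := le_lt_trans (Re_le_normc _) vn; rewrite cReB ltr_norml => /andP[? _]; lra.
    rewrite /q; case: eqP => [->//|/eqP vnu].
    by rewrite GE// mulrAC divff ?mul1r// subr_eq0.
  apply: (@cdiff_local R (fun z => h z / (z - nu))).
    exists (normc (nu - z)) => [|v vz]; first by rewrite normc_gt0 subr_eq0 eq_sym.
    rewrite /q; case: eqP => // vn; move: vz; rewrite vn ltxx//.
  apply: cdiffM; first exact: H2_analytic.
  apply: cdiffV; first by rewrite subr_eq0.
  by apply: cdiffB; [exact: cdiff_id|exact: cdiff_cst].
pose h1 z := (z + conjc nu) * q z.
have dh1 z : 0 < Re z -> cdiff h1 z.
  move=> z0; apply: cdiffM; last exact: dq.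
  by apply: cdiffD; [exact: cdiff_id|exact: cdiff_cst].
have bh1 z : 0 < Re z -> h z = bfactor nu z * h1 z.
  move=> z0; rewrite hq /bfactor /h1.
  by have := bfactor_denom_neq0 nu0 z0; move: (z + conjc nu) => d d0; field.
(* a crude bound first: [h1] is bounded near [nu], and [|bfactor nu|] is
   bounded below away from it *)
have [r r0 hr] : exists2 r : R, 0 < r & forall z, normc (z - nu) < r -> normc (h1 z) <= normc (h1 nu) + 1.
  have /cdiff_cts/cts_atP/(_ 1 ltr01)[r r0 hr] := dh1 nu nu0.
  exists r => // z /hr h2; have := le_normcD (h1 z - h1 nu) (h1 nu); rewrite subrK; lra.
set K := normc (h1 nu) + 1 in hr.
have K0 : 0 < K by rewrite ltr_wpDl ?normc_ge0.
pose c := (r + 2 * Re nu) / r.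
have c0 : 0 < c by rewrite divr_gt0// addr_gt0// mulr_gt0.
have far z : 0 < Re z -> r <= normc (z - nu) -> normc (h1 z) <= c * normc (h z).
  move=> z0 zr; rewrite bh1// normcM mulrA ler_peMl ?normc_ge0//.
  rewrite /bfactor normcM ComplexField.Normc.normcV.
  have d0 : 0 < normc (z + conjc nu) by rewrite normc_gt0 bfactor_denom_neq0.
  have d1 : normc (z + conjc nu) <= normc (z - nu) + 2 * Re nu.
    have -> : z + conjc nu = (z - nu) + (2 * Re nu)%:C.
      by apply: complexP; rewrite ?cReD ?cImD ?cReJ ?cImJ ?cReN ?cImN/=; ring.
    by rewrite (le_trans (le_normcD _ _))// normc_real ger0_norm// mulr_ge0// ltW.
  rewrite mulrA ler_pdivlMr// mul1r (le_trans d1)// /c mulrAC ler_pdivlMr//.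
  have := mulr_ge0 (ltW nu0) (_ : 0 <= normc (z - nu) - r); rewrite subr_ge0 => /(_ zr).
  move: (normc (z - nu)) (Re nu) => a b; lra.
have rw : Re (r +i* Im nu) != 0 by rewrite /= gt_eqF.
have [[mk ik] nk] := kernel_sqint rw.
have bound x y : 0 < x -> normc (h1 (x +i* y)) ^+ 2 <=
    c ^+ 2 * normc (h (x +i* y)) ^+ 2 + (2 * r ^+ 2 * K ^+ 2) * normc (((r +i* Im nu) - (0 +i* y))^-1) ^+ 2.
  move=> x0'; have [far1|near1] := leP r (normc ((x +i* y) - nu)).
    apply: (@le_trans _ _ ((c * normc (h (x +i* y))) ^+ 2)).
      have p0 : 0 <= c * normc (h (x +i* y)) by rewrite mulr_ge0 ?normc_ge0 ?(ltW c0).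
      by rewrite lerXn2r ?nnegrE ?normc_ge0//; exact: far.
    by rewrite exprMn lerDl mulr_ge0 ?sqr_ge0// mulr_ge0 ?sqr_ge0// mulr_ge0 ?sqr_ge0.
  apply: (@le_trans _ _ (K ^+ 2)).
    by rewrite lerXn2r ?nnegrE ?normc_ge0 ?(ltW K0)//; exact: hr.
  apply: ler_wpDl; first by rewrite mulr_ge0 ?sqr_ge0.
  rewrite ComplexField.Normc.normcV exprVn sqr_normc_line/= subr0 (gtr0_norm r0).
  have t0 : 0 < r ^+ 2 + (y - Im nu) ^+ 2 by rewrite ltr_wpDr ?sqr_ge0// exprn_gt0.
  rewrite ler_pdivlMr//.
  have : (y - Im nu) ^+ 2 <= r ^+ 2.
    rewrite -real_normK ?num_real// lerXn2r ?nnegrE ?(ltW r0)// ltW//.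
    by have := le_lt_trans (Im_le_normc _) near1; rewrite cImB.
  have := sqr_ge0 K; move: (K ^+ 2) (r ^+ 2) ((y - Im nu) ^+ 2) => a b d; nra.
pose M := c ^+ 2 * hsq h + r * K ^+ 2.
have M0 : 0 <= M.
  by apply: addr_ge0; apply: mulr_ge0; rewrite ?sqr_ge0 ?hsq_ge0 ?(ltW r0).
have [Hh1 _] : H2 h1 /\ hsq h1 <= M.
  apply: H2_intro => // x x0'.
  have [[mh ih] nh] := H2_line Hh x0'.
  have ig : mu.-integrable setT (EFin \o (fun y => c ^+ 2 * normc (line h x y) ^+ 2 +
      (2 * r ^+ 2 * K ^+ 2) * normc (((r +i* Im nu) - (0 +i* y))^-1) ^+ 2)).
    by apply: rintegrableD => //; exact: rintegrableZ.
  have s1 : sqint setT (line h1 x).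
    apply: (le_sqint _ _ ig) => //; first exact: H2_line_cmeasurable.
    by move=> y _; exact: bound.
  split => //; rewrite /M mulrDr.
  apply: (@le_trans _ _ (\int[mu]_y (c ^+ 2 * normc (line h x y) ^+ 2 +
      (2 * r ^+ 2 * K ^+ 2) * normc (((r +i* Im nu) - (0 +i* y))^-1) ^+ 2))).
    apply: le_Rintegral => //; first by case: s1.
    by move=> y _; exact: bound.
  rewrite RintegralD//; [|exact: rintegrableZ|exact: rintegrableZ].
  rewrite (@RintegralZl _ _ _ mu _ (fun y => normc (line h x y) ^+ 2))//.
  rewrite (@RintegralZl _ _ _ mu _ (fun y => normc (((r +i* Im nu) - (0 +i* y))^-1) ^+ 2))//.
  rewrite -/(nsq setT (line h x)) lerD//.
    by rewrite [leRHS]mulrCA ler_wpM2l ?sqr_ge0.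
  move: nk; rewrite /nsq => ->; rewrite subr0 /= (gtr0_norm r0).
  rewrite le_eqVlt; apply/orP; left; apply/eqP; field; by rewrite gt_eqF.
exists h1; split => //.
(* the sharp bound is read off on the boundary, where [|bfactor nu| -> 1] *)
have lim1 := hsq_cvg Hh1.
have lim2 : (1 - (4 / Re nu) * xs n) * nsq setT (line h1 (xs n)) @[n --> \oo] --> (1 - (4 / Re nu) * 0) * (2 * pi * hsq h1).
  apply: cvgM; last exact: lim1.
  apply: cvgB; first exact: cvg_cst.
  by apply: cvgMl_tmp; exact: cvg_harmonic.
rewrite mulr0 subr0 mul1r in lim2.
have : 2 * pi * hsq h1 <= 2 * pi * hsq h.
  apply: (cvgr_to_le lim2); apply: nearW => n.
  have xn0 := @xs_gt0 R n; have [s1 _] := H2_line Hh1 xn0; have [s2 n2] := H2_line Hh xn0.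
  apply: le_trans n2; rewrite /nsq -RintegralZl//; last by case: s1.
  apply: le_Rintegral => //.
  - by apply: rintegrableZ => //; case: s1.
  - by case: s2.
  move=> y _; rewrite /line bh1// normcM exprMn ler_wpM2r ?sqr_ge0//.
  rewrite bfactor_sqr//= lerD2l lerN2.
  have d0 : 0 < normc ((xs n +i* y) + conjc nu) by rewrite normc_gt0 bfactor_denom_neq0.
  have d1 := @bfactor_denom nu (xs n +i* y) nu0 xn0.
  rewrite ler_pdivrMr ?exprn_gt0// -!mulrA ler_pM2l// mulrCA ler_pM2l//.
  rewrite mulrC ler_pdivlMr// -expr2 lerXn2r ?nnegrE ?normc_ge0 ?(ltW nu0)//.
  by apply: le_trans d1 => /=; rewrite lerDr ltW.
by rewrite ler_pM2l// two_pi_gt0.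
Qed.

End HardyClosure.

(** * Powers on the unit interval *)

Section Powers.
Context {R : realType}.
Local Notation mu := (@lebesgue_measure R).
Implicit Types (a b z w : R[i]) (s t : R).

Lemma cpowE t a : cpow t a =
  (expR (Re a * ln t) * cos (Im a * ln t)) +i* (expR (Re a * ln t) * sin (Im a * ln t)).
Proof.
rewrite /cpow /cexp cReM cImM /= !mulr0 subr0 add0r.
by apply: complexP; rewrite ?cReM ?cImM/=; ring.
Qed.

Lemma normc_cpow t a : normc (cpow t a) = expR (Re a * ln t).
Proof.
have e0 : 0 <= expR (Re a * ln t) := expR_ge0 _.
apply/eqP; rewrite -(@eqrXn2 _ 2) ?normc_ge0// sqr_normcE cpowE/= !exprMn -mulrDr.
by rewrite cos2Dsin2 mulr1.
Qed.

Lemma cpowD t a b : cpow t (a + b) = cpow t a * cpow t b.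
Proof.
rewrite !cpowE cReD cImD !mulrDl expRD cosD sinD.
by apply: complexP; rewrite ?cReM ?cImM/=; ring.
Qed.

Lemma cpowJ t a : cpow t (conjc a) = conjc (cpow t a).
Proof. by rewrite !cpowE cReJ cImJ mulNr cosN sinN mulrN. Qed.

Lemma cpow1 a : cpow 1 a = 1 :> R[i].
Proof. by rewrite cpowE ln1 !mulr0 expR0 cos0 sin0 !mul1r. Qed.

Lemma cpow_cmeasurable D a : cmeasurable D (fun t => cpow t a).
Proof.
have ml (k : R) : measurable_fun setT (fun t : R => k * ln t).
  by apply: measurable_funM => //; exact: measurable_ln.
have me (k : R) : measurable_fun setT (fun t : R => expR (k * ln t)).
  by apply: measurableT_comp => //; exact: measurable_expR.
split; apply: measurable_funTS.
  under eq_fun do rewrite cpowE/=; apply: measurable_funM; first exact: me.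
  apply: measurableT_comp; last exact: ml.
  by apply: continuous_measurable_fun; exact: continuous_cos.
under eq_fun do rewrite cpowE/=; apply: measurable_funM; first exact: me.
apply: measurableT_comp; last exact: ml.
by apply: continuous_measurable_fun; exact: continuous_sin.
Qed.

Lemma is_derive_Mln (k t : R) : 0 < t -> is_derive t 1 (fun t => k * ln t) (k * t^-1).
Proof. by move=> t0; apply: is_deriveZ; exact: is_derive1_ln. Qed.

Lemma is_derive_Re_cpow a t : 0 < t ->
  is_derive t 1 (fun t => Re (cpow t (a + 1))) (Re ((a + 1) * cpow t a)).
Proof.
move=> t0.
rewrite (_ : (fun t => Re (cpow t (a + 1))) =
  (fun t => (expR \o (fun t => (Re a + 1) * ln t)) t * (cos \o (fun t => Im a * ln t)) t)); last first.
  by apply/funext => u; rewrite cpowE/= cReD cImD/= addr0.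
have d1 := is_derive_Mln (Re a + 1) t0; have d2 := is_derive_Mln (Im a) t0.
apply: is_derive_eq; rewrite cpowE cReM cReD cImD/= addr0 mulrDl expRD mul1r lnK ?posrE//.
by rewrite !scalerAl /GRing.scale/=; field; rewrite gt_eqF.
Qed.

Lemma is_derive_Im_cpow a t : 0 < t ->
  is_derive t 1 (fun t => Im (cpow t (a + 1))) (Im ((a + 1) * cpow t a)).
Proof.
move=> t0.
rewrite (_ : (fun t => Im (cpow t (a + 1))) =
  (fun t => (expR \o (fun t => (Re a + 1) * ln t)) t * (sin \o (fun t => Im a * ln t)) t)); last first.
  by apply/funext => u; rewrite cpowE/= cReD cImD/= addr0.
have d1 := is_derive_Mln (Re a + 1) t0; have d2 := is_derive_Mln (Im a) t0.
apply: is_derive_eq; rewrite cpowE cImM cReD cImD/= addr0 mulrDl expRD mul1r lnK ?posrE//.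
by rewrite !scalerAl /GRing.scale/=; field; rewrite gt_eqF.
Qed.

Lemma Rintegral_FTC2 (f F : R -> R) (u v : R) : u < v ->
  (forall t, u <= t -> is_derive t 1 F (f t)) ->
  (forall t, u <= t -> {for t, continuous f}) ->
  \int[mu]_(t in `[u, v]) f t = F v - F u.
Proof.
move=> uv dF cf; rewrite /Rintegral (@continuous_FTC2 R f F u v uv)//.
- apply: continuous_in_subspaceT => t /set_mem /=; rewrite in_itv/= => /andP[ut _].
  exact: cf.
- split.
  + move=> t; rewrite in_itv/= => /andP[ut _]; have := dF t (ltW ut) => h; exact: ex_derive.
  + apply: cvg_at_right_filter; have h := dF u (lexx _).
    by apply/differentiable_continuous/derivable1_diffP; exact: ex_derive.
  + apply: cvg_at_left_filter; have h := dF v (ltW uv).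
    by apply/differentiable_continuous/derivable1_diffP; exact: ex_derive.
- move=> t; rewrite in_itv/= => /andP[ut _]; have h := dF t (ltW ut).
  by rewrite derive1E; exact: derive_val.
Qed.

Lemma cpow_continuous a t : 0 < t -> {for t, continuous ((fun t => cpow t a) : R -> R[i]^o)}.
Proof.
move=> t0; have [d1 d2] := (is_derive_Re_cpow (a - 1) t0, is_derive_Im_cpow (a - 1) t0).
rewrite subrK in d1 d2; apply/cvg_complexP; split.
  by apply: (@differentiable_continuous _ _ _ t (fun t => Re (cpow t a)));
     apply/derivable1_diffP; exact: ex_derive.
by apply: (@differentiable_continuous _ _ _ t (fun t => Im (cpow t a)));
   apply/derivable1_diffP; exact: ex_derive.
Qed.

Lemma cintegral_cpow_itv a (e : R) : 0 < e -> e < 1 ->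
  (a + 1) * cintegral `[e, 1] (fun t => cpow t a) = 1 - cpow e (a + 1).
Proof.
move=> e0 e1.
have ci : cintegrable `[e, 1] (fun t => cpow t a).
  by apply: cintegrable_continuous => t /andP[et _]; apply: cpow_continuous; exact: lt_le_trans et.
rewrite -cintegralZ// -[X in _ = X - _](cpow1 (a + 1)).
have cc t : e <= t -> {for t, continuous ((fun t => (a + 1) * cpow t a) : R -> R[i]^o)}.
  move=> et; apply: (@cvgM R[i] R _ _ (fun=> a + 1) (fun t => cpow t a)); first exact: cvg_cst.
  by apply: cpow_continuous; exact: lt_le_trans et.
apply: complexP; rewrite ?cReB ?cImB.
  apply: (@Rintegral_FTC2 (fun t => Re ((a + 1) * cpow t a)) (fun t => Re (cpow t (a + 1)))) => // t et.
    by apply: is_derive_Re_cpow; exact: lt_le_trans et.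
  by have /cvg_complexP[] := cc t et.
apply: (@Rintegral_FTC2 (fun t => Im ((a + 1) * cpow t a)) (fun t => Im (cpow t (a + 1)))) => // t et.
  by apply: is_derive_Im_cpow; exact: lt_le_trans et.
by have /cvg_complexP[] := cc t et.
Qed.

Lemma xs_lt1 n : xs n.+1 < 1 :> R.
Proof. by rewrite /xs invf_lt1// ltr1n. Qed.

Lemma sqint_obnd_cbnd (f : R -> R[i]) (u v : R) : cmeasurable setT f ->
  sqint `]u, v] f -> sqint `[u, v] f.
Proof.
move=> mf [_ fi]; split.
  by case: mf => mR mI; split; exact: measurable_funTS.
apply/integrableP; split.
  by apply/measurable_EFinP; apply: measurable_funTS; exact: measurable_normc_sqr.
rewrite -integral_itv_obnd_cbnd.
  by move/integrableP : fi => [].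
apply: measurableT_comp => //; apply/measurable_EFinP; apply: measurable_funTS.
exact: measurable_normc_sqr.
Qed.

(** The antiderivative of the squared modulus bounds the integrals over
    [[1/n, 1]] uniformly, and Fatou's lemma lets [n] grow. *)
Lemma cpow_sqint a : - 2^-1 < Re a -> sqint (@I01 R) (fun t => cpow t a).
Proof.
move=> a0; have p0 : 0 < 2 * Re a + 1 by lra.
apply: sqint_obnd_cbnd; first exact: cpow_cmeasurable.
pose f_ n t := (\1_(`[xs n.+1, 1]%classic : set R) t)%:C * cpow t a.
have mf_ n : cmeasurable setT (f_ n).
  apply: cmeasurableM; last exact: cpow_cmeasurable.
  by split => /=; [exact: measurable_indic|exact: measurable_cst].
have n2 t : normc (cpow t a) ^+ 2 = expR ((2 * Re a) * ln t).
  by rewrite normc_cpow -expRM_natl; congr expR; ring.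
have key n : sqint `]0, 1] (f_ n) /\ nsq `]0, 1] (f_ n) <= (2 * Re a + 1)^-1.
  have x0 := @xs_gt0 R n.+1.
  have I1 : \int[mu]_(t in `[xs n.+1, 1]) expR ((2 * Re a) * ln t) <= (2 * Re a + 1)^-1.
    have := @cintegral_cpow_itv ((2 * Re a)%:C) (xs n.+1) x0 (xs_lt1 n).
    rewrite (_ : (2 * Re a)%:C + 1 = (2 * Re a + 1)%:C); last by rewrite rmorphD.
    move=> /(congr1 (@complex.Re R)); rewrite cReB cReM Re_cintegral mul0r subr0 => h.
    rewrite -[leRHS]mul1r ler_pdivlMr// mulrC.
    rewrite (@eq_Rintegral _ _ _ mu _ (fun t => Re (cpow t (2 * Re a)%:C))); last first.
      by move=> t _; rewrite cpowE/= mul0r cos0 mulr1.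
    by rewrite h cpowE/= mul0r cos0 mulr1 lerBlDr lerDl expR_ge0.
  have ci : mu.-integrable `[xs n.+1, 1] (EFin \o (fun t => expR ((2 * Re a) * ln t))).
    have [h _] : cintegrable `[xs n.+1, 1] (fun t => cpow t (2 * Re a)%:C).
      by apply: cintegrable_continuous => t /andP[et _]; apply: cpow_continuous; exact: lt_le_trans et.
    by apply: eq_integrable h => // t _; congr (_%:E); rewrite cpowE/= mul0r cos0 mulr1.
  apply: (sqintP _ _ _).1 => //.
    by case: (mf_ n) => mR mI; split; exact: measurable_funTS.
  have -> : (\int[mu]_(t in `]0%R, 1%R]) (normc (f_ n t) ^+ 2)%:E)%E =
      (\int[mu]_(t in `[xs n.+1, 1%R]) (expR ((2 * Re a) * ln t))%:E)%E.
    rewrite [LHS]integral_mkcond [RHS]integral_mkcond; apply: eq_integral => t _.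
    rewrite /f_ /patch normcM exprMn normc_real n2 indicE.
    case: ifPn => h1; case: ifPn => h2; rewrite ?normr1 ?normr0 ?expr1n ?expr0n ?mul1r ?mul0r//.
    move: h1 h2; rewrite !notin_setE !inE/= !in_itv/= => h1 /andP[h2 h3].
    by exfalso; apply: h1; rewrite h3 (lt_le_trans x0).
  by rewrite -lee_fin in I1; apply: le_trans I1; rewrite /Rintegral fineK//; exact: integrable_fin_num.
have [] // := @sqint_fatou R `]0, 1] f_ (fun t => cpow t a) (2 * Re a + 1)^-1 _ _ _ _ => //.
- by move=> n; case: (key n).
- move=> t /=; rewrite in_itv/= => /andP[t0 t1]; apply/cvg_normcP => e e0; near=> n.
  rewrite /f_ indicE mem_set ?mul1r ?subrr ?ComplexField.Normc.normc0//=.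
  rewrite in_itv/= t1 andbT ltW//; apply: le_lt_trans (_ : xs n < t).
    by rewrite /xs lef_pV2 ?posrE// ler_nat.
  by near: n; exact: near_infty_natSinv_lt (PosNum t0).
- by apply: nearW => n; case: (key n).
Unshelve. all: by end_near. Qed.

Lemma cpow_xs_cvg0 a : 0 < Re a -> (cpow (xs n.+1) a : R[i]^o) @[n --> \oo] --> (0 : R[i]^o).
Proof.
move=> a0; apply/cvg_normcP => e e0.
have d0 : 0 < expR (ln e / Re a) := expR_gt0 _.
near=> n; rewrite subr0 normc_cpow.
rewrite -[ltRHS](@lnK R) ?posrE// ltr_expR mulrC -ltr_pdivlMr//.
rewrite -[ltRHS]expRK ltr_ln ?posrE ?expR_gt0 ?xs_gt0//.
apply: le_lt_trans (_ : xs n < _); first by rewrite /xs lef_pV2 ?posrE// ler_nat.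
by near: n; exact: near_infty_natSinv_lt (PosNum d0).
Unshelve. all: by end_near. Qed.

(** The antiderivative is differentiable only away from [0], so the integral is
    obtained as the limit of the integrals over [[1/n, 1]]. *)
Lemma cintegral_cpow a : cintegrable (@I01 R) (fun t => cpow t a) -> - 1 < Re a ->
  cintegral (@I01 R) (fun t => cpow t a) = (a + 1)^-1.
Proof.
move=> ci a0.
have an : a + 1 != 0.
  by apply/eqP => /(congr1 (@complex.Re R)); rewrite cReD/= => h; lra.
apply: (mulfI an); rewrite divff//.
pose g t := (\1_(`]0%R, 1%R]%classic : set R) t)%:C * cpow t a.
pose G n t := (\1_(`[xs n.+1, 1]%classic : set R) t)%:C * cpow t a.
have [|||||_ lim] := @cintegral_cvg R (@I01 R) G g (fun t => normc (cpow t a)).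
- exact: measurable_itv.
- move=> n; apply: cmeasurableM; last exact: cpow_cmeasurable.
  by split => /=; [exact: measurable_indic|exact: measurable_cst].
- move=> t; rewrite /I01/= in_itv/= => t01; rewrite /g /G; have [t0|t0] := ltP 0 t; last first.
    rewrite (_ : (fun n => _) = (fun=> (\1_(`]0%R, 1%R]%classic : set R) t)%:C * cpow t a)); first exact: cvgC_cst.
    apply/funext => n; rewrite !indicE; congr (_%:C * _); congr (_ %:R).
    rewrite memNset ?memNset//= in_itv/=; first by rewrite ltNge t0.
    by move=> /andP[h _]; have := lt_le_trans (@xs_gt0 R n.+1) h; rewrite ltNge t0.
  apply/cvg_normcP => e e0; near=> n.
  rewrite (_ : \1_(`[xs n.+1, 1]%classic : set R) t = \1_(`]0%R, 1%R]%classic : set R) t) ?subrr ?ComplexField.Normc.normc0//.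
  have xt : xs n.+1 <= t.
    rewrite ltW//; apply: le_lt_trans (_ : xs n < t); first by rewrite /xs lef_pV2 ?posrE// ler_nat.
    by near: n; exact: near_infty_natSinv_lt (PosNum t0).
  by rewrite !indicE !mem_set//= in_itv/= ?t0 ?xt; case/andP: t01.
- by apply: integrable_normc => //; exact: measurable_itv.
- move=> n t _; rewrite /G normcM normc_real indicE.
  by rewrite ler_piMl ?normc_ge0//; case: (_ \in _); rewrite ?normr1 ?normr0.
have Eg : cintegral (@I01 R) g = cintegral (@I01 R) (fun t => cpow t a).
  have h (u : R -> R) : measurable_fun setT u ->
     \int[mu]_(t in @I01 R) (\1_(`]0%R, 1%R]%classic : set R) t * u t) = \int[mu]_(t in @I01 R) u t.
    move=> mU; have mg : measurable_fun setT (fun t => \1_(`]0%R, 1%R]%classic : set R) t * u t).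
      by apply: measurable_funM => //; exact: measurable_indic.
    rewrite /Rintegral -integral_itv_obnd_cbnd; last first.
      by apply/measurable_EFinP; exact: measurable_funTS mg.
    rewrite -integral_itv_obnd_cbnd; last by apply/measurable_EFinP; exact: measurable_funTS mU.
    by congr fine; apply: eq_integral => t /set_mem h; rewrite indicE mem_set// mul1r.
  have [mR mI] := @cpow_cmeasurable setT a.
  apply: complexP; rewrite ?Re_cintegral ?Im_cintegral -?(h _ mR) -?(h _ mI); apply: eq_Rintegral => t _.
    by rewrite /g cReM mul0r subr0.
  by rewrite /g cImM mul0r addr0.
have EG n : cintegral (@I01 R) (G n) = cintegral `[xs n.+1, 1] (fun t => cpow t a).
  have x0 := @xs_gt0 R n.+1.
  have h (u : R -> R) : \int[mu]_(t in @I01 R) (\1_(`[xs n.+1, 1]%classic : set R) t * u t) =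
      \int[mu]_(t in `[xs n.+1, 1]) u t.
    rewrite /Rintegral; congr fine; rewrite [LHS]integral_mkcond [RHS]integral_mkcond.
    apply: eq_integral => t _; rewrite /patch indicE /I01.
    have [h|h] := boolP (t \in `[xs n.+1, 1]%classic).
      rewrite mem_set ?mul1r//; move: h; rewrite !inE/= !in_itv/= => /andP[h1 h2].
      by rewrite h2 (le_trans (ltW x0)).
    by case: ifPn => _; rewrite ?mul0r//= mul0r.
  apply: complexP.
    rewrite !Re_cintegral -[RHS]h; apply: eq_Rintegral => t _.
    by rewrite /G cReM mul0r subr0.
  rewrite !Im_cintegral -[RHS]h; apply: eq_Rintegral => t _.
  by rewrite /G cImM mul0r addr0.
have l1 : ((a + 1) * cintegral (@I01 R) (G n) : R[i]^o) @[n --> \oo] --> ((a + 1) * cintegral (@I01 R) g : R[i]^o).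
  by apply: cvgC_Ml.
have l2 : ((a + 1) * cintegral (@I01 R) (G n) : R[i]^o) @[n --> \oo] --> (1 - 0 : R[i]^o).
  rewrite (_ : (fun n => _) = (fun n => 1 + -1 * cpow (xs n.+1) (a + 1))).
    apply: cvgC_D; first exact: cvgC_cst.
    rewrite oppr0 -[X in _ --> X](mulr0 (-1)); apply: cvgC_Ml; apply: cpow_xs_cvg0.
    by rewrite cReD/=; lra.
  by apply/funext => n; rewrite EG cintegral_cpow_itv ?xs_gt0 ?xs_lt1// mulN1r.
by rewrite -Eg (cvgC_unique l1 l2) subr0.
Unshelve. all: by end_near. Qed.

End Powers.

(** * Completeness in the mean *)

Section Completeness.
Context {R : realType}.
Local Notation mu := (@lebesgue_measure R).
Implicit Types (f g : R -> R[i]) (t : R).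

Lemma cvgn_series_fin (u : nat -> R) : (forall n, 0 <= u n) ->
  (\sum_(0 <= n <oo) (u n)%:E < +oo)%E -> cvgn (series u).
Proof.
move=> u0 us; apply: nondecreasing_is_cvgn; first exact: nondecreasing_series.
have s0 : (0 <= \sum_(0 <= n <oo) (u n)%:E)%E by apply: nneseries_ge0 => n _ _; rewrite lee_fin.
exists (fine (\sum_(0 <= n <oo) (u n)%:E)%E) => _ [n _ <-].
rewrite -lee_fin fineK ?ge0_fin_numE//.
by rewrite /series/= -sumEFin; apply: nneseries_lim_ge => k _ _; rewrite lee_fin.
Qed.

Lemma cvgn_telescope (v d : nat -> R) : (forall k, `|v k.+1 - v k| <= d k) ->
  cvgn (series d) -> cvgn v.
Proof.
move=> vd cd.
have h : cvgn (series (telescope v)).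
  apply: (@normed_cvg R R^o); apply: series_le_cvg cd => //= n.
  exact: le_trans (vd n).
rewrite (_ : v = (fun n => v 0%N + series (telescope v) n)); last first.
  by apply/funext => n; rewrite eq_sum_telescope.
by apply: is_cvgD => //; exact: is_cvg_cst.
Qed.

Lemma cvgC_telescope (u : nat -> R[i]) (d : nat -> R) :
  (forall k, normc (u k.+1 - u k) <= d k) -> cvgn (series d) ->
  exists l : R[i], (u n : R[i]^o) @[n --> \oo] --> (l : R[i]^o).
Proof.
move=> ud cd.
have cR : cvgn (fun n => Re (u n)).
  by apply: cvgn_telescope cd => k; rewrite -cReB (le_trans (Re_le_normc _)).
have cI : cvgn (fun n => Im (u n)).
  by apply: cvgn_telescope cd => k; rewrite -cImB (le_trans (Im_le_normc _)).
by exists (limn (fun n => Re (u n)) +i* limn (fun n => Im (u n))); apply/cvg_complexP.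
Qed.

Lemma mI01 : measurable (@I01 R). Proof. exact: measurable_itv. Qed.

Lemma nsq_I01_1 : sqint (@I01 R) (fun=> 1) /\ nsq (@I01 R) (fun=> 1) = 1.
Proof.
split; first by rewrite -[1]/(1%:C); apply: (@eq_sqint R _ (fun t => cpow t 0));
  [move=> t; rewrite cpowE !mul0r expR0 cos0 sin0 !mul1r|apply: cpow_sqint => /=; rewrite oppr_lt0].
rewrite /nsq ComplexField.Normc.normc1 Rintegral_cst; last exact: mI01.
rewrite (_ : fine _ = 1); first by rewrite expr1n mul1r.
by have := @lebesgue_measure_itv R `[0, 1]; rewrite /= lte_fin ltr01 sube0 => ->.
Qed.

(** Riesz-Fischer: a sequence which is Cauchy in the mean at a geometric rate
    converges almost everywhere, and Fatou's lemma turns the pointwise limit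
    into a limit in the mean. *)
Lemma nsq_complete (p : nat -> R -> R[i]) : (forall k, sqint (@I01 R) (p k)) ->
  (forall k j, (k <= j)%N -> nsq (@I01 R) (fun t => p j t - p k t) <= (2^-1 ^+ k) ^+ 2) ->
  exists2 f, sqint (@I01 R) f &
    forall k, nsq (@I01 R) (fun t => f t - p k t) <= (2^-1 ^+ k) ^+ 2.
Proof.
move=> sp cp; have mD := mI01; set D := @I01 R in sp cp mD *.
have [s1 n1] := nsq_I01_1.
pose u k t := normc (p k.+1 t - p k t).
have sd k : sqint D (fun t => p k.+1 t - p k t) by exact: sqintB.
have mu_ k : measurable_fun D (u k) by apply: measurable_normc; case: (sd k).
have iu k : mu.-integrable D (EFin \o u k).
  have ci := sqint_mul mD (sd k) s1.
  by have := integrable_normc mD ci; apply: eq_integrable => // t _ /=; rewrite mulr1.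
have Iu k : (\int[mu]_(t in D) (u k t)%:E <= (2^-1 ^+ k)%:E)%E.
  rewrite -[leLHS]fineK; last exact: integrable_fin_num (iu k).
  rewrite lee_fin; change (\int[mu]_(t in D) u k t <= 2^-1 ^+ k).
  have h := Rintegral_normcM mD (sd k) s1.
  rewrite -ler_sqr ?nnegrE ?exprn_ge0 ?invr_ge0//; last first.
    by apply: Rintegral_ge0 => t _; exact: normc_ge0.
  apply: le_trans (cp k k.+1 (leqnSn k)).
  rewrite n1 mulr1 in h; apply: le_trans h; rewrite le_eqVlt; apply/orP; left; apply/eqP.
  by congr (_ ^+ 2); apply: eq_Rintegral => t _; rewrite mulr1.
pose S t := (\sum_(0 <= k <oo) (u k t)%:E)%E.
have mS : measurable_fun D S.
  apply: ge0_emeasurable_sum => [k t Dt _|k _]; first by rewrite lee_fin normc_ge0.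
  exact/measurable_EFinP.
have S0 t : (0 <= S t)%E by apply: nneseries_ge0 => k _ _; rewrite lee_fin normc_ge0.
have iS : mu.-integrable D S.
  apply/integrableP; split => //.
  under eq_integral => t _ do rewrite gee0_abs//.
  rewrite integral_nneseries//; [|by move=> k; apply/measurable_EFinP; exact: mu_
    |by move=> k t _; rewrite lee_fin normc_ge0].
  have hs := @is_cvg_geometric_series R 1 2^-1.
  apply: (@le_lt_trans _ _ (\sum_(0 <= k <oo) (2^-1 ^+ k)%:E)%E).
    apply: lee_nneseries => k _; last exact: Iu.
    by move=> _; apply: integral_ge0 => t _; rewrite lee_fin normc_ge0.
  have {}hs : cvgn (series (fun k => 2^-1 ^+ k : R)).
    have := hs; rewrite /geometric/=; under eq_fun do rewrite mul1r.
    by apply; rewrite ger0_norm ?invr_ge0// invf_lt1// ltr1n.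
  rewrite (_ : (fun n => _) = EFin \o series (fun k => 2^-1 ^+ k : R)).
    by rewrite EFin_lim// ltry.
  by apply/funext => n; rewrite /series/= -sumEFin.
have [N [mN N0 subN]] := integrable_ae (mu:=mu) mD iS.
(* [q k] is [p k] made to vanish on a null set, so that the sequence converges
   at every point *)
pose q k t := (\1_(~` N) t)%:C * p k t.
have mq k : cmeasurable D (q k).
  apply: cmeasurableM; last by case: (sp k).
  split => /=; last exact: measurable_cst.
  by apply: measurable_indic; exact: measurableC.
have qN k t : N t -> q k t = 0.
  by move=> Nt; rewrite /q indicE memNset ?mul0r//=; exact.
have qC k t : ~ N t -> q k t = p k t.
  by move=> Nt; rewrite /q indicE mem_set ?mul1r.
have sq k : sqint D (q k).
  apply: (@le_sqint R _ _ (fun t => normc (p k t) ^+ 2)) => //; first by case: (sp k).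
  move=> t _; have [Nt|Nt] := pselect (N t); last by rewrite qC.
  by rewrite qN// ComplexField.Normc.normc0 expr0n sqr_ge0.
have /choice[f hf] : forall t, exists l : R[i], D t -> (q k t : R[i]^o) @[k --> \oo] --> (l : R[i]^o).
  move=> t; have [Nt|Nt] := pselect (N t).
    exists 0 => _; rewrite (_ : (fun k => _) = (fun=> 0)); first exact: cvgC_cst.
    by apply/funext => k; rewrite qN.
  have [Dt|nDt] := pselect (D t); last by exists 0.
  have St : S t \is a fin_num by apply: contrapT => h; apply: Nt; apply: subN => /(_ Dt).
  have Sy : (S t < +oo)%E by move: St; rewrite ge0_fin_numE.
  have [l hl] := @cvgC_telescope (fun k => p k t) (fun k => u k t) (fun k => lexx _)
    (cvgn_series_fin (fun k => normc_ge0 _) Sy).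
  exists l => _; rewrite (_ : (fun k => _) = (fun k => p k t))//.
  by apply/funext => k; rewrite qC.
have sf k : sqint D (fun t => f t - q k t) /\ nsq D (fun t => f t - q k t) <= (2^-1 ^+ k) ^+ 2.
  apply: (@sqint_fatou R D (fun j t => q j t - q k t) (fun t => f t - q k t) _ mD).
  - by move=> j; exact: sqintB.
  - move=> t Dt; exact: (@cvgC_D R (fun j => q j t) (fun=> - q k t) (f t) (- q k t) (hf t Dt) (@cvgC_cst R _)).
  - near=> j; apply: le_trans (cp k j _); last by near: j; exact: nbhs_infty_ge.
    have [_ i1] := sqintB mD (sq j) (sq k); have [_ i2] := sqintB mD (sp j) (sp k).
    apply: le_Rintegral => // t _; have [Nt|Nt] := pselect (N t); last by rewrite !qC.
    by rewrite !qN// subrr ComplexField.Normc.normc0 expr0n sqr_ge0.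
have Sf : sqint D f.
  have [h _] := sf 0%N; have := sqintD mD h (sq 0%N); apply: eq_sqint => t; exact: subrK.
exists f => // k; have [_] := sf k; apply: le_trans.
rewrite le_eqVlt; apply/orP; left; apply/eqP; congr fine.
apply: ae_eq_integral => //.
- have [mg _] := sqintB mD Sf (sp k); apply/measurable_EFinP; exact: (measurable_normc_sqr mg).
- have [mg _] := sqintB mD Sf (sq k); apply/measurable_EFinP; exact: (measurable_normc_sqr mg).
- exists N; split => // t /= ht; apply: contrapT => Nt; apply: ht => _.
  by rewrite qC.
Unshelve. all: by end_near. Qed.

End Completeness.

(** * The transform, powers and reproducing kernels *)

Section Muntz.
Context {R : realType}.
Local Notation mu := (@lebesgue_measure R).
Local Notation D := (@I01 R).
Implicit Types (f g : R -> R[i]) (t : R) (z w : R[i]).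

Lemma sqrt_hsqD (f g : R[i] -> R[i]) : H2 f -> H2 g ->
  Num.sqrt (hsq (fun z => f z + g z)) <= Num.sqrt (hsq f) + Num.sqrt (hsq g).
Proof.
move=> Hf Hg; rewrite -ler_sqr ?nnegrE ?addr_ge0 ?sqrtr_ge0//.
rewrite sqrrD !sqr_sqrtr ?hsq_ge0// hsqD//.
rewrite [leRHS]addrAC lerD2l -[leRHS]mulr_natl ler_pM2l// -sqrtrM ?hsq_ge0//.
rewrite (le_trans (ler_norm _))// (le_trans (Re_le_normc _))//.
rewrite -[leLHS]ger0_norm ?normc_ge0// -sqrtr_sqr ler_sqrt; last exact: (mulr_ge0 (hsq_ge0 _) (hsq_ge0 _)).
exact: hardy_inner_CS.
Qed.

Lemma l2normE f : sqint D f -> l2norm f = (Num.sqrt (nsq D f))%:E.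
Proof.
move=> sf; rewrite /l2norm nsqE//; last exact: mI01.
by rewrite poweR12_sqrt// lee_fin nsq_ge0.
Qed.

Lemma L2P f : L2 f <-> sqint D f.
Proof.
split=> [[mR mI lf]|sf]; last first.
  by have [[mR mI] _] := sf; split => //; rewrite l2normE// ltry.
have I0 : (0 <= \int[mu]_(t in D) ((normc (f t)) ^+ 2)%:E)%E.
  by apply: integral_ge0 => t _; rewrite lee_fin sqr_ge0.
move: lf; rewrite /l2norm poweR12_sqrt//.
case E : (\int[mu]_(t in D) ((normc (f t)) ^+ 2)%:E)%E I0 => [r| |]// _ _.
have [] // := (sqintP r mI01 (conj mR mI)).1 _.
by rewrite E.
Qed.

Lemma Re_half : Re (2^-1 : R[i]) = 2^-1.
Proof. by have -> : (2^-1 : R[i]) = (2^-1 : R)%:C; [rewrite fmorphV rmorph_nat|]. Qed.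

Lemma mellin_kernel_sqint z : 0 < Re z -> sqint D (fun t => cpow t (z - 2^-1)).
Proof.
move=> z0; apply: cpow_sqint; rewrite cReB Re_half; lra.
Qed.

Lemma mellin_lin (a : R[i]) f g z : sqint D f -> sqint D g -> 0 < Re z ->
  mellin (fun t => a * f t + g t) z = a * mellin f z + mellin g z.
Proof.
move=> sf sg z0; have mD := @mI01 R; have sk := mellin_kernel_sqint z0.
rewrite /mellin -cintegralZ//; last exact: sqint_mul.
rewrite -cintegralD//; last 2 first.
- by apply: cintegrableZ => //; exact: sqint_mul.
- exact: sqint_mul.
by apply: eq_cintegral => t _; rewrite mulrDl mulrA.
Qed.

Lemma mellinB f g z : sqint D f -> sqint D g -> 0 < Re z ->
  mellin (fun t => f t - g t) z = mellin f z - mellin g z.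
Proof.
move=> sf sg z0; rewrite -mulN1r addrC -mellin_lin//.
by congr (mellin _ _); apply/funext => t; rewrite mulN1r addrC.
Qed.

Lemma mellin_le f z : sqint D f -> 0 < Re z ->
  normc (mellin f z) ^+ 2 <= nsq D f * nsq D (fun t => cpow t (z - 2^-1)).
Proof. by move=> sf z0; apply: cintegralM_CS => //; [exact: mI01|exact: mellin_kernel_sqint]. Qed.

(** Each value of the transform is continuous in the mean, being the integral
    against a fixed square integrable power. *)
Lemma mellin_cvg (f_ : nat -> R -> R[i]) f z (e : nat -> R) : 0 < Re z ->
  (forall k, sqint D (f_ k)) -> sqint D f ->
  (forall k, nsq D (fun t => f t - f_ k t) <= e k) -> e @ \oo --> 0 ->
  (mellin (f_ k) z : R[i]^o) @[k --> \oo] --> (mellin f z : R[i]^o).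
Proof.
move=> z0 sf_ sf fe e0; have mD := @mI01 R.
pose K := nsq D (fun t => cpow t (z - 2^-1)).
have K0 : 0 <= K := nsq_ge0 _ _.
have eK : (fun k => e k * K) @ \oo --> 0.
  by rewrite -[X in _ --> X](mul0r K); apply: cvgMr_tmp.
apply/cvg_normcP => r r0; have r2 : 0 < r ^+ 2 by rewrite exprn_gt0.
have /cvgrPdist_lt/(_ _ r2) := eK; apply: filterS => k; rewrite sub0r normrN => hk.
rewrite -ltr_sqr ?nnegrE ?normc_ge0 ?(ltW r0)// normcBC -mellinB//.
apply: (le_lt_trans (mellin_le (sqintB mD sf (sf_ k)) z0)).
apply: le_lt_trans hk; apply: le_trans (ler_norm _).
by rewrite ler_wpM2r.
Qed.

Lemma mellin_cpow l z : - 2^-1 < Re l -> 0 < Re z ->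
  mellin (fun t => cpow t l) z = (z + (l + 2^-1))^-1.
Proof.
move=> l0 z0.
have ci : cintegrable D (fun t => cpow t (l + (z - 2^-1))).
  have := sqint_mul mI01 (cpow_sqint l0) (mellin_kernel_sqint z0).
  by under eq_fun do rewrite -cpowD.
rewrite /mellin; under eq_cintegral do rewrite -cpowD.
rewrite cintegral_cpow//; first by congr (_^-1); field.
by rewrite cReD cReB Re_half; lra.
Qed.

End Muntz.


Section HardyInnerRight.
Context {R : realType}.
Implicit Types (f g : R[i] -> R[i]).

Lemma hardy_innerDr f g1 g2 : H2 f -> H2 g1 -> H2 g2 ->
  hardy_inner f (fun z => g1 z + g2 z) = hardy_inner f g1 + hardy_inner f g2.
Proof.
move=> Hf H1 H2'; have [Hp _] := H2D H1 H2'.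
rewrite (hardy_inner_conj Hp Hf) hardy_innerDl// rmorphD/=.
by rewrite (hardy_inner_conj H1 Hf) (hardy_inner_conj H2' Hf).
Qed.

Lemma hardy_innerZr (a : R[i]) f g : H2 f -> H2 g ->
  hardy_inner f (fun z => a * g z) = conjc a * hardy_inner f g.
Proof.
move=> Hf Hg; have [Hp _] := H2Z a Hg.
by rewrite (hardy_inner_conj Hp Hf) hardy_innerZl// rmorphM/= -hardy_inner_conj.
Qed.

Lemma hardy_inner_sumr n (c : nat -> R[i]) f (G : nat -> R[i] -> R[i]) : H2 f -> (forall i, H2 (G i)) ->
  hardy_inner f (fun z => \sum_(i < n) c i * G i z) = \sum_(i < n) conjc (c i) * hardy_inner f (G i).
Proof.
move=> Hf HG; have HZ i : H2 (fun z => c i * G i z) by have [] := H2Z (c i) (HG i).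
elim: n => [|n IH].
  under eq_fun do rewrite big_ord0; rewrite big_ord0.
  have [h0 e0] := @H2_0 R; apply/eqP; rewrite -normc_eq0 -sqrf_eq0 eq_le sqr_ge0 andbT.
  by have := hardy_inner_CS Hf h0; rewrite e0 mulr0.
under eq_fun do rewrite big_ord_recr/=; rewrite big_ord_recr/= hardy_innerDr//.
  by rewrite IH hardy_innerZr.
by apply: H2_sum => i; exact: HZ.
Qed.

(** Moving a near minimiser along [k] cannot decrease the norm much, so it is
    nearly orthogonal to [k]. *)
Lemma near_minimizer_inner (u k : R[i] -> R[i]) (m e : R) : H2 u -> H2 k ->
  (forall a, m <= hsq (fun z => u z + a * k z)) -> hsq u <= m + e ->
  normc (hardy_inner u k) ^+ 2 <= e * hsq k.
Proof.
move=> Hu Hk hm hu; set I := hardy_inner u k; set K := hsq k.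
have E (t : R) : hsq (fun z => u z + (- t%:C * I) * k z) =
    hsq u + t ^+ 2 * normc I ^+ 2 * K - 2 * t * normc I ^+ 2.
  have [Hak hak] := H2Z (- t%:C * I) Hk.
  rewrite hsqD// hak hardy_innerZr// -/I -/K normcM normcN normc_real exprMn real_normK ?num_real//.
  have -> : conjc (- t%:C * I) * I = (- (t * normc I ^+ 2))%:C.
    by rewrite sqr_normcE; apply: complexP; rewrite ?cReM ?cImM ?cReJ ?cImJ ?cReM ?cImM ?cReN ?cImN/=; ring.
  by rewrite /=; ring.
have [K0|Kn] := eqVneq K 0.
  by rewrite K0 mulr0; have := hardy_inner_CS Hu Hk; rewrite -/K K0 mulr0.
have K0 : 0 < K by rewrite lt_neqAle eq_sym Kn hsq_ge0.
have := hm (- (K^-1)%:C * I); rewrite E => h.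
have {}h : m <= hsq u - normc I ^+ 2 / K.
  apply: le_trans h _; rewrite le_eqVlt; apply/orP; left; apply/eqP; by field.
rewrite -ler_pdivrMr//; lra.
Qed.

End HardyInnerRight.

Section MuntzSpace.
Context {R : realType} (lam : nat -> R[i]).
Context (hlam : forall n, half_plane (- 2^-1) (lam n)).
Local Notation mu := (@lebesgue_measure R).
Local Notation D := (@I01 R).
Implicit Types (f g : R -> R[i]) (t : R) (z w : R[i]) (N : nat) (c : nat -> R[i]).

(** The point whose reproducing kernel is the transform of the power [t ^ lam
    n]. *)
Definition node n : R[i] := conjc (lam n) + 2^-1.
Definition mpoly N c t := \sum_(n < N) c n * cpow t (lam n).
Definition kpoly N c z := \sum_(n < N) c n * rkernel (node n) z.

Lemma kpolyZ a N c z : a * kpoly N c z = kpoly N (fun n => a * c n) z.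
Proof. by rewrite /kpoly mulr_sumr; apply: eq_bigr => i _; rewrite mulrA. Qed.

Lemma node_gt0 n : 0 < Re (node n).
Proof. by rewrite cReD cReJ Re_half; have := hlam n; rewrite /half_plane/=; lra. Qed.

Lemma sqint_mpoly N c : sqint D (mpoly N c).
Proof.
apply: sqint_sum; first exact: mI01.
by move=> i; apply: sqintZ; [exact: mI01|apply: cpow_sqint; exact: hlam].
Qed.

Lemma H2_kpoly N c : H2 (kpoly N c).
Proof.
by apply: H2_sum => i; have [] := H2Z (c i) (H2_rkernel (node_gt0 i)).
Qed.

Lemma mellin_mpoly N c z : 0 < Re z -> mellin (mpoly N c) z = kpoly N c z.
Proof.
move=> z0; have mD := @mI01 R; rewrite /mpoly /kpoly; elim: N => [|N IH].
  rewrite big_ord0 /mellin (eq_cintegral (g := fun=> 0)) ?cintegral0// => t _.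
  by rewrite big_ord0 mul0r.
rewrite big_ord_recr/= -IH addrC.
have -> : rkernel (node N) z = mellin (fun t => cpow t (lam N)) z.
  rewrite mellin_cpow//; last exact: hlam.
  rewrite /rkernel /node; congr ((_ + _)^-1).
  apply: complexP; rewrite ?cReJ ?cImJ ?cReD ?cImD ?cReJ ?cImJ//.
  have -> : (2^-1 : R[i]) = (2^-1 : R)%:C by rewrite fmorphV rmorph_nat.
  by rewrite /=; ring.
rewrite -mellin_lin//; last 2 first.
- by apply: cpow_sqint; exact: hlam.
- exact: sqint_mpoly.
by congr (mellin _ z); apply/funext => t; rewrite big_ord_recr/= addrC.
Qed.

(** The same coefficients serve every family [F].  Applied to the powers and
    to the kernels, this makes linear operations on combinations commute with
    the transform. *)
Lemma combo_lin a N c N' c' : exists M (d : nat -> R[i]), forall F : nat -> R[i],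
  a * \sum_(n < N) c n * F n + \sum_(n < N') c' n * F n = \sum_(n < M) d n * F n.
Proof.
exists (maxn N N'), (fun n => a * (if (n < N)%N then c n else 0) + (if (n < N')%N then c' n else 0)) => F.
rewrite (big_ord_widen _ (fun n => c n * F n) (leq_maxl N N')) big_mkcond/=.
rewrite (big_ord_widen _ (fun n => c' n * F n) (leq_maxr N N')) [X in _ + X]big_mkcond/=.
rewrite mulr_sumr -big_split/=; apply: eq_bigr => n _.
by case: ifPn => _; case: ifPn => _; ring.
Qed.

(** The powers and the reproducing kernels have the same Gram matrix: both
    squared norms equal the sum of [conj (c n)] times the value at the [n]-th
    node. *)
Lemma nsq_mpoly N c : nsq D (mpoly N c) = hsq (kpoly N c).
Proof.
have mD := @mI01 R; have sP := sqint_mpoly N c; have HQ := H2_kpoly N c.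
suff : (nsq D (mpoly N c))%:C = (hsq (kpoly N c))%:C by move=> /(congr1 (@complex.Re R)).
rewrite -cintegral_mul_conj -hardy_inner_self//.
have HG i : H2 (rkernel (node i)) by exact/H2_rkernel/node_gt0.
have -> : hardy_inner (kpoly N c) (kpoly N c) = _ := hardy_inner_sumr N c HQ HG.
have se i : sqint D (fun t => conjc (cpow t (lam i))) by apply: sqintJ => //; exact/cpow_sqint/hlam.
rewrite (eq_cintegral (g := fun t => \sum_(i < N) conjc (c i) * (mpoly N c t * conjc (cpow t (lam i))))); last first.
  move=> t _; rewrite {2}/mpoly rmorph_sum mulr_sumr; apply: eq_bigr => i _.
  by rewrite rmorphM/= mulrCA.
rewrite cintegral_sum//; last by move=> i; apply: cintegrableZ => //; exact: sqint_mul.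
apply: eq_bigr => i _; rewrite cintegralZ//; last exact: sqint_mul.
rewrite hardy_inner_rkernel ?node_gt0//; congr (_ * _).
rewrite -mellin_mpoly ?node_gt0//; apply: eq_cintegral => t _.
by rewrite -cpowJ /node addrK.
Qed.

Lemma muntzP f : muntz_space lam f <-> sqint D f /\
  forall e, 0 < e -> exists N c, nsq D (fun t => f t - mpoly N c t) <= e ^+ 2.
Proof.
have mD := @mI01 R; split=> [[/L2P sf fM]|[sf fM]].
  split => // e /fM[N [c]]; rewrite l2normE; last by apply: sqintB => //; exact: sqint_mpoly.
  rewrite lte_fin => h; exists N, c; rewrite -[leLHS]sqr_sqrtr ?nsq_ge0//.
  by rewrite ler_sqr ?nnegrE ?sqrtr_ge0 ?(ltW h)// (le_trans _ (ltW h))// sqrtr_ge0.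
split; first exact/L2P.
move=> e e0; have e20 : 0 < e / 2 by rewrite divr_gt0.
have [N [c h]] := fM _ e20; exists N, c.
rewrite l2normE; last by apply: sqintB => //; exact: sqint_mpoly.
rewrite lte_fin; apply: (@le_lt_trans _ _ (e / 2)); last lra.
by rewrite -[leRHS]ger0_norm ?(ltW e20)// -sqrtr_sqr ler_sqrt ?sqr_ge0.
Qed.

Lemma muntz_sqint f : muntz_space lam f -> sqint D f.
Proof. by move=> /muntzP[]. Qed.

Lemma muntz_lin a f g : muntz_space lam f -> muntz_space lam g ->
  muntz_space lam (fun t => a * f t + g t).
Proof.
move=> /muntzP[sf fM] /muntzP[sg gM]; have mD := @mI01 R; apply/muntzP; split.
  by apply: sqintD => //; exact: sqintZ.
move=> e e0; pose K := 2 * normc a ^+ 2 + 2.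
have K0 : 0 < K by have := sqr_ge0 (normc a); rewrite /K; lra.
pose d := e / Num.sqrt K; have d0 : 0 < d by rewrite divr_gt0// sqrtr_gt0.
have [N [c hc]] := fM _ d0; have [N' [c' hc']] := gM _ d0.
have [M [b hb]] := combo_lin a N c N' c'; exists M, b.
have s1 := sqintB mD sf (sqint_mpoly N c); have s2 := sqintB mD sg (sqint_mpoly N' c').
rewrite (eq_nsq (g := fun t => a * (f t - mpoly N c t) + (g t - mpoly N' c' t))); last first.
  by move=> t _; congr normc; have := hb (fun n => cpow t (lam n)); rewrite /= /mpoly => <-; ring.
apply: le_trans (nsqD_le mD (sqintZ a mD s1) s2) _; rewrite nsqZ//.
have -> : e ^+ 2 = (2 * normc a ^+ 2 + 2) * d ^+ 2.
  by rewrite /d exprMn exprVn sqr_sqrtr ?(ltW K0)// mulrC divfK// gt_eqF.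
rewrite [leRHS]mulrDl; apply: lerD; last by rewrite ler_pM2l.
by rewrite -mulrA ler_pM2l// ler_wpM2l ?sqr_ge0.
Qed.

Lemma mpoly_muntz N c : muntz_space lam (mpoly N c).
Proof.
apply/muntzP; split=> [|e e0]; first exact: sqint_mpoly.
exists N, c; rewrite (eq_nsq (g := fun=> 0)) => [|t _]; last by rewrite subrr.
by rewrite /nsq ComplexField.Normc.normc0 expr0n Rintegral_cst ?mul0r ?sqr_ge0//; exact: mI01.
Qed.

End MuntzSpace.

(** * Isometry and interpolation on the Muntz space *)

Lemma dist_le_via (R : realFieldType) (a b c u v x : R) :
  a <= c + u -> c <= a + u -> b <= c + v -> c <= b + v -> u <= 2 * x -> v <= x ->
  `|a - b| <= 3 * x.
Proof. by move=> *; rewrite ler_norml; apply/andP; split; lra. Qed.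

(** The parallelogram law for two points [u], [v] whose squared distances [a],
    [b] to [g] are nearly minimal: [s] stands for [|2 g - u - v|^2] and [d]
    for [|u - v|^2]. *)
Lemma parallelogram_gap (R : realFieldType) (m s d a b ek ej : R) :
  s + d = 2 * a + 2 * b -> 4 * m <= s -> a <= m + ek -> b <= m + ej -> ej <= ek ->
  d <= 4 * ek.
Proof. by move=> *; lra. Qed.

Section MuntzIsometry.
Context {R : realType} (lam : nat -> R[i]).
Context (hlam : forall n, half_plane (- 2^-1) (lam n)).
Local Notation mu := (@lebesgue_measure R).
Local Notation D := (@I01 R).
Local Notation node := (node lam).
Local Notation mpoly := (mpoly lam).
Local Notation kpoly := (kpoly lam).
Implicit Types (f g : R -> R[i]) (t : R) (z w : R[i]) (N : nat) (c : nat -> R[i]).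

Lemma hsq_kpolyB N c N' c' :
  hsq (fun z => kpoly N c z - kpoly N' c' z) =
  nsq D (fun t => mpoly N c t - mpoly N' c' t).
Proof.
have [M [b hb]] := combo_lin (-1) N' c' N c.
have -> : (fun z => kpoly N c z - kpoly N' c' z) = kpoly M b.
  apply/funext => z; have := hb (fun n => rkernel (node n) z).
  by rewrite /= -/(kpoly _ _ _) -/(kpoly _ _ _) -/(kpoly _ _ _) => <-; rewrite mulN1r addrC.
rewrite -(nsq_mpoly hlam); apply: eq_nsq => t _; congr normc.
have := hb (fun n => cpow t (lam n)).
by rewrite /= -/(mpoly _ _ _) -/(mpoly _ _ _) -/(mpoly _ _ _) => <-; rewrite mulN1r addrC.
Qed.

Lemma xs_le n m : (n <= m)%N -> xs m <= xs n :> R.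
Proof. by move=> nm; rewrite /xs lef_pV2 ?posrE// ler_nat ltnS. Qed.

Lemma xs_cvg0 : @xs R @ \oo --> 0. Proof. exact: cvg_harmonic. Qed.

Lemma exists_xs_lt (e : R) : 0 < e -> exists n, xs n < e.
Proof.
move=> e0; have [n _ /(_ n (leqnn n)) h] := near_infty_natSinv_lt (PosNum e0).
by exists n.
Qed.

Lemma sqrt_hsqBC (f g : R[i] -> R[i]) : H2 f -> H2 g ->
  Num.sqrt (hsq f) <= Num.sqrt (hsq g) + Num.sqrt (hsq (fun z => f z - g z)).
Proof.
move=> Hf Hg; have := sqrt_hsqD Hg (H2B Hf Hg).
by under [X in hsq X]eq_fun do rewrite addrC subrK.
Qed.

Lemma hsqBC (f g : R[i] -> R[i]) : H2 f -> H2 g ->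
  hsq (fun z => f z - g z) = hsq (fun z => g z - f z).
Proof.
move=> Hf Hg; have [_] := H2Z (-1) (H2B Hg Hf).
rewrite normcN ComplexField.Normc.normc1 expr1n mul1r => <-; congr hsq.
by apply/funext => z; rewrite mulN1r opprB.
Qed.

Lemma sqrt_nsqBC f g : sqint D f -> sqint D g ->
  Num.sqrt (nsq D f) <= Num.sqrt (nsq D g) + Num.sqrt (nsq D (fun t => f t - g t)).
Proof.
move=> sf sg; have := sqrt_nsqD (@mI01 R) sg (sqintB (@mI01 R) sf sg).
by under [X in nsq D X]eq_fun do rewrite addrC subrK.
Qed.

Lemma nsqBC f g : nsq D (fun t => f t - g t) = nsq D (fun t => g t - f t).
Proof. by apply: eq_nsq => t _; rewrite normcBC. Qed.

Lemma sqrt_le_of_sqr (x y : R) : 0 <= y -> x <= y ^+ 2 -> Num.sqrt x <= y.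
Proof.
by move=> y0 h; rewrite -[leRHS]ger0_norm// -sqrtr_sqr; exact: ler_wsqrtr.
Qed.

(** The transform is isometric on combinations of powers; the closure of the
    Hardy space under bounded pointwise limits carries this over to the whole
    Muntz space. *)
Lemma muntz_isometry f : muntz_space lam f ->
  H2 (mellin f) /\ hsq (mellin f) = nsq D f.
Proof.
move=> /(muntzP hlam)[sf fM]; have mD := @mI01 R.
have /choice[p hp] : forall k, exists p : nat * (nat -> R[i]),
    nsq D (fun t => f t - mpoly p.1 p.2 t) <= xs k ^+ 2.
  by move=> k; have [N [c h]] := fM _ (xs_gt0 k); exists (N, c).
pose P k := mpoly (p k).1 (p k).2; pose Q k := kpoly (p k).1 (p k).2.
have sP k : sqint D (P k) by exact: sqint_mpoly.
have HQ k : H2 (Q k) by exact: H2_kpoly.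
have x1 k : xs k <= 1 :> R by rewrite (le_trans (xs_le (leq0n k)))// /xs invr1.
have x2 : (fun k => xs k ^+ 2 : R) @ \oo --> 0.
  by rewrite -[X in _ --> X](mulr0 0); apply: cvgM; exact: xs_cvg0.
have Qcvg z : 0 < Re z -> (Q k z : R[i]^o) @[k --> \oo] --> (mellin f z : R[i]^o).
  move=> z0; have := mellin_cvg z0 sP sf hp x2.
  by under eq_fun do rewrite mellin_mpoly//.
have QQ j k : hsq (fun z => Q j z - Q k z) <= 2 * xs j ^+ 2 + 2 * xs k ^+ 2.
  rewrite hsq_kpolyB -/(P _) -/(P _).
  rewrite (eq_nsq (g := fun t => (f t - P k t) + - (f t - P j t))); last first.
    by move=> t _; congr normc; ring.
  apply: (le_trans (nsqD_le mD (sqintB mD sf (sP k)) (sqintN mD (sqintB mD sf (sP j))))).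
  by rewrite nsqN addrC lerD// ler_pM2l//; exact: hp.
have [Hm _] : H2 (mellin f) /\ hsq (mellin f) <= 2 * nsq D f + 2.
  apply: (@H2_closure R Q) => // k.
  rewrite /Q -(nsq_mpoly hlam) -/(P k).
  rewrite (eq_nsq (g := fun t => f t + - (f t - P k t))); last first.
    by move=> t _; congr normc; ring.
  apply: (le_trans (nsqD_le mD sf (sqintN mD (sqintB mD sf (sP k))))).
  rewrite nsqN lerD2l -[leRHS]mulr1 ler_pM2l//; apply: le_trans (hp k) _.
  by rewrite expr_le1// ltW// xs_gt0.
split => //.
have mQ k : hsq (fun z => mellin f z - Q k z) <= (2 * xs k) ^+ 2.
  refine (@H2_closure R (fun j z => Q (j + k)%N z - Q k z) (fun z => mellin f z - Q k z) ((2 * xs k) ^+ 2) _ _ _).2.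
  - by move=> j; exact: H2B.
  - move=> j; apply: (le_trans (QQ _ _)).
    have h : xs (j + k)%N ^+ 2 <= xs k ^+ 2 :> R.
      by rewrite ler_sqr ?nnegrE ?(ltW (xs_gt0 _))// xs_le// leq_addl.
    by have -> : (2 * xs k) ^+ 2 = 2 * xs k ^+ 2 + 2 * xs k ^+ 2 :> R; [ring|rewrite lerD2r ler_pM2l].
  - move=> z z0; have h := Qcvg z z0.
    have hk : (Q (j + k)%N z : R[i]^o) @[j --> \oo] --> (mellin f z : R[i]^o).
      by move: h; rewrite -(cvg_shiftn k).
    exact: (@cvgC_D R (fun j => Q (j + k)%N z) (fun=> - Q k z) _ _ hk (@cvgC_cst R _)).
have key k : `|Num.sqrt (hsq (mellin f)) - Num.sqrt (nsq D f)| <= 3 * xs k.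
  have e1 : Num.sqrt (hsq (Q k)) = Num.sqrt (nsq D (P k)) by rewrite /Q -(nsq_mpoly hlam).
  have x0 := @xs_gt0 R k.
  have h1 := sqrt_hsqBC Hm (HQ k).
  have h2 := sqrt_hsqBC (HQ k) Hm; rewrite hsqBC// in h2.
  have h3 : Num.sqrt (hsq (fun z => mellin f z - Q k z)) <= 2 * xs k.
    by apply: sqrt_le_of_sqr => //; rewrite mulr_ge0// ltW.
  have h4 := sqrt_nsqBC sf (sP k).
  have h5 := sqrt_nsqBC (sP k) sf; rewrite nsqBC in h5.
  have h6 : Num.sqrt (nsq D (fun t => f t - P k t)) <= xs k.
    by apply: sqrt_le_of_sqr; [exact: ltW|exact: hp].
  by rewrite -e1 in h4 h5; exact: (dist_le_via h1 h2 h4 h5 h3 h6).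
have E : Num.sqrt (hsq (mellin f)) = Num.sqrt (nsq D f).
  apply/eqP; rewrite -subr_eq0 -normr_le0 leNgt; apply/negP => h.
  have h3 : 0 < `|Num.sqrt (hsq (mellin f)) - Num.sqrt (nsq D f)| / 3 by rewrite divr_gt0.
  have [n hn] := exists_xs_lt h3; have := key n; lra.
by rewrite -[LHS]sqr_sqrtr ?hsq_ge0// E sqr_sqrtr ?nsq_ge0.
Qed.

(** The values at the nodes are the inner products with the kernels there, so
    they are matched by the best approximation of [g] by combinations of
    kernels, the error being orthogonal to the kernels.  The corresponding
    combinations of powers converge in the mean, by isometry and completeness. *)
Lemma muntz_interpolation (g : R[i] -> R[i]) : H2 g ->
  exists2 f, muntz_space lam f & forall n, mellin f (node n) = g (node n).
Proof.
move=> Hg; have mD := @mI01 R.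
pose E := [set x | exists N c, x = hsq (fun z => g z - kpoly N c z)].
have Elb : lbound E 0 by move=> x [N [c ->]]; exact: hsq_ge0.
have E0 : E !=set0 by exists (hsq (fun z => g z - kpoly 0 (fun=> 0) z)), 0%N, (fun=> 0).
have hE : has_inf E by split => //; exists 0.
pose m := inf E.
have hm N c : m <= hsq (fun z => g z - kpoly N c z).
  by apply: ge_inf; [exists 0|exists N, c].
(* with this tolerance the parallelogram law makes the minimising sequence
   Cauchy at the rate required by [nsq_complete] *)
pose e k : R := 4^-1 * (2^-1 ^+ k) ^+ 2.
have e0 k : 0 < e k by rewrite mulr_gt0// exprn_gt0// exprn_gt0.
have /choice[p hp] : forall k, exists p : nat * (nat -> R[i]),
    hsq (fun z => g z - kpoly p.1 p.2 z) <= m + e k.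
  move=> k; have [_ [N [c ->]] h] := inf_adherent (e0 k) hE.
  by exists (N, c); exact: ltW.
pose P k := mpoly (p k).1 (p k).2; pose Q k := kpoly (p k).1 (p k).2.
have sP k : sqint D (P k) by exact: sqint_mpoly.
have HQ k : H2 (Q k) by exact: H2_kpoly.
have HgQ k : H2 (fun z => g z - Q k z) by exact: H2B.
have e_le k j : (k <= j)%N -> e j <= e k.
  move=> kj; rewrite ler_pM2l// ler_sqr ?nnegrE ?exprn_ge0//.
  by apply: ler_wiXn2l => //; rewrite invf_le1// ler1n.
have PP k j : (k <= j)%N -> nsq D (fun t => P j t - P k t) <= (2^-1 ^+ k) ^+ 2.
  move=> kj; rewrite -hsq_kpolyB -/(Q _) -/(Q _).
  have pl := hsq_parallelogram (HgQ k) (HgQ j).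
  (* half the sum of two combinations is a combination, hence at distance at
     least [m] from [g] *)
  have mid : 4 * m <= hsq (fun z => (g z - Q k z) + (g z - Q j z)).
    have [M [b hb]] := combo_lin 1 (p k).1 (p k).2 (p j).1 (p j).2.
    have HM : H2 (fun z => g z - 2^-1 * kpoly M b z).
      by have [HM _] := H2Z 2^-1 (H2_kpoly hlam M b); exact: H2B Hg HM.
    rewrite (_ : (fun z => (g z - Q k z) + (g z - Q j z)) = (fun z => 2 * (g z - 2^-1 * kpoly M b z))); last first.
      apply/funext => z; have := hb (fun n => rkernel (node n) z).
      by rewrite /= -/(kpoly _ _ _) -/(kpoly _ _ _) -/(kpoly _ _ _) -/(Q k z) -/(Q j z) => <-; field.
    have [_ ->] := H2Z 2 HM.
    have -> : normc (2 : R[i]) ^+ 2 = 4.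
      by rewrite sqr_normcE cReD cImD/=; ring.
    rewrite ler_pM2l//.
    have := hm M (fun n => 2^-1 * b n); congr (_ <= hsq _); apply/funext => z.
    by rewrite kpolyZ.
  have -> : (fun z => Q j z - Q k z) = (fun z => (g z - Q k z) - (g z - Q j z)).
    by apply/funext => z; ring.
  have -> : (2^-1 ^+ k) ^+ 2 = 4 * e k by rewrite /e; field.
  exact: (parallelogram_gap pl mid (hp k) (hp j) (e_le k j kj)).
have [f sf fP] := nsq_complete sP PP.
have h0 : (fun k => (2^-1 ^+ k) ^+ 2 : R) @ \oo --> 0.
  rewrite -[X in _ --> X](mulr0 0); apply: cvgM; apply: cvg_expr;
    by rewrite ger0_norm ?invr_ge0// invf_lt1// ltr1n.
exists f.
  apply/(muntzP hlam); split => // r r0; have r2 : 0 < r ^+ 2 by rewrite exprn_gt0.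
  have /cvgrPdist_lt/(_ _ r2)[k _ /(_ k (leqnn k))] := h0.
  rewrite /= sub0r normrN ger0_norm ?sqr_ge0// => /ltW h.
  by exists (p k).1, (p k).2; apply: le_trans (fP k) h.
move=> n; have n0 := node_gt0 hlam n; have Hk := H2_rkernel n0.
have c1 : (Q k (node n) : R[i]^o) @[k --> \oo] --> (mellin f (node n) : R[i]^o).
  have := mellin_cvg n0 sP sf fP h0.
  by under eq_fun do rewrite mellin_mpoly//.
apply: cvgC_unique c1 _.
have near_k k : normc (g (node n) - Q k (node n)) ^+ 2 <= e k * hsq (rkernel (node n)).
  have := @near_minimizer_inner R (fun z => g z - Q k z) (rkernel (node n)) m (e k) (HgQ k) Hk.
  rewrite hardy_inner_rkernel//; apply; last exact: hp.
  move=> a.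
  have [M [b hb]] := combo_lin (-1) n.+1 (fun i => if i == n then a else 0) (p k).1 (p k).2.
  have := hm M b; congr (_ <= hsq _); apply/funext => z.
  have := hb (fun i => rkernel (node i) z).
  rewrite /= -/(kpoly _ _ _) -/(kpoly _ _ _) -/(Q k z) => <-.
  rewrite big_ord_recr/= eqxx big1 ?add0r; first by rewrite opprD mulN1r opprK addrCA addrC -addrA addrC.
  by move=> i _; rewrite lt_eqF ?mul0r//; exact: ltn_ord.
apply/cvg_normcP => r r0; have r2 : 0 < r ^+ 2 by rewrite exprn_gt0.
have c2 : (fun k => e k * hsq (rkernel (node n))) @ \oo --> 0.
  rewrite -[X in _ --> X](mul0r (hsq (rkernel (node n)))); apply: cvgMr_tmp.
  by rewrite -[X in _ --> X](mulr0 4^-1); apply: cvgMl_tmp.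
have /cvgrPdist_lt/(_ _ r2) := c2; apply: filterS => k; rewrite sub0r normrN => hk.
rewrite -ltr_sqr ?nnegrE ?normc_ge0 ?(ltW r0)// normcBC.
by apply: (le_lt_trans (near_k k)); apply: le_lt_trans hk; exact: ler_norm.
Qed.

End MuntzIsometry.

(** * Blaschke products *)

Section Blaschke.
Context {R : realType} (nu : nat -> R[i]).
Context (nu_gt0 : forall n, 0 < Re (nu n)).
Implicit Types (z w : R[i]) (n N : nat).

(** The terms of the Blaschke condition. *)
Definition bweight n : R := Re (nu n) / (1 + normc (nu n) ^+ 2).

Lemma bweight_ge0 n : 0 <= bweight n.
Proof. by rewrite divr_ge0 ?(ltW (nu_gt0 n))// addr_ge0 ?sqr_ge0. Qed.

Definition bconst z : R := 2 + (1 + 2 * normc z ^+ 2) / Re z ^+ 2.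

Lemma bconst_ge0 z : 0 <= bconst z.
Proof.
by rewrite addr_ge0// divr_ge0 ?sqr_ge0// addr_ge0// mulr_ge0// sqr_ge0.
Qed.

(** At a fixed point [z] of the half plane, [|z + conj nu|^2] and [1 + |nu|^2]
    are comparable uniformly in [nu]; so the Blaschke condition controls every
    factor at every point. *)
Lemma bdenom_le n z : 0 < Re z ->
  (normc (z + conjc (nu n)) ^+ 2)^-1 <= bconst z / (1 + normc (nu n) ^+ 2).
Proof.
move=> z0; have d0 := bfactor_denom (nu_gt0 n) z0; have n0 := nu_gt0 n.
set d := normc (z + conjc (nu n)) in d0 *.
have dp : 0 < d by rewrite (lt_le_trans _ d0)// addr_gt0.
have w0 : 0 < 1 + normc (nu n) ^+ 2 by rewrite ltr_wpDr ?sqr_ge0.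
have h1 : normc (nu n) ^+ 2 <= 2 * d ^+ 2 + 2 * normc z ^+ 2.
  have -> : normc (nu n) = normc ((z + conjc (nu n)) + - z) by rewrite addrC addKr normc_conj.
  by apply: (le_trans (sqr_normcD_le _ _)); rewrite normcN.
have h2 : 1 + 2 * normc z ^+ 2 <= (1 + 2 * normc z ^+ 2) / Re z ^+ 2 * d ^+ 2.
  rewrite mulrAC ler_pdivlMr ?exprn_gt0// ler_wpM2l//.
    by rewrite addr_ge0// mulr_ge0// sqr_ge0.
  by rewrite ler_sqr ?nnegrE ?(ltW z0) ?(ltW dp)// (le_trans _ d0)// lerDl ltW.
rewrite ler_pdivlMr// mulrC ler_pdivrMr ?exprn_gt0// /bconst mulrDl; lra.
Qed.

Lemma bfactor_defect n z : 0 < Re z ->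
  1 - normc (bfactor (nu n) z) ^+ 2 <= 4 * Re z * bconst z * bweight n.
Proof.
move=> z0; rewrite bfactor_sqr// opprB addrCA subrr addr0.
rewrite -!mulrA ler_pM2l// ler_pM2l// /bweight mulrCA ler_pM2l//.
exact: bdenom_le.
Qed.

(** The numerator of the difference is [2 Re nu (z - 1)]. *)
Lemma bfactorB n z : 0 < Re z ->
  normc (bfactor (nu n) z - bfactor (nu n) 1) <=
  normc (z - 1) * (bconst 1 + bconst z) * bweight n.
Proof.
move=> z0; have n0 := nu_gt0 n; have o0 : 0 < Re (1 : R[i]) by exact: ltr01.
have d1 := bfactor_denom_neq0 n0 o0; have d2 := bfactor_denom_neq0 n0 z0.
have -> : bfactor (nu n) z - bfactor (nu n) 1 =
    (2 * Re (nu n))%:C * (z - 1) * ((1 + conjc (nu n))^-1 * (z + conjc (nu n))^-1).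
  have -> : (2 * Re (nu n))%:C = nu n + conjc (nu n).
    by apply: complexP; rewrite ?cReD ?cImD ?cReJ ?cImJ/=; ring.
  by rewrite /bfactor; field; rewrite d1 d2.
rewrite !normcM !ComplexField.Normc.normcV normc_real ger0_norm; last by rewrite mulr_ge0// ltW.
have h1 := bdenom_le n o0; have h2 := bdenom_le n z0.
set a := (normc (1 + _))^-1; set b := (normc (z + _))^-1.
have ab : a * b <= 2^-1 * ((bconst 1 + bconst z) / (1 + normc (nu n) ^+ 2)).
  rewrite mulrDl; move: h1 h2; rewrite -!exprVn -/a -/b => h1 h2.
  have := sqr_ge0 (a - b); nra.
have -> : normc (z - 1) * (bconst 1 + bconst z) * bweight n =
  2 * Re (nu n) * normc (z - 1) * (2^-1 * ((bconst 1 + bconst z) / (1 + normc (nu n) ^+ 2))).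
  by rewrite /bweight; field; rewrite gt_eqF// ltr_wpDr ?sqr_ge0.
by rewrite ler_wpM2l// !mulr_ge0 ?normc_ge0 ?(ltW n0).
Qed.

Definition bprod (alpha : nat -> R[i]) N z := \prod_(n < N) (alpha n * bfactor (nu n) z).

Section Unimodular.
Context (alpha : nat -> R[i]).
Context (alpha1 : forall n, normc (alpha n) = 1).

Lemma bterm_le1 n z : 0 < Re z -> normc (alpha n * bfactor (nu n) z) <= 1.
Proof. by move=> z0; rewrite normcM alpha1 mul1r bfactor_le1. Qed.

Lemma bprod_le1 N z : 0 < Re z -> normc (bprod alpha N z) <= 1.
Proof.
move=> z0; rewrite /bprod; elim: N => [|N IH].
  by rewrite big_ord0 ComplexField.Normc.normc1.
by rewrite big_ord_recr/= normcM mulr_ile1 ?normc_ge0// bterm_le1.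
Qed.

Lemma bprod_cdiff N z : 0 < Re z -> cdiff (bprod alpha N) z.
Proof.
move=> z0; rewrite /bprod; elim: N => [|N IH].
  by under eq_fun do rewrite big_ord0; exact: cdiff_cst.
under eq_fun do rewrite big_ord_recr/=.
apply: cdiffM; first exact: IH.
by apply: cdiffZ; exact: bfactor_cdiff.
Qed.

Lemma bfactor_eq0 n z : 0 < Re z -> (bfactor (nu n) z == 0) = (z == nu n).
Proof.
move=> z0; rewrite /bfactor mulf_eq0 invr_eq0 (negbTE (bfactor_denom_neq0 (nu_gt0 n) z0)) orbF.
by rewrite subr_eq0.
Qed.

Lemma alpha_neq0 n : alpha n != 0.
Proof. by rewrite -normc_gt0 alpha1 ltr01. Qed.

Lemma bprod_neq0 N z : 0 < Re z -> (forall n, (n < N)%N -> z != nu n) -> bprod alpha N z != 0.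
Proof.
move=> z0 zn; apply/prodf_neq0 => -[n nN] _ /=.
by rewrite mulf_neq0 ?alpha_neq0// bfactor_eq0// zn.
Qed.

Lemma bprod_node N n : (n < N)%N -> bprod alpha N (nu n) = 0.
Proof.
move=> nN; apply/eqP/prodf_eq0; exists (Ordinal nN) => //=.
by rewrite mulf_eq0 bfactor_eq0// eqxx orbT.
Qed.

Context (summable_nu : cvgn (series bweight)).

(** Off the nodes, the moduli of the partial products stay away from zero,
    because the defects [1 - |b_n(z)|^2] are summable. *)
Lemma bprod_bounded_below z : 0 < Re z -> (forall n, z != nu n) ->
  exists2 c : R, 0 < c & \forall N \near \oo, c <= normc (bprod alpha N z) ^+ 2.
Proof.
move=> z0 zn; pose K := 4 * Re z * bconst z.
have K0 : 0 <= K by rewrite !mulr_ge0 ?bconst_ge0 ?(ltW z0).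
pose dl n := 1 - normc (bfactor (nu n) z) ^+ 2.
have b1 n : normc (bfactor (nu n) z) ^+ 2 <= 1 by rewrite expr_le1 ?normc_ge0// bfactor_le1.
have dl0 n : 0 <= dl n by rewrite subr_ge0.
have dl1 n : dl n <= 1 by rewrite gerBl sqr_ge0.
have cs : cvgn (series (fun n => K * bweight n)) by exact: is_cvg_seriesZ.
have cd : cvgn (series dl).
  apply: series_le_cvg cs => // n; first by rewrite mulr_ge0// bweight_ge0.
  exact: bfactor_defect.
(* beyond [M] the defects sum to at most one half, and so do the losses of the
   remaining product *)
have [M hM] : exists M, forall N, (M <= N)%N -> \sum_(M <= n < N) dl n <= 2^-1.
  have h2 : (0 : R) < 2^-1 by [].
  have /cauchy_cvgP/cauchy_seriesP/(_ _ h2) [[A1 A2] /= [[a _ hA1] [b _ hA2]] hA] := cd.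
  exists (maxn a b) => N hN; have := hA (maxn a b, N).
  rewrite /= ger0_norm ?sumr_ge0// => /(_ _)/ltW; apply; split.
    by apply: hA1; rewrite /= leq_maxl.
  by apply: hA2; rewrite /= (leq_trans (leq_maxr a b)).
exists (normc (bprod alpha M z) ^+ 2 / 2).
  by rewrite divr_gt0// exprn_gt0// normc_gt0 bprod_neq0.
exists M => // N /= MN.
have E k : normc (bprod alpha k z) ^+ 2 = \prod_(0 <= n < k) (1 - dl n).
  rewrite big_mkord /bprod; elim: k => [|k IH].
    by rewrite !big_ord0 ComplexField.Normc.normc1 expr1n.
  by rewrite !big_ord_recr/= normcM exprMn IH normcM alpha1 mul1r /dl opprB addrCA subrr addr0.
rewrite !E (big_cat_nat (leq0n M) MN)//=; apply: ler_wpM2l.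
  by apply: prodr_ge0 => n _; rewrite subr_ge0.
have tail : forall k, (M <= k)%N -> 1 - \sum_(M <= n < k) dl n <= \prod_(M <= n < k) (1 - dl n).
  elim=> [|k IH] Mk; first by rewrite !big_geq// subr0.
  move: Mk; rewrite leq_eqVlt => /orP[/eqP <-|Mk]; first by rewrite !big_geq// subr0.
  rewrite !big_nat_recr//=.
  have {}IH := IH Mk.
  have s0 : 0 <= \sum_(M <= n < k) dl n by exact: sumr_ge0.
  have p1 : \prod_(M <= n < k) (1 - dl n) <= 1.
    by apply: prodr_ile1 => n _; rewrite subr_ge0 dl1 gerBl dl0.
  have := dl0 k; have := dl1 k; nra.
apply: le_trans (tail N MN); have := hM N MN; lra.
Qed.

End Unimodular.

(** The normalisation [alpha n * b_n(1) >= 0] makes [alpha n * b_n(z) - 1]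
    summable for every [z]. *)
Lemma blaschke_exists : cvgn (series bweight) -> exists B, blaschke_product nu B.
Proof.
move=> cw; have o0 : 0 < Re (1 : R[i]) by exact: ltr01.
pose b n := bfactor (nu n) 1.
pose alpha n : R[i] := if b n == 0 then 1 else conjc (b n) / (normc (b n))%:C.
have a1 n : normc (alpha n) = 1.
  rewrite /alpha; case: ifPn => [_|bn]; first exact: ComplexField.Normc.normc1.
  rewrite normcM ComplexField.Normc.normcV normc_conj normc_real ger0_norm ?normc_ge0// divff//.
  by rewrite normc_eq0.
have ab n : alpha n * b n = (normc (b n))%:C.
  rewrite /alpha; case: ifPn => [/eqP ->|bn]; first by rewrite mulr0 ComplexField.Normc.normc0.
  rewrite mulrAC [conjc _ * _]mulrC mulc_conj rmorphXn expr2/= mulfK//.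
  by rewrite -normc_gt0 normc_real normr_gt0 normc_eq0.
suff /choice[B hB] : forall z, exists l : R[i], 0 < Re z ->
    (bprod alpha N z : R[i]^o) @[N --> \oo] --> (l : R[i]^o).
  by exists B, alpha; split.
move=> z; have [z0|_] := ltP 0 (Re z); last by exists 0.
pose C := 4 * bconst 1 + normc (z - 1) * (bconst 1 + bconst z).
have cC : cvgn (series (fun n => C * bweight n)) by exact: is_cvg_seriesZ.
have [|l hl] := @cvgC_telescope R (fun N => bprod alpha N z) (fun n => C * bweight n) _ cC.
  move=> N; rewrite /bprod big_ord_recr/= -[X in _ - X]mulr1 -mulrBr normcM.
  apply: (@le_trans _ _ (normc (alpha N * bfactor (nu N) z - 1))).
    by rewrite ler_piMl ?normc_ge0//; exact: bprod_le1.
  have -> : alpha N * bfactor (nu N) z - 1 =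
      alpha N * (bfactor (nu N) z - b N) + ((normc (b N))%:C - 1).
    by rewrite -ab; ring.
  apply: (le_trans (le_normcD _ _)); rewrite normcM a1 mul1r /C mulrDl addrC lerD//; last exact: bfactorB.
  have -> : (normc (b N))%:C - 1 = (normc (b N) - 1)%:C by rewrite rmorphB.
  rewrite normc_real; have hb := bfactor_le1 (nu_gt0 N) o0; rewrite -/(b N) in hb.
  rewrite ler0_norm ?subr_le0// opprB.
  have := bfactor_defect N o0; rewrite -/(b N) /= mulr1 => h; apply: le_trans h.
  have := normc_ge0 (b N); nra.
by exists l.
Qed.

Section BlaschkeProduct.
Context (B : R[i] -> R[i]).
Context (summable_nu : cvgn (series bweight)).
Context (alpha : nat -> R[i]).
Context (alpha1 : forall n, normc (alpha n) = 1).
Context (bprod_cvg : forall z, 0 < Re z ->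
  (bprod alpha N z : R[i]^o) @[N --> \oo] --> (B z : R[i]^o)).

Lemma blaschke_node n : B (nu n) = 0.
Proof.
apply: cvgC_unique (bprod_cvg (nu_gt0 n)) _.
apply: cvg_near_cst; exists n.+1 => // N /= nN.
exact: bprod_node.
Qed.

Lemma blaschke_neq0 z : 0 < Re z -> (forall n, z != nu n) -> B z != 0.
Proof.
move=> z0 zn; have [c c0 hc] := bprod_bounded_below alpha1 summable_nu z0 zn.
have h : (fun N => normc (bprod alpha N z) ^+ 2) @ \oo --> normc (B z) ^+ 2.
  by apply: cvg_normc_sqr; exact: bprod_cvg.
have : c <= normc (B z) ^+ 2.
  have hcst : (fun _ : nat => c) @ \oo --> c by exact: cvg_cst.
  exact: (ler_cvg_to hcst h).
move=> h1; have := lt_le_trans c0 h1.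
by apply: contraTneq => ->; rewrite ComplexField.Normc.normc0 expr0n ltxx.
Qed.

Lemma H2_blaschkeM g : H2 g ->
  H2 (fun z => B z * g z) /\ hsq (fun z => B z * g z) <= hsq g.
Proof.
move=> Hg; have HP N := H2_bddM Hg (fun z => @bprod_cdiff alpha N z) (fun z => @bprod_le1 alpha alpha1 N z).
apply: (@H2_closure R (fun N z => bprod alpha N z * g z)).
- by move=> N; case: (HP N).
- by move=> N; case: (HP N).
- move=> z z0; exact: (@cvgC_M R (fun N => bprod alpha N z) (fun=> g z) _ _ (bprod_cvg z0) (@cvgC_cst R _)).
Qed.

Context (nu_inj : injective nu).

(** The points are distinct, so dividing out one zero of [h] leaves the others. *)
Lemma bprod_divide h N : H2 h -> (forall n, h (nu n) = 0) ->
  exists hN, [/\ H2 hN, hsq hN <= hsq h & forall z, 0 < Re z -> h z = bprod alpha N z * hN z].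
Proof.
move=> Hh hn; elim: N => [|N [hN [HN nN eN]]].
  by exists h; split => // z _; rewrite /bprod big_ord0 mul1r.
have z0 : hN (nu N) = 0.
  have /eqP := eN _ (nu_gt0 N); rewrite hn eq_sym mulf_eq0 => /orP[|/eqP//].
  rewrite (negbTE (bprod_neq0 alpha1 (nu_gt0 N) _))// => n nN'.
  by apply: contraTneq nN' => /nu_inj ->; rewrite ltnn.
have [h1 [H1 n1 e1]] := H2_divide HN (nu_gt0 N) z0.
have [Hc nc] := H2Z (conjc (alpha N)) H1.
exists (fun z => conjc (alpha N) * h1 z); split; first exact: Hc.
  by rewrite nc normc_conj alpha1 expr1n mul1r; exact: le_trans n1 nN.
move=> z zp; have aa : alpha N * conjc (alpha N) = 1 by rewrite mulc_conj alpha1 expr1n.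
rewrite eN// e1// /bprod big_ord_recr/=; set P := \prod_(i < N) _; set b := bfactor _ _.
by rewrite -[LHS]mulr1 -aa; ring.
Qed.

(** Dividing out the first [N] zeros of [h] and multiplying by [B] gives [v_N]
    in [B H^2], of no larger norm, tending to [h] pointwise.  As [v_N] is
    orthogonal to [h], the squared norm of [h + v_N] is at most [2 |h|^2],
    whereas that of the limit [2 h] is [4 |h|^2]. *)
Lemma vanishing_orthogonal_eq0 h : H2 h -> (forall n, h (nu n) = 0) ->
  (forall g, H2 g -> hardy_inner h (fun z => B z * g z) = 0) ->
  forall z, 0 < Re z -> h z = 0.
Proof.
move=> Hh hn ho.
have /choice[hN hNP] := fun N => bprod_divide N Hh hn.
pose v N z := B z * hN N z.
have Hv N : H2 (v N) /\ hsq (v N) <= hsq h.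
  have [H1 n1 _] := hNP N; have [H2' n2] := H2_blaschkeM H1.
  by split => //; exact: le_trans n1.
have vcvg z : 0 < Re z -> (v N z : R[i]^o) @[N --> \oo] --> (h z : R[i]^o).
  move=> z0; have [[n zn]|zn] := pselect (exists n, z = nu n).
    rewrite zn hn (_ : (fun N => _) = (fun=> 0)); first exact: cvgC_cst.
    by apply/funext => N; rewrite /v blaschke_node mul0r.
  have {}zn n : z != nu n by apply/eqP => e; apply: zn; exists n.
  have Bz := blaschke_neq0 z0 zn.
  have Pz N : bprod alpha N z != 0 by exact: bprod_neq0.
  rewrite (_ : (fun N => _) = (fun N => (B z * h z) * (bprod alpha N z)^-1)); last first.
    apply/funext => N; have [_ _ e] := hNP N; rewrite /v e// -mulrA; congr (_ * _).
    by rewrite mulrC mulKf.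
  have e : (B z * h z) * (B z)^-1 = h z by rewrite mulrC mulKf.
  rewrite -[X in _ --> X]e.
  by apply: cvgC_Ml; apply: (@cvgV R[i] nat \oo _ _ _ Bz (bprod_cvg z0)).
have [_ le2] : H2 (fun z => h z + h z) /\ hsq (fun z => h z + h z) <= 2 * hsq h.
  apply: (@H2_closure R (fun N z => h z + v N z)).
  - by move=> N; have [Hvn _] := Hv N; have [] := H2D Hh Hvn.
  - move=> N; have [Hvn nv] := Hv N; have [H1 _ _] := hNP N.
    rewrite hsqD// ho// mulr0 addr0; lra.
  - move=> z z0; exact: (@cvgC_D R (fun=> h z) (fun N => v N z) _ _ (@cvgC_cst R _) (vcvg z z0)).
have h0 : hsq h = 0.
  move: le2; rewrite hsqD// hardy_inner_self//=; have := hsq_ge0 h; lra.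
move=> z z0; have := H2_eval_le Hh z0; rewrite h0 pmulr_lle0// => hz.
by apply/eqP; rewrite -normc_eq0 -sqrf_eq0 eq_le hz sqr_ge0.
Qed.

End BlaschkeProduct.

End Blaschke.

(** * The Muntz space and the model space *)

Section ModelSpace.
Context {R : realType} (lam : nat -> R[i]).
Context (hlam : forall n, half_plane (- 2^-1) (lam n)).
Local Notation mu := (@lebesgue_measure R).
Local Notation D := (@I01 R).
Local Notation node := (node lam).
Local Notation mpoly := (mpoly lam).
Local Notation kpoly := (kpoly lam).
Implicit Types (f g : R -> R[i]) (t : R) (z w : R[i]).

Lemma ae_impl (P Q : R -> Prop) : (forall t, P t -> Q t) ->
  {ae mu, forall t, P t} -> {ae mu, forall t, Q t}.
Proof.
move=> PQ [A [mA A0 sA]]; exists A; split => // t /= nQ; apply: sA => /= Pt.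
by apply: nQ; exact: PQ.
Qed.

Lemma nsq_eq0P f : sqint D f ->
  nsq D f = 0 <-> {ae mu, forall t, D t -> f t = 0}.
Proof.
move=> sf; have mD := @mI01 R; have [mf _] := sf.
have mn : measurable_fun D (fun t => (normc (f t) ^+ 2)%:E).
  by apply/measurable_EFinP; exact: (measurable_normc_sqr mf).
have E : (\int[mu]_(t in D) `|(normc (f t) ^+ 2)%:E|)%E = (nsq D f)%:E.
  by rewrite -nsqE//; apply: eq_integral => t _; rewrite gee0_abs// lee_fin sqr_ge0.
have [h1 h2] := ae_eq_integral_abs mu mD mn; split=> [n0|af].
  have := h1 _; rewrite E n0 => /(_ erefl); apply: filterS => t h Dt.
  by have /eqP := h Dt; rewrite /= eqe sqrf_eq0 normc_eq0 => /eqP.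
suff : (nsq D f)%:E = 0%E by move=> /eqP; rewrite eqe => /eqP.
rewrite -E; apply: h2; apply: ae_impl af => t h Dt.
by rewrite /= h// ComplexField.Normc.normc0 expr0n.
Qed.

Lemma l2eqP f g : sqint D f -> sqint D g ->
  l2eq f g <-> nsq D (fun t => f t - g t) = 0.
Proof.
move=> sf sg; rewrite (nsq_eq0P (sqintB (@mI01 R) sf sg)).
split; apply: ae_impl => t h Dt; first by rewrite h// subrr.
by apply/eqP; rewrite -subr_eq0 h.
Qed.

Lemma h2eqP (F G : R[i] -> R[i]) : h2eq F G <-> forall z, 0 < Re z -> F z = G z.
Proof.
by split=> h z; [move=> z0; apply: h; rewrite inE|rewrite inE; exact: h].
Qed.

Lemma hsq_eq0P (F : R[i] -> R[i]) : H2 F -> hsq F = 0 <-> forall z, 0 < Re z -> F z = 0.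
Proof.
move=> HF; split=> [h z z0|h].
  have := H2_eval_le HF z0; rewrite h pmulr_lle0// => hz.
  by apply/eqP; rewrite -normc_eq0 -sqrf_eq0 eq_le hz sqr_ge0.
have [H0 e0] := @H2_0 R.
by have [_ ->] := @eq_H2 R (fun=> 0) F (fun z hz => esym (h z hz)) H0.
Qed.

Lemma muntzB f g : muntz_space lam f -> muntz_space lam g ->
  muntz_space lam (fun t => f t - g t).
Proof.
move=> fM gM; rewrite (_ : (fun t => f t - g t) = (fun t => -1 * g t + f t)).
  exact: muntz_lin.
by apply/funext => t; rewrite mulN1r addrC.
Qed.

(** Almost everywhere equality of [f] and [g], and equality of their
    transforms, both amount to the vanishing of this number. *)
Lemma hsq_mellinB f g : muntz_space lam f -> muntz_space lam g ->
  H2 (fun z => mellin f z - mellin g z) /\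
  hsq (fun z => mellin f z - mellin g z) = nsq D (fun t => f t - g t).
Proof.
move=> fM gM; have [Hm em] := muntz_isometry hlam (muntzB fM gM).
have [H1 e1] := @eq_H2 R _ (fun z => mellin f z - mellin g z)
  (fun z hz => mellinB (muntz_sqint hlam fM) (muntz_sqint hlam gM) hz) Hm.
by split; [exact: H1|exact: etrans e1 em].
Qed.

(** A function vanishing at the nodes is orthogonal to the kernels there, hence
    to the transforms of combinations of powers, hence to all transforms. *)
Lemma mellin_orthogonal f v : muntz_space lam f -> H2 v ->
  (forall n, v (node n) = 0) -> hardy_inner (mellin f) v = 0.
Proof.
move=> fM Hv v0; have [Hm _] := muntz_isometry hlam fM.
have key n : normc (hardy_inner (mellin f) v) ^+ 2 <= xs n ^+ 2 * hsq v.
  have [sf /(_ _ (xs_gt0 n))[N [c hc]]] := (muntzP hlam f).1 fM.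
  have [Hd ed] := hsq_mellinB fM (mpoly_muntz hlam N c).
  have HQ := H2_kpoly hlam N c.
  have [Hd' ed'] := @eq_H2 R _ (fun z => mellin f z - kpoly N c z) (fun z hz =>
    congr1 (fun x => mellin f z - x) (mellin_mpoly hlam N c hz)) Hd.
  have Q0 : hardy_inner (kpoly N c) v = 0.
    rewrite (hardy_inner_conj Hv HQ).
    have -> : hardy_inner v (kpoly N c) = _ := hardy_inner_sumr N c Hv
      (fun i => H2_rkernel (node_gt0 hlam i)).
    rewrite big1 ?conjc0// => i _.
    by rewrite hardy_inner_rkernel ?node_gt0// v0 mulr0.
  have fE : mellin f = (fun z => (mellin f z - kpoly N c z) + kpoly N c z).
    by apply/funext => z; rewrite subrK.
  have E : hardy_inner (mellin f) v = hardy_inner (fun z => mellin f z - kpoly N c z) v.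
    apply: (etrans (congr1 (fun F => hardy_inner F v) fE)).
    apply: (etrans (hardy_innerDl Hd' HQ Hv)).
    exact: (etrans (congr1 (fun x => _ + x) Q0) (addr0 _)).
  rewrite E.
  apply: le_trans (hardy_inner_CS Hd' Hv) _.
  by rewrite ed' ed ler_wpM2r ?hsq_ge0.
have x2 : (fun k => xs k ^+ 2 * hsq v) @ \oo --> 0.
  rewrite -[X in _ --> X](mul0r (hsq v)); apply: cvgMr_tmp.
  by rewrite -[X in _ --> X](mulr0 0); apply: cvgM; exact: xs_cvg0.
have cs : (fun _ : nat => normc (hardy_inner (mellin f) v) ^+ 2) @ \oo -->
  normc (hardy_inner (mellin f) v) ^+ 2 by exact: cvg_cst.
have h : normc (hardy_inner (mellin f) v) ^+ 2 <= 0.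
  by apply: (ler_cvg_to cs x2); apply: nearW.
by apply/eqP; rewrite -normc_eq0 -sqrf_eq0 eq_le h sqr_ge0.
Qed.

Lemma node_inj : injective lam -> injective node.
Proof.
move=> li m n /addIr/(congr1 conjc); rewrite !conjcK; exact: li.
Qed.

Lemma bweight_node n : bweight node n =
  (2^-1 + Re (lam n)) / (1 + normc (lam n + 2^-1) ^+ 2).
Proof.
rewrite /bweight /node cReD cReJ Re_half addrC; congr (_ / (1 + _ ^+ 2)).
rewrite -[RHS]normc_conj; congr normc.
have -> : (2^-1 : R[i]) = (2^-1 : R)%:C by rewrite fmorphV rmorph_nat.
by apply: complexP; rewrite ?cReJ ?cImJ ?cReD ?cImD ?cReJ ?cImJ/=; ring.
Qed.

End ModelSpace.

Theorem theorem2p3 (R : realType) (lam : nat -> R[i])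
    (lam_inj : injective lam)
    (lam_half_plane : forall n, half_plane (- 2^-1) (lam n))
    (lam_sum : (\sum_(0 <= n <oo)
        ((2^-1 + complex.Re (lam n)) /
         (1 + (normc (lam n + 2^-1)) ^+ 2))%:E < +oo)%E) :
  let nu := fun n => (lam n)^* + 2^-1 in
  (exists B, blaschke_product nu B) /\
  forall B, blaschke_product nu B ->
    isometric_isomorphism
      (muntz_space lam) (@l2eq R) (@l2norm R)
      (model_space B) (@h2eq R) (@hardy_norm R)
      (@mellin R).
Proof.
have n0 := node_gt0 lam_half_plane; have ninj := node_inj lam_inj.
have cw : cvgn (series (bweight (node lam))).
  apply: cvgn_series_fin => [n|]; first exact: bweight_ge0.
  by under eq_eseriesr do rewrite bweight_node.
move=> nu; change nu with (node lam) => {nu}.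
split=> [|B [alpha [a1 aB]]]; first exact: blaschke_exists.
have cB z : 0 < Re z -> (bprod (node lam) alpha N z : R[i]^o) @[N --> \oo] --> (B z : R[i]^o).
  by move=> z0; exact: (aB z z0).
have HB g (Hg : H2 g) := H2_blaschkeM n0 a1 cB Hg.
have M_K f : muntz_space lam f -> model_space B (mellin f).
  move=> fM; split; first by have [] := muntz_isometry lam_half_plane fM.
  move=> g Hg; have [Hv _] := HB g Hg.
  apply: (mellin_orthogonal lam_half_plane fM Hv) => n.
  by rewrite (blaschke_node n0 cB) mul0r.
split => //.
- move=> f g fM gM; have [Hd ed] := hsq_mellinB lam_half_plane fM gM.
  have sf := muntz_sqint lam_half_plane fM; have sg := muntz_sqint lam_half_plane gM.
  split=> [/(l2eqP sf sg) h|/h2eqP h].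
    apply/h2eqP => z z0; apply/eqP; rewrite -subr_eq0; apply/eqP.
    by apply: (hsq_eq0P Hd).1 z0; exact: etrans ed h.
  apply/(l2eqP sf sg); apply: etrans (esym ed) _; apply: (hsq_eq0P Hd).2 => z z0.
  by rewrite h// subrr.
- move=> a f g fM gM; apply/h2eqP => z z0.
  by apply: mellin_lin => //; exact: (muntz_sqint lam_half_plane).
- move=> f fM; have [Hm em] := muntz_isometry lam_half_plane fM.
  by rewrite hardy_normE// em l2normE//; exact: (muntz_sqint lam_half_plane).
- move=> g [Hg go]; have [f fM fg] := muntz_interpolation lam_half_plane Hg.
  exists f => //; apply/h2eqP => z z0; have [Hm mo] := M_K f fM.
  have orth u : H2 u -> hardy_inner (fun w => g w - mellin f w) (fun w => B w * u w) = 0.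
    move=> Hu; have [Hv _] := HB u Hu; have [HmN _] := H2Z (-1) Hm.
    have -> : (fun w => g w - mellin f w) = (fun w => g w + -1 * mellin f w).
      by apply/funext => w; rewrite mulN1r.
    apply: (etrans (hardy_innerDl Hg HmN Hv)).
    have -> := hardy_innerZl (-1) Hm Hv.
    by rewrite (go u Hu) (mo u Hu) mulr0 addr0.
  have zeros n : g (node lam n) - mellin f (node lam n) = 0 by rewrite fg subrr.
  have := vanishing_orthogonal_eq0 n0 cw a1 cB ninj (H2B Hg Hm) zeros orth z0.
  by move=> /eqP; rewrite subr_eq0 => /eqP ->.
Qed.
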